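(* Let $0<|q|<1$. Then, as an identity modulo $(1-P)^4$ of meromorphic functions of $Q$ on the annulus $|q|^2<|Q|<1$, $$P^{\ell_q(Q)}\sum_{d=0}^\infty\frac{\prod_{i=1}^4(Pq^{\frac i5};q)_d}{(Pq;q)_d^4}Q^d=P^{\ell_q(Q)}\frac{\prod_{i=1}^4(Pq^{\frac i5};q)_\infty}{(Pq;q)_\infty^4}\sum_{j=1}^4\frac{\big(q,q,Pq^{\frac j5}Q,q/(Pq^{\frac j5}Q);q\big)_\infty}{\big(Pq^{\frac j5},q/(Pq^{\frac j5}),Q,q/Q;q\big)_\infty}\cdot\frac{(q^{-\frac j5}q;q)^4_\infty\,e^{-1}_{q,q^{j/5}}(1/Q)}{\prod_{i=1,i\neq j}^4(q^{\frac{i-j}5};q)_\infty\,(q;q)_\infty}\,W_j(1/Q),$$ where $$W_1(1/Q)=e_{q,q^{1/5}}(1/Q)\;{}_4\phi_3\big(q^{\frac15},q^{\frac15},q^{\frac15},q^{\frac15};q^{\frac45},q^{\frac35},q^{\frac25};q;q^2/Q\big),$$ $$W_2(1/Q)=e_{q,q^{2/5}}(1/Q)\;{}_4\phi_3\big(q^{\frac25},q^{\frac25},q^{\frac25},q^{\frac25};q^{\frac65},q^{\frac45},q^{\frac35};q;q^2/Q\big),$$ $$W_3(1/Q)=e_{q,q^{3/5}}(1/Q)\;{}_4\phi_3\big(q^{\frac35},q^{\frac35},q^{\frac35},q^{\frac35};q^{\frac75},q^{\frac65},q^{\frac45};q;q^2/Q\big),$$ $$W_4(1/Q)=e_{q,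q^{4/5}}(1/Q)\;{}_4\phi_3\big(q^{\frac45},q^{\frac45},q^{\frac45},q^{\frac45};q^{\frac85},q^{\frac75},q^{\frac65};q;q^2/Q\big).$$
   Context: A fifth root $q^{1/5}$ of $q$ is fixed and $q^{i/5}=(q^{1/5})^i$. $(a;q)_d=\prod_{k=0}^{d-1}(1-aq^k)$ for $d\in\mathbb{N}\cup\{\infty\}$, $(a_1,\dots,a_r;q)_d=\prod_i(a_i;q)_d$, and ${}_4\phi_3(a_1,a_2,a_3,a_4;b_1,b_2,b_3;q;x)=\sum_{d\ge0}\frac{(a_1,a_2,a_3,a_4;q)_d}{(q,b_1,b_2,b_3;q)_d}x^d$. Identities are in $K(\mathbb{P}^3)\otimes\mathbb{C}=\mathbb{C}[P]/((1-P)^4)$, $P=\mathcal{O}(-1)$: a function of $P$ holomorphic near $P=1$ is replaced by its Taylor expansion in $1-P$ modulo $(1-P)^4$, and equality is coefficientwise. $\theta_q(Q)=\sum_{d\in\mathbb{Z}}q^{d(d-1)/2}Q^d$; $\ell_q(Q)=-Q\theta_q'(Q)/\theta_q(Q)$; $P^{\ell_q(Q)}:=\sum_{a\ge0}(-1)^a\binom{\ell_q(Q)}{a}(1-P)^a$ with $\binom{\ell}{a}=\frac1{a!}\prod_{r=0}^{a-1}(\ell-r)$; $e_{q,\lambda}(Q)=\theta_q(Q)/\theta_q(\lambda Q)$, $e_{q,\lambda}^{-1}=1/e_{q,\lambda}$. *)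

(* Defs.v *)
From HB Require Import structures.
From mathcomp Require Import all_boot all_order all_algebra complex.
From mathcomp Require Import all_classical all_reals all_analysis.

Set Implicit Arguments.
Unset Strict Implicit.
Unset Printing Implicit Defensive.

Import Order.TTheory GRing.Theory Num.Theory numFieldNormedType.Exports.
Local Open Scope classical_set_scope.
Local Open Scope ring_scope.

(* R[i] packed as a numClosedFieldType: the bare carrier R[i] does not inherit
   the generic topology and norm of number fields, [Cx R] does.  Accordingly,
   [limn], [derivable _ _ 1] and [derive1n] below are complex limits and complex
   derivatives. *)
Definition Cx (R : realType) : numClosedFieldType := R[i].

Section QSeries.
Variable R : realType.
Local Notation C := (Cx R).
Implicit Types a b q x l Q : C.

Definition csum (u : nat -> C) : C := limn (series u).

Definition csumZ (u : int -> C) : C :=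
  csum (fun n => u (Posz n)) + csum (fun n => u (Negz n)).

Definition qpoch a q (d : nat) : C := \prod_(0 <= k < d) (1 - a * q ^+ k).

Definition qpoch_oo a q : C := limn (qpoch a q).

Definition qpochs (s : seq C) q (d : nat) : C := \prod_(a <- s) qpoch a q d.

Definition qpochs_oo (s : seq C) q : C := \prod_(a <- s) qpoch_oo a q.

Definition phi43 a1 a2 a3 a4 b1 b2 b3 q x : C :=
  csum (fun d => qpochs [:: a1; a2; a3; a4] q d
                 / qpochs [:: q; b1; b2; b3] q d * x ^+ d).

(* The exponent d(d-1)/2 is a nonnegative integer for every d in Z. *)
Definition theta q Q : C :=
  csumZ (fun d : int => q ^ ((d * (d - 1)) %/ 2)%Z * Q ^ d).

Definition ell q Q : C := - Q * derive1 (theta q) Q / theta q Q.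

Definition eqlam q (lam : C) Q : C := theta q Q / theta q (lam * Q).

Definition cbinom l (a : nat) : C :=
  (\prod_(0 <= r < a) (l - r%:R)) / a`!%:R.

End QSeries.

(* K(P^3) tensor C = C[P]/((1-P)^4), presented as C[X]/(X^4) with X = 1 - P;
   elements are represented by polynomials in X of degree at most 3. *)
Definition KP3 (R : realType) := {poly %/ ('X^4 : {poly Cx R})}.

(* Since P = 1 - X, the coefficient of X^k is (-1)^k f^(k)(1) / k!. *)
Definition taylorP (R : realType) (f : Cx R -> Cx R) : KP3 R :=
  in_qpoly 'X^4 (\poly_(k < 4) ((-1) ^+ k * derive1n k f 1 / k`!%:R)).

Definition Ppow (R : realType) (l : Cx R) : KP3 R :=
  in_qpoly 'X^4 (\poly_(a < 4) ((-1) ^+ a * cbinom l a)).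

Section Meromorphic.
Variable R : realType.
Local Notation C := (Cx R).

Definition holomorphic_near (f : C -> C) (z : C) : Prop :=
  \forall w \near z, derivable f w 1.

Definition meromorphic_on (D : set C) (f : C -> C) : Prop :=
  forall z, D z -> exists (n : nat) (g : C -> C),
    holomorphic_near g z /\ \forall w \near z^', f w = g w / (w - z) ^+ n.

(* Meromorphic functions are represented by total functions whose values at
   poles (division by zero) are meaningless, so they are compared on a
   punctured neighbourhood of every point, i.e. off a discrete set. *)
Definition mero_eq (D : set C) (f g : C -> C) : Prop :=
  [/\ meromorphic_on D f, meromorphic_on D g
    & forall z, D z -> \forall w \near z^', f w = g w].

Definition mero_eqK (D : set C) (F G : C -> KP3 R) : Prop :=
  forall k : 'I_4,
    mero_eq D (fun Q => (F Q : {poly C})`_k) (fun Q => (G Q : {poly C})`_k).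

End Meromorphic.

(* W_j as a function of its argument y = 1/Q; r is the fixed fifth root of q. *)
Definition Wfun (R : realType) (q r : Cx R) (j : nat) (y : Cx R) : Cx R :=
  match j with
  | 1 => eqlam q (r ^+ 1) y *
         phi43 (r ^+ 1) (r ^+ 1) (r ^+ 1) (r ^+ 1) (r ^+ 4) (r ^+ 3) (r ^+ 2)
           q (q ^+ 2 * y)
  | 2 => eqlam q (r ^+ 2) y *
         phi43 (r ^+ 2) (r ^+ 2) (r ^+ 2) (r ^+ 2) (r ^+ 6) (r ^+ 4) (r ^+ 3)
           q (q ^+ 2 * y)
  | 3 => eqlam q (r ^+ 3) y *
         phi43 (r ^+ 3) (r ^+ 3) (r ^+ 3) (r ^+ 3) (r ^+ 7) (r ^+ 6) (r ^+ 4)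
           q (q ^+ 2 * y)
  | 4 => eqlam q (r ^+ 4) y *
         phi43 (r ^+ 4) (r ^+ 4) (r ^+ 4) (r ^+ 4) (r ^+ 8) (r ^+ 7) (r ^+ 6)
           q (q ^+ 2 * y)
  | _ => 0
  end.

(* Main.v *)
Require Import Defs.
From mathcomp Require Import all_boot all_order all_algebra complex.
From mathcomp Require Import all_classical all_reals all_analysis.
From mathcomp Require Import ring lra zify.

Import Order.TTheory GRing.Theory Num.Theory numFieldNormedType.Exports.
Local Open Scope classical_set_scope.
Local Open Scope ring_scope.

(** The theorem is a connection formula between series in Q and series in 1/Q.
Its proof is a residue computation in an auxiliary variable x that is carried
out first for rational functions and then passed to the limit.

Put a_i = P q^(i/5) and b = P q. The coefficient of Q^d in the left-hand
series is, up to a constant, the value at x = q^d of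
G(x) = (b x;q)_oo^4 / prod_i (a_i x;q)_oo. Multiply G by a ratio of theta
functions in Q and x with simple poles at the powers of q, whose residue at
q^d is proportional to Q^d. The residues at the powers of q then add up to the
bilateral series of the G(q^d) Q^d, and the residues at the poles
x = q^(-m)/a_j of G add up, for each j, to a theta quotient times a 4phi3 in
q^2/Q. The sum of all residues is zero. To prove this without contour
integrals, all infinite products are truncated: [residue_sum] is Lagrange
interpolation, [finite_identity] is the truncated identity, and [tannery]
(dominated convergence for series, with geometric dominators on
|q|^2 < |Q| < 1) gives the limit, [bilateral]. Both the truncated identity and
the dominators are available on the whole annulus, so no analytic
continuation in Q occurs.

The half of the bilateral series with d < 0 is absent from the theorem. Each
of its terms contains the factor 1 - 1/P from (b q^d;q)_oo to the fourth
power, so this half is (P - 1)^4 times a function analytic at P = 1, and it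
does not contribute modulo (1 - P)^4 ([connection_near_1] and
[taylorP_perturb]).

Taylor coefficients in P are handled through expansions
f(c + h) = sum_n alpha_n h^n for which sum_n |alpha_n| rho^n is bounded by an
explicit constant. This norm is submultiplicative, so it stays bounded along
the partial q-products, the series over d can be expanded coefficientwise
([expansion_csum]), and the iterated derivatives at the centre are the
n! alpha_n ([expansion_derive1n]). It also follows that the coefficients of
the left-hand side are power series in Q.

It remains to treat the prefactor and the exceptional points. The triple
product identity ([jacobi]) shows that theta vanishes only on the discrete
lattice -q^Z; hence its logarithmic derivative is meromorphic ([mero_ell]), and
near every point of the annulus, the point itself excepted, none of the
functions of Q in the statement degenerates ([near_off_lattice]). Meromorphy
of the right-hand side is inherited from the left-hand side. *)

Set Implicit Arguments.
Unset Strict Implicit.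
Unset Printing Implicit Defensive.

(** * Absolute value and convergence in the complex field *)

Section Modulus.
Variable R : realType.
Local Notation C := (Cx R).
Implicit Types x y z : C.

(** The order on the complex field is only partial; a real-valued modulus
gives access to the real analysis. *)
Definition cabs x : R := complex.Re `|x|.

Lemma cabsE x : `|x| = real_complex R (cabs x) :> C.
Proof. by rewrite /cabs RRe_real // normr_real. Qed.

Lemma cabs_ge0 x : 0 <= cabs x.
Proof. by rewrite -ler0c -cabsE normr_ge0. Qed.

Lemma cabsM x y : cabs (x * y) = cabs x * cabs y.
Proof. by apply: complexI; rewrite -cabsE normrM !cabsE rmorphM. Qed.

Lemma cabsD x y : cabs (x + y) <= cabs x + cabs y.
Proof. by rewrite -lecR rmorphD /= -!cabsE ler_normD. Qed.

Lemma cabsN x : cabs (- x) = cabs x.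
Proof. by rewrite /cabs normrN. Qed.

Lemma cabs0 : cabs 0 = 0. Proof. by rewrite /cabs normr0. Qed.

Lemma cabs1 : cabs 1 = 1. Proof. by rewrite /cabs normr1. Qed.

Lemma cabs_eq0 x : (cabs x == 0) = (x == 0).
Proof. by rewrite -(inj_eq (@complexI R)) -cabsE normr_eq0. Qed.

Lemma cabs_gt0 x : (0 < cabs x) = (x != 0).
Proof. by rewrite lt_def cabs_ge0 cabs_eq0 andbT. Qed.

Lemma cabsB x y : cabs (x - y) <= cabs x + cabs y.
Proof. by rewrite -(cabsN y) cabsD. Qed.

Lemma cabsC x y : cabs (x - y) = cabs (y - x).
Proof. by rewrite -cabsN opprB. Qed.

Lemma cabs_dist x y : cabs x - cabs y <= cabs (x - y).
Proof. by rewrite lerBlDr -{1}(subrK y x) cabsD. Qed.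

Lemma cabsX x n : cabs (x ^+ n) = cabs x ^+ n.
Proof. by elim: n => [|n IH]; rewrite ?expr0 ?cabs1 // !exprS cabsM IH. Qed.

Lemma cabsV x : cabs x^-1 = (cabs x)^-1.
Proof. by apply: complexI; rewrite -cabsE normfV cabsE fmorphV. Qed.

Lemma cabs_prod I (r : seq I) (P : pred I) (F : I -> C) :
  cabs (\prod_(i <- r | P i) F i) = \prod_(i <- r | P i) cabs (F i).
Proof. exact: (big_morph cabs cabsM cabs1). Qed.

Lemma cabs_sum I (r : seq I) (P : pred I) (F : I -> C) :
  cabs (\sum_(i <- r | P i) F i) <= \sum_(i <- r | P i) cabs (F i).
Proof.
elim/big_ind2 : _ => [|x a y b h1 h2|//]; first by rewrite cabs0.
by apply: le_trans (cabsD _ _) _; exact: lerD.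
Qed.

Lemma cabs_real (x : R) : cabs (real_complex R x) = `|x|.
Proof. by rewrite /cabs normc_def /= expr0n /= addr0 sqrtr_sqr. Qed.

Lemma cabs_nat n : cabs n%:R = n%:R.
Proof. by rewrite -(rmorph_nat (real_complex R)) cabs_real normr_nat. Qed.

Lemma Re_le_cabs x : `|complex.Re x| <= cabs x.
Proof.
rewrite /cabs normc_def /= -sqrtr_sqr ler_wsqrtr // lerDl sqr_ge0 //.
Qed.

Lemma Im_le_cabs x : `|complex.Im x| <= cabs x.
Proof.
rewrite /cabs normc_def /= -sqrtr_sqr ler_wsqrtr // lerDr sqr_ge0 //.
Qed.

Lemma cabs_le_ReIm x : cabs x <= `|complex.Re x| + `|complex.Im x|.
Proof.
rewrite [in cabs x](complexE x); apply: le_trans (cabsD _ _) _.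
rewrite cabsM !cabs_real (_ : cabs _ = 1) ?mul1r //.
by rewrite /cabs normc_def /= expr0n /= expr1n add0r sqrtr1.
Qed.

Lemma normC_lt x (e : R) : (`|x| < real_complex R e) = (cabs x < e).
Proof. by rewrite cabsE ltcR. Qed.

Lemma norm0Bcabs x : `|0 - cabs x| = cabs x.
Proof. by rewrite sub0r normrN ger0_norm ?cabs_ge0. Qed.

(** Reduces every complex limit to the limit of a real, nonnegative function.
*)
Lemma cvgCP {T : Type} {F : set_system T} {FF : Filter F} (f : T -> C) (l : C) :
  f @ F --> l <-> (cabs (f t - l)) @[t --> F] --> (0 : R).
Proof.
split=> [/cvgrPdist_lt h | /cvgrPdist_lt h].
  apply/cvgrPdist_lt => e e0.
  have e0' : (0 : C) < real_complex R e by rewrite -[0]/(real_complex R 0) ltcR.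
  have := h _ e0'; apply: filterS => t.
  by rewrite norm0Bcabs normC_lt cabsC.
apply/cvgrPdist_lt => e e0.
have er : e = real_complex R (complex.Re e) by rewrite RRe_real // gtr0_real.
have e0' : 0 < complex.Re e by move: e0; rewrite er -[0]/(real_complex R 0) ltcR.
have := h _ e0'; apply: filterS => t.
by rewrite norm0Bcabs er normC_lt cabsC.
Qed.

Lemma cvg_cabs {T : Type} {F : set_system T} {FF : Filter F} (f : T -> C) (l : C) :
  f @ F --> l -> cabs (f t) @[t --> F] --> cabs l.
Proof.
move=> /cvgCP h; apply/cvgrPdist_lt => e e0.
move/cvgrPdist_lt: h => /(_ _ e0); apply: filterS => t.
rewrite norm0Bcabs => h; apply: le_lt_trans h.
by rewrite ler_norml cabsC cabs_dist andbT lerNl opprB cabsC cabs_dist.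
Qed.

(** Real radii are enough to describe complex neighbourhoods, since a complex
radius that is positive is real. *)
Lemma nearC (z : C) (P : C -> Prop) :
  (\forall w \near z, P w) <-> exists2 e : R, 0 < e & forall w, cabs (w - z) < e -> P w.
Proof.
split=> [/nbhs_ballP[e /= e0 h] | [e e0 h]].
  have er : e = real_complex R (complex.Re e) by rewrite RRe_real // gtr0_real.
  have e0' : 0 < complex.Re e by move: e0; rewrite er -[0]/(real_complex R 0) ltcR.
  exists (complex.Re e) => // w hw; apply: h.
  by rewrite -ball_normE /= er normC_lt cabsC.
apply/nbhs_ballP; exists (real_complex R e).
  by rewrite /= -[0]/(real_complex R 0) ltcR.
by move=> w; rewrite -ball_normE /= normC_lt cabsC => /h.
Qed.

Lemma near_dnbhsC (z : C) (P : C -> Prop) :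
  (\forall w \near z^', P w) <->
  exists2 e : R, 0 < e & forall w, cabs (w - z) < e -> w != z -> P w.
Proof. exact: (nearC z (fun w => w != z -> P w)). Qed.

End Modulus.

(** * Series dominated by a geometric series *)

Section DominatedSeries.
Variable R : realType.
Local Notation C := (Cx R).
Implicit Types (u v : nat -> C) (M s : R).

Lemma cvgnC (u : nat -> C) (l : C) (b : nat -> R) :
  (forall n, cabs (u n - l) <= b n) -> b @ \oo --> 0 -> u @ \oo --> l.
Proof.
move=> h hb; apply/cvgCP; apply: (@squeeze_cvgr _ _ _ _ (cst 0) b) => //.
  by apply: nearW => n; rewrite cabs_ge0 h.
exact: cvg_cst.
Qed.

Lemma cvgDC {T : Type} {F : set_system T} {FF : Filter F} (f g : T -> C) (a b : C) :
  f @ F --> a -> g @ F --> b -> (fun t => f t + g t) @ F --> a + b.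
Proof. exact: cvgD. Qed.

Lemma cvgMC {T : Type} {F : set_system T} {FF : Filter F} (f g : T -> C) (a b : C) :
  f @ F --> a -> g @ F --> b -> (fun t => f t * g t) @ F --> a * b.
Proof. exact: cvgM. Qed.

Lemma cvgZC {T : Type} {F : set_system T} {FF : Filter F} (k : C) (g : T -> C) (b : C) :
  g @ F --> b -> (fun t => k * g t) @ F --> k * b.
Proof. by apply: cvgMC; exact: cvg_cst. Qed.

Lemma cvg_geomr (M s : R) : 0 <= s < 1 -> (fun n => M * s ^+ n) @ \oo --> 0.
Proof. by case/andP=> s0 s1; apply: cvg_geometric; rewrite ger0_norm. Qed.

Lemma cvg_exprC (z : C) : cabs z < 1 -> (fun n => z ^+ n) @ \oo --> 0.
Proof.
move=> z1; apply: (@cvgnC _ _ (fun n => 1 * cabs z ^+ n)).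
  by move=> n; rewrite subr0 cabsX mul1r.
by apply: cvg_geomr; rewrite cabs_ge0.
Qed.

Lemma cvg_ReIm (u : nat -> C) (a b : R) :
  (fun n => complex.Re (u n)) @ \oo --> a ->
  (fun n => complex.Im (u n)) @ \oo --> b ->
  u @ \oo --> (Complex a b : C).
Proof.
move=> ha hb; apply: (@cvgnC _ _ (fun n => `|complex.Re (u n) - a| + `|complex.Im (u n) - b|)).
  by move=> n; apply: le_trans (cabs_le_ReIm _) _; case: (u n).
rewrite -(addr0 0); apply: cvgD; apply/norm_cvg0P; exact/subr_cvg0.
Qed.

(** Every family of the development decays geometrically, so geometric
dominators replace general summable ones. *)
Definition geo_bound u M s := forall n, cabs (u n) <= M * s ^+ n.

Definition geo_summable u := exists M s, 0 <= s < 1 /\ geo_bound u M s.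

Lemma geo_bound_ge0 u M s : geo_bound u M s -> 0 <= M.
Proof. by move=> /(_ 0%N); rewrite expr0 mulr1; apply: le_trans; rewrite cabs_ge0. Qed.

(** Completeness of the complex field, in the only form used: real and
imaginary parts converge absolutely. *)
Lemma geo_summable_cvg u : geo_summable u -> series u @ \oo --> csum u.
Proof.
move=> [M [s [s01 hu]]]; suff: cvgn (series u) by [].
have cv (f : nat -> R) : (forall n, `|f n| <= cabs (u n)) -> cvgn (series f).
  move=> hf; apply: normed_cvg.
  apply: (@series_le_cvg _ _ (geometric M s)) => [n|n|n|] /=.
  - exact: normr_ge0.
  - by rewrite mulr_ge0 ?(geo_bound_ge0 hu)// exprn_ge0 //; case/andP: s01.
  - exact: le_trans (hf n) (hu n).
  by apply: is_cvg_geometric_series; case/andP: s01 => s0 s1; rewrite ger0_norm.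
have hre := cv _ (fun n => Re_le_cabs (u n)).
have him := cv _ (fun n => Im_le_cabs (u n)).
apply/cvg_ex; exists (Complex (limn (series (fun n => complex.Re (u n)))) (limn (series (fun n => complex.Im (u n))))).
have E (f : C -> R) n : f 0 = 0 -> {morph f : x y / x + y} -> f (series u n) = series (fun n => f (u n)) n.
  by move=> f0 fD; rewrite /series /= (big_morph f fD f0).
apply: cvg_ReIm.
  rewrite (_ : (fun n => _) = series (fun n => complex.Re (u n))) //.
  by apply/funext => n; apply: E => // -[a b] [c d].
rewrite (_ : (fun n => _) = series (fun n => complex.Im (u n))) //.
by apply/funext => n; apply: E => // -[a b] [c d].
Qed.

Lemma csum_cvg u l : series u @ \oo --> l -> csum u = l.
Proof. exact/cvg_lim. Qed.

Lemma csum_fin u N : (forall n, (N <= n)%N -> u n = 0) -> csum u = \sum_(n < N) u n.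
Proof.
move=> h; apply: csum_cvg; rewrite -(cvg_shiftn N).
rewrite (_ : (fun n => _) = cst (\sum_(n < N) u n)); first exact: cvg_cst.
apply/funext => n /=; rewrite /series /= -(big_mkord xpredT) (big_cat_nat _ (n := N)) ?leq_addl//=.
by rewrite [X in _ + X]big_nat_cond [X in _ + X]big1 ?addr0 // => i; rewrite andbT => /andP[/h].
Qed.

Lemma csumD u v : geo_summable u -> geo_summable v -> csum (fun n => u n + v n) = csum u + csum v.
Proof.
move=> /geo_summable_cvg hu /geo_summable_cvg hv; apply: csum_cvg.
rewrite (_ : series _ = (fun n => series u n + series v n)).
  exact: cvgDC hu hv.
by apply/funext => n; rewrite /series /= big_split.
Qed.

Lemma csumZ u k : geo_summable u -> csum (fun n => k * u n) = k * csum u.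
Proof.
move=> /geo_summable_cvg hu; apply: csum_cvg.
rewrite (_ : series _ = (fun n => k * series u n)); first exact: cvgZC.
by apply/funext => n; rewrite /series /= mulr_sumr.
Qed.

Lemma geo_summableZ u k : geo_summable u -> geo_summable (fun n => k * u n).
Proof.
move=> [M [s [s01 h]]]; exists (cabs k * M), s; split=> // n.
by rewrite cabsM -mulrA ler_wpM2l ?cabs_ge0.
Qed.

Lemma geo_bound_shift u M s K : geo_bound u M s -> geo_bound (fun n => u (n + K)%N) (M * s ^+ K) s.
Proof. by move=> h n; apply: le_trans (h _) _; rewrite exprD (mulrC (s ^+ n)) mulrA. Qed.

Lemma geo_summable_shift u K : geo_summable u -> geo_summable (fun n => u (n + K)%N).
Proof. by move=> [M [s [s01 h]]]; exists (M * s ^+ K), s; split=> //; exact: geo_bound_shift. Qed.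

Lemma geo_summableD u v : geo_summable u -> geo_summable v -> geo_summable (fun n => u n + v n).
Proof.
move=> [M [s [/andP[s0 s1] h]]] [M' [s' [/andP[s0' s1'] h']]].
exists (M + M'), (Num.max s s'); split; first by rewrite le_max s0 /= gt_max s1.
move=> n; apply: le_trans (cabsD _ _) _; rewrite mulrDl.
apply: lerD; [apply: le_trans (h n) _|apply: le_trans (h' n) _];
rewrite ler_wpM2l ?(geo_bound_ge0 h) ?(geo_bound_ge0 h')// lerXn2r ?nnegrE ?le_max ?s0 ?s0' ?lexx ?orbT //.
Qed.

Lemma csum_split u K : geo_summable u ->
  csum u = \sum_(n < K) u n + csum (fun n => u (n + K)%N).
Proof.
move=> hu; apply: csum_cvg; rewrite -(cvg_shiftn K).
have /geo_summable_cvg h := geo_summable_shift K hu.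
rewrite (_ : (fun n => _) = (fun n => \sum_(n < K) u n + series (fun n => u (n + K)%N) n)).
  by apply: (cvgDC _ h); exact: cvg_cst.
apply/funext => n /=; rewrite /series /= -[X in X + _](big_mkord xpredT).
by rewrite (big_cat_nat _ (n := K)) ?leq_addl//= -{2}(add0n K) big_addn addnK.
Qed.

Lemma csumS u : geo_summable u -> csum u = u 0%N + csum (fun n => u n.+1).
Proof.
move=> hu; rewrite (csum_split 1 hu) big_ord1; congr (_ + csum _).
by apply/funext => n; rewrite addn1.
Qed.

Lemma cvgn_cabs_le (T : Type) {F : set_system T} {FF : ProperFilter F} (f : T -> C) l B :
  f @ F --> l -> (\forall t \near F, cabs (f t) <= B) -> cabs l <= B.
Proof.
move=> /cvg_cabs hc hB.
have <- : lim (cabs (f t) @[t --> F]) = cabs l by exact: cvg_lim.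
apply: limr_le => //; by apply/cvg_ex; exists (cabs l).
Qed.

Lemma cabs_csum_le u M s : 0 <= s < 1 -> geo_bound u M s -> cabs (csum u) <= M / (1 - s).
Proof.
move=> s01 hu; have g : geo_summable u by exists M, s.
have /andP[s0 s1] := s01.
have M0 := geo_bound_ge0 hu.
apply: (cvgn_cabs_le (geo_summable_cvg g)); apply: nearW => n.
rewrite /series /=; apply: le_trans (cabs_sum _ _ _) _.
apply: le_trans (_ : \sum_(0 <= i < n) M * s ^+ i <= _).
  by apply: ler_sum => i _; exact: hu.
rewrite -mulr_sumr ler_wpM2l // big_mkord -[leRHS]mul1r.
rewrite ler_pdivlMr ?subr_gt0 // mulrC.
by rewrite -opprB mulNr -subrX1 opprB gerBl exprn_ge0.
Qed.

Lemma cvg_sumr (K : numFieldType) (T : Type) {F : set_system T} {FF : Filter F}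
    (I : Type) (r : seq I) (f : T -> I -> K) (l : I -> K) :
  (forall i, f t i @[t --> F] --> l i) ->
  (\sum_(i <- r) f t i) @[t --> F] --> \sum_(i <- r) l i.
Proof.
move=> h; elim: r => [|i r IH].
  by rewrite big_nil; under eq_cvg do rewrite big_nil; exact: cvg_cst.
by rewrite big_cons; under eq_cvg do rewrite big_cons; exact: cvgD.
Qed.

(** Dominated convergence for series. A tail beyond a fixed rank is small
uniformly in the parameter, and the finitely many remaining terms converge. *)
Lemma tannery (T : Type) {F : set_system T} {FF : ProperFilter F}
    (u : T -> nat -> C) v M s : 0 <= s < 1 ->
  (\forall t \near F, geo_bound (u t) M s) ->
  (forall n, u t n @[t --> F] --> v n) ->
  geo_bound v M s /\ csum (u t) @[t --> F] --> csum v.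
Proof.
move=> s01 hu huv; have /andP[s0 s1] := s01.
have hv : geo_bound v M s.
  by move=> n; apply: (cvgn_cabs_le (huv n)); apply: filterS hu => t; apply.
split=> //.
have gv : geo_summable v by exists M, s.
have M0 := geo_bound_ge0 hv.
apply/cvgCP/cvgrPdist_lt => e e0.
have [K hK] : exists K, (2 * M) * s ^+ K / (1 - s) < e / 2.
  have /cvgrPdist_lt := @cvg_geomr (2 * M / (1 - s)) s s01.
  move=> /(_ (e / 2)); rewrite divr_gt0 // => /(_ isT) [K _ /(_ K (leqnn K))] /=.
  rewrite sub0r normrN ger0_norm; last first.
    by rewrite mulr_ge0 ?exprn_ge0 // divr_ge0 ?subr_ge0 ?mulr_ge0 // ltW.
  by move=> h; exists K; rewrite mulrAC.
have fin : (\sum_(n < K) cabs (u t n - v n)) @[t --> F] --> (0 : R).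
  have hn (n : 'I_K) : cabs (u t n - v n) @[t --> F] --> (0 : R) by exact/cvgCP.
  suff e0' : \sum_(i < K) (0 : R) = 0 by rewrite -[X in _ --> X]e0'; exact: (cvg_sumr hn).
  exact: big1.
move/cvgrPdist_lt: fin => /(_ (e / 2)); rewrite divr_gt0 // => /(_ isT) fin.
have := @filterI _ F FF _ _ hu fin; apply: filterS => t [ht].
rewrite norm0Bcabs sub0r normrN ger0_norm; last by apply: sumr_ge0 => i _; exact: cabs_ge0.
move=> hf; have gu : geo_summable (u t) by exists M, s.
rewrite (_ : csum (u t) - csum v = csum (fun n => u t n + (-1) * v n)); last first.
  by rewrite csumD ?csumZ ?mulN1r //; exact: geo_summableZ.
have gw := geo_summableD gu (geo_summableZ (-1) gv).
rewrite (csum_split K gw) (splitr e); apply: le_lt_trans (cabsD _ _) _; apply: ltrD.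
  apply: le_lt_trans (cabs_sum _ _ _) _.
  rewrite (eq_bigr (fun n : 'I_K => cabs (u t n - v n))) => [|n _]; first exact hf.
  by rewrite mulN1r.
apply: le_lt_trans hK; apply: cabs_csum_le => //; apply: (geo_bound_shift (u := fun n => u t n + -1 * v n)) => n.
by rewrite mulN1r; apply: le_trans (cabsB _ _) _; rewrite mulr2n !mulrDl !mul1r lerD.
Qed.

Lemma cvgn_telescope (w : nat -> C) : geo_summable (fun d => w d.+1 - w d) -> cvgn w.
Proof.
move=> g; have h := geo_summable_cvg g.
have E : w = (fun d => w 0%N + series (fun d => w d.+1 - w d) d).
  by apply/funext => d; rewrite /series /= telescope_sumr // addrC subrK.
rewrite E; apply/cvg_ex; exists (w 0%N + csum (fun d => w d.+1 - w d)).
by apply: (cvgDC _ h); exact: cvg_cst.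
Qed.

(** Fubini for geometrically dominated double series, obtained from dominated
convergence applied to the finite partial sums over one index. *)
Lemma csum_exchange (u : nat -> nat -> C) M s t : 0 <= s < 1 -> 0 <= t < 1 ->
  (forall d n, cabs (u d n) <= M * s ^+ d * t ^+ n) ->
  csum (fun d => csum (u d)) = csum (fun n => csum (fun d => u d n)).
Proof.
move=> s01 t01 h; have /andP[s0 s1] := s01; have /andP[t0 t1] := t01.
have M0 : 0 <= M by have := le_trans (cabs_ge0 _) (h 0%N 0%N); rewrite !mulr1.
have gd d : geo_bound (u d) (M * s ^+ d) t by exact: h.
have gn n : geo_bound (u^~ n) (M * t ^+ n) s by move=> d; rewrite mulrAC h.
have E D : series (fun d => csum (u d)) D = csum (fun n => \sum_(d < D) u d n).
  rewrite /series /= big_mkord; elim: D => [|D IH].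
    by rewrite big_ord0 (@csum_fin _ 0) ?big_ord0 // => n _; rewrite big_ord0.
  rewrite big_ord_recr /= IH.
  under [in RHS]eq_fun do rewrite big_ord_recr.
  rewrite csumD //; last by exists (M * s ^+ D), t.
  exists (\sum_(d < D) M * s ^+ d), t; split=> // n; rewrite mulr_suml.
  by apply: le_trans (cabs_sum _ _ _) _; apply: ler_sum => d _; exact: h.
apply: csum_cvg; rewrite (_ : series _ = fun D => csum (fun n => \sum_(d < D) u d n)).
  apply: (proj2 (@tannery _ _ _ (fun D n => \sum_(d < D) u d n) _ (M / (1 - s)) t _ _ _)) => //.
    apply: nearW => D n; apply: le_trans (cabs_sum _ _ _) _.
    apply: le_trans (_ : \sum_(d < D) (M * t ^+ n) * s ^+ d <= _).
      by apply: ler_sum => d _; rewrite mulrAC; exact: h.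
    rewrite -mulr_sumr [leRHS]mulrAC ler_wpM2l ?mulr_ge0 ?exprn_ge0 // -[leRHS]mul1r.
    rewrite ler_pdivlMr ?subr_gt0 // mulrC.
    by rewrite -opprB mulNr -subrX1 opprB gerBl exprn_ge0.
  move=> n; have g : geo_summable (u^~ n) by exists (M * t ^+ n), s.
  by have := geo_summable_cvg g; under eq_cvg do rewrite /series /= big_mkord.
exact/funext.
Qed.

End DominatedSeries.

(** * The q-Pochhammer symbol *)

Section QPoch.
Variable R : realType.
Local Notation C := (Cx R).
Variable q : C.
Hypotheses (q0 : q != 0) (q1 : cabs q < 1).
Implicit Types a : C.

Lemma cabs_q01 : 0 <= cabs q < 1.
Proof. by rewrite cabs_ge0 q1. Qed.

Lemma qpoch0 a : qpoch a q 0 = 1.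
Proof. by rewrite /qpoch big_geq. Qed.

Lemma qpochS a d : qpoch a q d.+1 = qpoch a q d * (1 - a * q ^+ d).
Proof. by rewrite /qpoch big_nat_recr. Qed.

Lemma qpochD a m n : qpoch a q (m + n) = qpoch a q m * qpoch (a * q ^+ m) q n.
Proof.
elim: n => [|n IH]; first by rewrite addn0 qpoch0 mulr1.
by rewrite addnS !qpochS IH mulrA -mulrA exprD !mulrA.
Qed.

Lemma qpochSl a d : qpoch a q d.+1 = (1 - a) * qpoch (a * q) q d.
Proof. by rewrite -add1n qpochD expr1 qpochS qpoch0 mul1r expr0 mulr1. Qed.

(** The bound of 1 + x by exp x makes a product of factors that approach 1
geometrically bounded uniformly in its length. *)
Lemma prod_le_expR (s K : R) (f : nat -> R) d : 0 <= s < 1 -> 0 <= K ->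
  (forall k, 0 <= f k <= 1 + K * s ^+ k) ->
  \prod_(0 <= k < d) f k <= expR (K / (1 - s)).
Proof.
move=> /andP[s0 s1] K0 h.
apply: le_trans (_ : \prod_(0 <= k < d) expR (K * s ^+ k) <= _).
  apply: ler_prod => k _; have /andP[f0 f1] := h k; rewrite f0 /=.
  exact: le_trans f1 (expR_ge1Dx _).
rewrite -expR_sum ler_expR -mulr_sumr ler_wpM2l // big_mkord -[leRHS]mul1r.
rewrite ler_pdivlMr ?subr_gt0 // mulrC.
by rewrite -opprB mulNr -subrX1 opprB gerBl exprn_ge0.
Qed.

Lemma qpoch_le a d : cabs (qpoch a q d) <= expR (cabs a / (1 - cabs q)).
Proof.
rewrite cabs_prod; apply: prod_le_expR; rewrite ?cabs_ge0 ?cabs_q01 //.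
move=> k; rewrite cabs_ge0 /= -cabsX -cabsM.
by apply: le_trans (cabsB _ _) _; rewrite cabs1.
Qed.

(** Consecutive differences are geometrically dominated because the partial
products stay bounded. *)
Lemma qpoch_cvg a : qpoch a q @ \oo --> qpoch_oo a q.
Proof.
suff: cvgn (qpoch a q) by [].
apply: cvgn_telescope; exists (cabs a * expR (cabs a / (1 - cabs q))), (cabs q).
split=> [|d]; first exact: cabs_q01.
have -> : qpoch a q d.+1 - qpoch a q d = - (a * q ^+ d) * qpoch a q d.
  by rewrite qpochS; ring.
rewrite cabsM cabsN cabsM cabsX mulrAC ler_wpM2r ?exprn_ge0 ?cabs_ge0 //.
by rewrite ler_wpM2l ?cabs_ge0 ?qpoch_le.
Qed.

Lemma cvgn_qpoch_shift a K : (fun N => qpoch a q (N + K)) @ \oo --> qpoch_oo a q.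
Proof. by have := @qpoch_cvg a; rewrite -(cvg_shiftn K). Qed.

Lemma qpoch_oo_split a d : qpoch_oo a q = qpoch a q d * qpoch_oo (a * q ^+ d) q.
Proof.
have h1 := @cvgn_qpoch_shift a d.
have h2 : (fun N => qpoch a q d * qpoch (a * q ^+ d) q N) @ \oo -->
    qpoch a q d * qpoch_oo (a * q ^+ d) q.
  by apply: cvgZC; exact: qpoch_cvg.
have E : (fun N => qpoch a q (N + d)) = (fun N => qpoch a q d * qpoch (a * q ^+ d) q N).
  by apply/funext => N; rewrite addnC qpochD.
by rewrite E in h1; rewrite -(cvg_lim _ h1) // (cvg_lim _ h2).
Qed.

(** The condition under which (a;q)_oo is nonzero. *)
Definition qregular a := forall k, 1 - a * q ^+ k != 0.

Lemma qregular_shift a d : qregular a -> qregular (a * q ^+ d).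
Proof. by move=> h k; rewrite -mulrA -exprD. Qed.

Lemma qpoch_neq0 a d : qregular a -> qpoch a q d != 0.
Proof. by move=> h; rewrite /qpoch prodf_seq_neq0; apply/allP => k _ /=. Qed.

(** The inverse of a factor is 1/(1-x) = 1 + x/(1-x), so a lower bound on all
factors bounds the inverse products like the products themselves. *)
Lemma qpochV_le a (delta : R) d : 0 < delta ->
  (forall k, delta <= cabs (1 - a * q ^+ k)) ->
  cabs (qpoch a q d)^-1 <= expR (cabs a / delta / (1 - cabs q)).
Proof.
move=> d0 h; rewrite -prodfV cabs_prod; apply: prod_le_expR; rewrite ?cabs_q01 ?divr_ge0 ?cabs_ge0 ?ltW //.
move=> k; rewrite cabs_ge0 /=.
have n0 : 1 - a * q ^+ k != 0 by rewrite -cabs_gt0; exact: lt_le_trans (h k).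
have -> : (1 - a * q ^+ k)^-1 = 1 + a * q ^+ k / (1 - a * q ^+ k) by field.
apply: le_trans (cabsD _ _) _; rewrite cabs1 lerD2l 2!cabsM cabsX mulrAC cabsV.
rewrite ler_wpM2r ?exprn_ge0 ?cabs_ge0 // ler_wpM2l ?cabs_ge0 // lef_pV2 ?posrE //.
exact: lt_le_trans (h k).
Qed.

Lemma qregular_lb a : qregular a -> exists2 delta : R, 0 < delta & forall k, delta <= cabs (1 - a * q ^+ k).
Proof.
move=> h.
have [K hK] : exists K, forall k, (K <= k)%N -> 2^-1 <= cabs (1 - a * q ^+ k).
  have /cvgrPdist_lt := @cvg_geomr _ (cabs a) _ cabs_q01.
  move=> /(_ (2^-1)); rewrite invr_gt0 ltr0n => /(_ isT) [K _ hK]; exists K => k /hK /=.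
  rewrite -cabsX -cabsM norm0Bcabs => hk.
  have := cabs_dist 1 (a * q ^+ k); rewrite cabs1.
  have h2 : (1 : R) = 2^-1 + 2^-1 by field.
  lra.
have [d [d0 hd]] : exists d : R, 0 < d /\ forall k, (k < K)%N -> d <= cabs (1 - a * q ^+ k).
  elim: (K) => [|n [d [d0 hd]]]; first by exists 1.
  exists (Num.min d (cabs (1 - a * q ^+ n))); split; first by rewrite lt_min d0 cabs_gt0 h.
  move=> k; rewrite ltnS leq_eqVlt => /orP[/eqP->|/hd hk]; first by rewrite ge_min lexx orbT.
  by rewrite ge_min hk.
exists (Num.min d 2^-1); first by rewrite lt_min d0 invr_gt0 ltr0n.
move=> k; case: (ltnP k K) => [/hd hk|/hK hk]; by rewrite ge_min hk ?orbT.
Qed.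

Lemma qpochV_bounded a : qregular a -> exists B : R, forall d, cabs (qpoch a q d)^-1 <= B.
Proof.
move=> /qregular_lb[delta d0 h]; exists (expR (cabs a / delta / (1 - cabs q))) => d.
exact: qpochV_le.
Qed.

Lemma qpoch_oo_neq0 a : qregular a -> qpoch_oo a q != 0.
Proof.
move=> h; have [B hB] := qpochV_bounded h; apply/negP => /eqP h0.
have := @qpoch_cvg a; rewrite h0 => /cvg_cabs; rewrite cabs0.
have B0 : 0 < B.
  by apply: lt_le_trans (hB 0%N); rewrite cabs_gt0 invr_neq0 // qpoch0 oner_neq0.
move=> /cvgrPdist_lt /(_ B^-1); rewrite invr_gt0 => /(_ B0) [N _ /(_ N (leqnn N))] /=.
rewrite norm0Bcabs => hl; have := hB N; rewrite cabsV leNgt => /negP; apply.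
by rewrite -(invrK B) ltf_pV2 ?posrE ?invr_gt0 // cabs_gt0 qpoch_neq0.
Qed.

Lemma cvgV_qpoch a : qregular a -> (fun N => (qpoch a q N)^-1) @ \oo --> (qpoch_oo a q)^-1.
Proof. by move=> h; apply: cvgV; [exact: qpoch_oo_neq0 | exact: qpoch_cvg]. Qed.

(** The product of the -q^(-l) for 1 <= l <= m. It is kept as a product
because it cancels in every quotient where it occurs. *)
Definition rev_factor m : C := \prod_(0 <= l < m) - (q ^+ l.+1)^-1.

Lemma rev_factor_neq0 m : rev_factor m != 0.
Proof.
by rewrite prodf_seq_neq0; apply/allP => l _ /=; rewrite oppr_eq0 invr_eq0 expf_neq0.
Qed.

(** Reversing the order of the factors: 1 - a q^(-l) = (a)(-q^(-l))(1 - (q/a)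
q^(l-1)). *)
Lemma qpoch_rev a m : a != 0 -> qpoch (a / q ^+ m) q m = a ^+ m * rev_factor m * qpoch (q / a) q m.
Proof.
move=> a0; elim: m => [|m IH]; first by rewrite !qpoch0 /rev_factor big_geq // expr0 !mulr1.
rewrite qpochSl qpochS /rev_factor big_nat_recr //= -/(rev_factor m).
have -> : a / q ^+ m.+1 * q = a / q ^+ m by rewrite exprS; field; rewrite expf_neq0.
rewrite IH !exprS; field; rewrite a0 q0 expf_neq0 //.
Qed.

Lemma qpoch_revD a m n : a != 0 ->
  qpoch (a / q ^+ m) q (m + n) = a ^+ m * rev_factor m * qpoch (q / a) q m * qpoch a q n.
Proof. by move=> a0; rewrite qpochD qpoch_rev // divfK // expf_neq0. Qed.

End QPoch.

(** * A finite residue identity *)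

(** The sum of the residues of p / prod_i (X - x_i) vanishes when the degree
of p is at most the number of nodes minus two: this sum is the coefficient of
the top power in the Lagrange interpolation of p. *)
Lemma residue_sum (F : fieldType) (I : finType) (x : I -> F) (p : {poly F}) :
  injective x -> (size p < #|I|)%N ->
  \sum_i p.[x i] / \prod_(j | j != i) (x i - x j) = 0.
Proof.
move=> xi sp.
pose w i := \prod_(j | j != i) ('X - (x j)%:P).
have wE i k : (w i).[x k] = \prod_(j | j != i) (x k - x j).
  by rewrite horner_prod; apply: eq_bigr => j _; rewrite !hornerE.
have w0 i : (w i).[x i] != 0.
  by rewrite wE; apply/prodf_neq0 => j ji; rewrite subr_eq0 (inj_eq xi) eq_sym.
have ws i : size (w i) = #|I|.
  rewrite /w -big_filter size_prod_XsubC size_filter.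
  rewrite -sum1_count sum1_card -[RHS](ltn_predK sp) -(cardC1 i).
  by congr _.+1; apply: eq_card.
pose L := \sum_i (p.[x i] / (w i).[x i]) *: w i.
have LE k : L.[x k] = p.[x k].
  rewrite horner_sum (bigD1 k) //= hornerZ divfK // big1 ?addr0 // => i ik.
  rewrite hornerZ [X in _ * X]wE (bigD1 k) /=; last by rewrite eq_sym.
  by rewrite subrr mul0r mulr0.
have pL : p = L.
  apply/eqP; rewrite -subr_eq0; apply/eqP.
  apply: (@roots_geq_poly_eq0 _ _ (map x (enum I))).
  - by apply/allP => _ /mapP[k _ ->]; rewrite /root !hornerE LE subrr.
  - by rewrite map_inj_uniq ?enum_uniq.
  rewrite size_map -cardE; apply: leq_trans (size_polyD _ _) _.
  rewrite geq_max (ltnW sp) size_polyN /=; apply: leq_trans (size_sum _ _ _) _.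
  by apply/bigmax_leqP => i _; apply: leq_trans (size_scale_leq _ _) _; rewrite ws.
have := congr1 (fun r : {poly F} => r`_#|I|.-1) pL => /=.
rewrite nth_default; last by rewrite -ltnS prednK // (leq_ltn_trans _ sp).
rewrite coef_sum => /esym h; rewrite -[RHS]h; apply: eq_bigr => i _.
rewrite coefZ wE.
have -> : (w i)`_#|I|.-1 = 1.
  have /monicP := monic_prod_XsubC (index_enum I) (fun j => j != i) x.
  by rewrite lead_coefE -/(w i) ws.
by rewrite mulr1.
Qed.

Lemma prod_scale (F : fieldType) (I : finType) (P : pred I) (c : F) (f : I -> F) :
  \prod_(i | P i) (c * f i) = c ^+ #|P| * \prod_(i | P i) f i.
Proof. by rewrite big_split /= prodr_const. Qed.

Section Finite.
Variable R : realType.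
Local Notation C := (Cx R).
Variable q : C.
Hypotheses (q0 : q != 0) (q1 : cabs q < 1).

Lemma qX_neq0 n : q ^+ n != 0. Proof. exact: expf_neq0. Qed.

Lemma cabsX_lt1 (z : C) n : cabs z < 1 -> (0 < n)%N -> cabs (z ^+ n) < 1.
Proof. by move=> z1 n0; rewrite cabsX exprn_ilt1 ?cabs_ge0 // -lt0n. Qed.

Lemma qX_inj : injective (fun n => q ^+ n).
Proof.
suff h m n : (m < n)%N -> q ^+ m <> q ^+ n.
  move=> m n e; case: (ltngtP m n) => // /h; first by move=> /(_ e).
  by move=> /(_ (esym e)).
move=> mn e.
have : cabs (q ^+ (n - m)) < 1 by apply: cabsX_lt1; rewrite ?subn_gt0.
suff -> : q ^+ (n - m) = 1 by rewrite cabs1 ltxx.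
by apply: (mulfI (qX_neq0 m)); rewrite -exprD subnKC ?mulr1 // ltnW.
Qed.

Lemma qpoch_ord a N : qpoch a q N = \prod_(k < N) (1 - a * q ^+ k).
Proof. by rewrite /qpoch big_mkord. Qed.

(** The q-analogue of the product of the differences m - k over k <> m. *)
Lemma prod_punctured L (m : 'I_L.+1) :
  \prod_(k < L.+1 | k != m) (1 - q ^+ k / q ^+ m) =
  rev_factor q m * qpoch q q m * qpoch q q (L - m).
Proof.
have lem : (m <= L)%N by rewrite -ltnS.
pose F k : C := 1 - q ^+ k / q ^+ m.
have -> : \prod_(k < L.+1 | k != m) (1 - q ^+ k / q ^+ m) =
          \prod_(0 <= k < L.+1 | k != m) F k by rewrite big_mkord.
rewrite (big_cat_nat _ (n := m)) //=; last exact: ltnW.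
rewrite [X in _ * X]big_ltn_cond // eqxx /=; congr (_ * _).
  rewrite big_nat_cond (eq_bigl (fun i => (0 <= i < m)%N && true)); last first.
    by move=> i; case: (ltngtP i m); rewrite ?andbF.
  have := @qpoch_rev _ q q0 1 m (oner_neq0 _).
  rewrite expr1n !mul1r divr1 => <-; rewrite -big_nat_cond /qpoch.
  by apply: eq_bigr => k _; rewrite /F mulrC.
rewrite big_nat_cond (eq_bigl (fun i => (m.+1 <= i < L.+1)%N && true)); last first.
  by move=> i; case: (ltngtP i m); rewrite ?andbT ?andbF.
rewrite -big_nat_cond -{1}[m.+1]add0n big_addn subSS /qpoch.
by apply: eq_bigr => k _; rewrite /F addnS -addSn exprD mulfK ?qX_neq0 // exprS.
Qed.

Variables (s : nat) (a b : 'I_s -> C) (Q : C).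
Hypotheses (s0 : (0 < s)%N) (Q0 : Q != 0).
Hypotheses (a0 : forall i, a i != 0) (b0 : forall i, b i != 0).
Hypotheses (areg : forall i, qregular q (a i)) (areg' : forall i, qregular q (q / a i)).
Hypotheses (aareg : forall i j, i != j -> qregular q (a i / a j)).

Variable N : nat.

(** Two families of nodes: 2N+1 powers of q centred at 1, and the first N+1
poles of each 1/(a_i x;q)_oo. *)
Definition nodeT := ('I_N.*2.+1 + 'I_s * 'I_N.+1)%type.

Definition node (k : nodeT) : C :=
  match k with
  | inl k => q ^+ k / q ^+ N
  | inr p => (a p.1 * q ^+ p.2)^-1
  end.

(** Separates the two families of nodes. *)
Lemma aq_neq i m k : a i * q ^+ m * (q ^+ k / q ^+ N) != 1.
Proof.
have -> : a i * q ^+ m * (q ^+ k / q ^+ N) = a i * q ^+ (m + k) / q ^+ N.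
  by rewrite exprD !mulrA.
case: (leqP N (m + k)) => [h|h].
  have := areg i (m + k - N)%N; rewrite subr_eq0 eq_sym.
  by rewrite -{2}(subnK h) exprD mulrA mulfK ?qX_neq0.
have := areg' i (N - (m + k)).-1%N; rewrite subr_eq0 eq_sym; apply: contra => /eqP e.
have h2 : N = ((N - (m + k)).-1 + (m + k)).+1 by lia.
have -> : q / a i * q ^+ (N - (m + k)).-1%N = q ^+ N / (a i * q ^+ (m + k)).
  rewrite {2}h2 exprS exprD; field; by rewrite a0 qX_neq0.
by rewrite -(invrK (_ / _)) invf_div e invr1.
Qed.

Lemma node_inj : injective node.
Proof.
move=> [k|[i m]] [k'|[j m']] /=.
- move=> /(mulIf (invr_neq0 (qX_neq0 N))) /qX_inj h.
  by congr inl; apply: val_inj.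
- move=> e; have := aq_neq j m' k; rewrite e mulfV ?eqxx //.
  by rewrite mulf_neq0 ?qX_neq0.
- move=> e; have := aq_neq i m k'; rewrite -e mulfV ?eqxx //.
  by rewrite mulf_neq0 ?qX_neq0.
move=> /invr_inj e; case: (eqVneq i j) => [eij|ij].
  move: e; rewrite eij => /(mulfI (a0 j)) /qX_inj h; congr inr; congr pair => //.
  exact: val_inj.
exfalso; wlog h : i j m m' ij e / (m' <= m)%N.
  move=> H; case: (leqP m' m) => h; first exact: (H i j m m').
  by apply: (H j i m' m); rewrite 1?eq_sym 1?ltnW.
have /negP := aareg ij (m - m')%N; apply; rewrite subr_eq0; apply/eqP.
have : a i * q ^+ (m - m') = a j.
  by apply: (mulIf (qX_neq0 m')); rewrite -mulrA -exprD subnK.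
move=> <-; rewrite mulrAC; apply/esym/divff.
by rewrite mulf_neq0 // qX_neq0.
Qed.

(** The first product, divided by the product of the X - q^(k-N), truncates a
ratio of theta functions; its zeros Q q^(l-N) put the power Q^k in the residue
at q^(k-N). The poles 1/(a_i q^m) run to m = N, one more than the factors of
the numerator, so that the degree is at most the number of nodes minus two. *)
Definition numer : {poly C} :=
  \prod_(l < N.*2) ('X - (Q * (q ^+ l / q ^+ N))%:P) *
  \prod_i \prod_(l < N) (1 - (b i * q ^+ l) *: 'X).

Lemma size_numer : (size numer < #|{: nodeT}|)%N.
Proof.
rewrite card_sum card_prod !card_ord.
have h1 : size (\prod_(l < N.*2) ('X - (Q * (q ^+ l / q ^+ N))%:P)) = N.*2.+1.
  by rewrite size_prod_XsubC /index_enum -enumT size_enum_ord.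
pose f (i : 'I_s) (l : 'I_N) : {poly C} := 1 - (b i * q ^+ l) *: 'X.
have hs i l : (size (f i l) <= 2)%N.
  rewrite (leq_trans (size_polyD _ _)) // geq_max size_polyN size_poly1 /=.
  by rewrite (leq_trans (size_scale_leq _ _)) // size_polyX.
pose g i : {poly C} := \prod_(l < N) f i l.
have h2 i : (size (g i) <= N.+1)%N.
  apply: leq_trans (size_prod_leq _ _) _; rewrite card_ord.
  have : (\sum_(l < N) size (f i l) <= \sum_(l < N) 2)%N.
    by apply: leq_sum => l _; exact: hs.
  rewrite sum_nat_const card_ord; move: (bigop.body _ _ _) => S; lia.
have h3 : (size (\prod_i g i)%R <= (s * N).+1)%N.
  apply: leq_trans (size_prod_leq _ _) _; rewrite card_ord.
  have : (\sum_(i < s) size (g i) <= \sum_(i < s) N.+1)%N.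
    by apply: leq_sum => l _; exact: h2.
  rewrite sum_nat_const card_ord; move: (bigop.body _ _ _) => S; lia.
apply: leq_ltn_trans (size_polyMleq _ _) _; rewrite h1 -/(\prod_i g i); lia.
Qed.

(** The constant that turns the factors X - 1/(a_i q^m) into 1 - a_i q^m X. It
is common to all residues. *)
Definition node_scale : C := \prod_i \prod_(m < N.+1) - (a i * q ^+ m)^-1.

Lemma aqX_neq0 i m : a i * q ^+ m != 0.
Proof. by rewrite mulf_neq0 ?qX_neq0. Qed.

Lemma node_scale_neq0 : node_scale != 0.
Proof.
apply/prodf_neq0 => i _; apply/prodf_neq0 => m _.
by rewrite oppr_eq0 invr_eq0 aqX_neq0.
Qed.

Lemma numer_at X : numer.[X] =
  \prod_(l < N.*2) (X - Q * (q ^+ l / q ^+ N)) * \prod_i qpoch (b i * X) q N.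
Proof.
rewrite hornerM !horner_prod; congr (_ * _).
  by apply: eq_bigr => l _; rewrite !hornerE.
apply: eq_bigr => i _; rewrite horner_prod qpoch_ord.
by apply: eq_bigr => l _; rewrite !hornerE; congr (1 - _); ring.
Qed.

(** The residue at the node q^(k-N), up to the constant common to all
residues. *)
Definition node_term k : C :=
  Q ^+ k * (qpoch (q / Q) q k * qpoch Q q (N.*2 - k)) /
    (qpoch q q k * qpoch q q (N.*2 - k)) *
  \prod_i (qpoch (b i * (q ^+ k / q ^+ N)) q N / qpoch (a i * (q ^+ k / q ^+ N)) q N.+1).

(** The opposite of the residue at the node 1/(a_j q^m), up to the constant
common to all residues. *)
Definition pole_term j m : C :=
  let al := a j * q ^+ m in
  Q ^+ N * (qpoch (al * Q) q N * qpoch (q / (al * Q)) q N) /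
    (qpoch al q N.+1 * qpoch (q / al) q N) *
  (\prod_i qpoch (b i / al) q N) /
  ((\prod_(i | i != j) qpoch (a i / al) q N.+1) *
   (rev_factor q m * qpoch q q m * qpoch q q (N - m))).

Lemma prod_node_inr X :
  \prod_(p : 'I_s * 'I_N.+1) (X - node (inr p)) =
  node_scale * \prod_i qpoch (a i * X) q N.+1.
Proof.
rewrite -(pair_bigA _ (fun i (m : 'I_N.+1) => X - (a i * q ^+ m)^-1)) /= -big_split /=.
apply: eq_bigr => i _; rewrite qpoch_ord -big_split /=; apply: eq_bigr => m _.
by have h := aqX_neq0 i m; field; rewrite a0 qX_neq0.
Qed.

Lemma prod_node_inr_ne j (m : 'I_N.+1) X : X = (a j * q ^+ m)^-1 ->
  \prod_(p : 'I_s * 'I_N.+1 | p != (j, m)) (X - node (inr p)) =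
  - (node_scale * (a j * q ^+ m)) * ((\prod_(i | i != j) qpoch (a i * X) q N.+1) *
   (rev_factor q m * qpoch q q m * qpoch q q (N - m))).
Proof.
move=> XE.
have -> : - (node_scale * (a j * q ^+ m)) =
    \prod_(p : 'I_s * 'I_N.+1 | p != (j, m)) - (a p.1 * q ^+ p.2)^-1.
  rewrite /node_scale (pair_bigA _ (fun i (m : 'I_N.+1) => - (a i * q ^+ m)^-1)) /=.
  rewrite (bigD1 (j, m)) //=; set Z := \prod_(i | _) _.
  by have h := aqX_neq0 j m; field; rewrite a0 qX_neq0.
have -> : (\prod_(i | i != j) qpoch (a i * X) q N.+1) *
   (rev_factor q m * qpoch q q m * qpoch q q (N - m)) =
   \prod_(p : 'I_s * 'I_N.+1 | p != (j, m)) (1 - a p.1 * X * q ^+ p.2).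
  rewrite -prod_punctured.
  rewrite [RHS](bigID (fun p => p.1 == j)) /= mulrC; congr (_ * _).
    rewrite (reindex_onto (fun k : 'I_N.+1 => (j, k)) snd) /=; last first.
      by move=> [i k] /= /andP[_ /eqP ->].
    apply: eq_big => k; first by rewrite xpair_eqE !eqxx /= !andbT.
    by move=> _; rewrite XE; congr (1 - _); field; rewrite a0 !qX_neq0.
  under eq_bigr do rewrite qpoch_ord.
  rewrite (pair_big (fun i => i != j) xpredT (fun i (k : 'I_N.+1) => 1 - a i * X * q ^+ k)) /=.
  apply: eq_bigl => -[i k] /=; rewrite xpair_eqE andbT.
  by case: (i == j) => //=; rewrite ?andbF.
rewrite -big_split /=; apply: eq_bigr => -[i k] _ /=.
by have h := aqX_neq0 i k; field; rewrite a0 qX_neq0.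
Qed.

Lemma residue1 (k : 'I_N.*2.+1) :
  node_scale * (numer.[node (inl k)] / \prod_(y | y != inl k) (node (inl k) - node y)) = node_term k.
Proof.
rewrite numer_at big_sumType /=.
set X := q ^+ k / q ^+ N.
have kN : (k <= N.*2)%N by rewrite -ltnS.
have X0 : X != 0 by rewrite mulf_neq0 ?invr_eq0 ?qX_neq0.
have -> : \prod_(l < N.*2) (X - Q * (q ^+ l / q ^+ N)) =
    X ^+ N.*2 * (Q ^+ k * rev_factor q k * qpoch (q / Q) q k * qpoch Q q (N.*2 - k)).
  rewrite -qpoch_revD // subnKC // qpoch_ord.
  rewrite (eq_bigr (fun l : 'I_N.*2 => X * (1 - Q / q ^+ k * q ^+ l))).
    by rewrite prod_scale card_ord.
  by move=> l _; rewrite /X; field; rewrite !qX_neq0.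
have -> : \prod_(i < N.*2.+1 | inl i != inl k :> nodeT) (X - q ^+ i / q ^+ N) =
    X ^+ N.*2 * (rev_factor q k * qpoch q q k * qpoch q q (N.*2 - k)).
  rewrite -prod_punctured.
  rewrite (eq_bigr (fun l : 'I_N.*2.+1 => X * (1 - q ^+ l / q ^+ k))).
    by rewrite prod_scale (eq_card (B := predC1 k)) // cardC1 card_ord.
  by move=> l _; rewrite /X; field; rewrite !qX_neq0.
rewrite (eq_bigl xpredT) // prod_node_inr /node_term -/X prodf_div.
have h1 := rev_factor_neq0 q0 k.
have h2 : \prod_i qpoch (a i * X) q N.+1 != 0.
  apply/prodf_neq0 => i _; rewrite qpoch_ord; apply/prodf_neq0 => m _.
  rewrite subr_eq0 eq_sym (_ : a i * X * q ^+ m = a i * q ^+ m * X) ?aq_neq //.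
  by rewrite mulrAC.
have h3 n : qpoch q q n != 0.
  apply: qpoch_neq0 => l; rewrite -exprS subr_eq0 eq_sym; apply/eqP => e.
  by have := @cabsX_lt1 q l.+1 q1 isT; rewrite e cabs1 ltxx.
have h4 := node_scale_neq0; have h5 : X ^+ N.*2 != 0 by rewrite expf_neq0.
move: (\prod_i qpoch (a i * X) q N.+1) h2 => A h2.
move: (\prod_i qpoch (b i * X) q N) => B.
move: (X ^+ N.*2) h5 => Y h5; move: (rev_factor q k) h1 => r h1; move: node_scale h4 => L h4.
by field; rewrite h1 h2 h4 h5 !h3.
Qed.

Lemma residue2 j (m : 'I_N.+1) :
  node_scale * (numer.[node (inr (j, m))] / \prod_(y | y != inr (j, m)) (node (inr (j, m)) - node y)) = - pole_term j m.
Proof.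
rewrite numer_at big_sumType /=.
rewrite (eq_bigl (fun p => p != (j, m))) // (@prod_node_inr_ne j m) //.
rewrite (eq_bigl xpredT) // /pole_term.
set al := a j * q ^+ m; set X := al^-1.
have al0 : al != 0 by exact: aqX_neq0.
have X0 : X != 0 by rewrite invr_eq0.
have alQ0 : al * Q != 0 by exact: mulf_neq0.
have -> : \prod_(l < N.*2) (X - Q * (q ^+ l / q ^+ N)) =
    X ^+ N.*2 * ((al * Q) ^+ N * rev_factor q N * qpoch (q / (al * Q)) q N * qpoch (al * Q) q N).
  rewrite -(qpoch_revD q0 N N alQ0) addnn qpoch_ord.
  rewrite (eq_bigr (fun l : 'I_N.*2 => X * (1 - al * Q / q ^+ N * q ^+ l))).
    by rewrite prod_scale card_ord.
  by move=> l _; rewrite /X; field; rewrite al0 !qX_neq0.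
have -> : \prod_(l < N.*2.+1) (X - q ^+ l / q ^+ N) =
    X ^+ N.*2.+1 * (al ^+ N * rev_factor q N * qpoch (q / al) q N * qpoch al q N.+1).
  rewrite -(qpoch_revD q0 N N.+1 al0) addnS addnn qpoch_ord.
  rewrite (eq_bigr (fun l : 'I_N.*2.+1 => X * (1 - al / q ^+ N * q ^+ l))).
    by rewrite prod_scale card_ord.
  by move=> l _; rewrite /X; field; rewrite al0 !qX_neq0.
rewrite exprS exprMn.
have h1 n := rev_factor_neq0 q0 n.
have h4 := node_scale_neq0; have h5 : X ^+ N.*2 != 0 by rewrite expf_neq0.
have h6 : al ^+ N != 0 by rewrite expf_neq0.
move: (X ^+ N.*2) h5 => Y h5; move: (rev_factor q N) (h1 N) => r hr.
move: (rev_factor q m) (h1 m) => r' hr'; move: node_scale h4 => L h4.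
rewrite /X -/al; move: (al ^+ N) h6 => Z h6.
move: (\prod_i _) => B; move: (\prod_(i | _) _) => A.
move: (qpoch q q (N - m)) (qpoch q q m) (qpoch al q N.+1) => D1 D2 D3.
move: (qpoch (q / al) q N) (qpoch (al * Q) q N) (qpoch (q / (al * Q)) q N) => D4 D5 D6.
clearbody al; clear X X0 alQ0 h1 areg areg' aareg.
rewrite !(invfM, invrN, invrK).
move: A^-1 D1^-1 D2^-1 D3^-1 D4^-1 => A' D1' D2' D3' D4'.
by field; rewrite al0 hr hr' h4 h5 h6.
Qed.

(** The residues at the powers of q and those at the poles 1/(a_i q^m) have
opposite sums. The first family becomes the bilateral series in Q, the second
one the basic hypergeometric series in the inverse of Q. *)
Lemma finite_identity :
  \sum_(k < N.*2.+1) node_term k = \sum_j \sum_(m < N.+1) pole_term j m.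
Proof.
have := residue_sum node_inj size_numer.
move/(congr1 (fun x => node_scale * x)); rewrite mulr0 mulr_sumr big_sumType /=.
rewrite (eq_bigr _ (fun k _ => residue1 k)).
rewrite (eq_bigr (fun p : 'I_s * 'I_N.+1 => - pole_term p.1 p.2)); last first.
  by move=> [j m] _; exact: residue2.
rewrite sumrN -(pair_bigA _ (fun j (m : 'I_N.+1) => pole_term j m)) /= => /eqP.
by rewrite subr_eq0 => /eqP.
Qed.

End Finite.

(** * Passing to the limit under a geometric dominator *)

Section Tame.
Variable R : realType.
Local Notation C := (Cx R).
Implicit Types (f g : nat -> nat -> C) (l : nat -> C).

(** A double family, uniformly bounded and convergent in its first index.
After multiplication by w^n with |w| < 1 it can be summed and its limit taken
termwise. *)
Definition tame f l :=
  (exists B : R, forall N n, cabs (f N n) <= B) /\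
  (forall n, (fun N => f N n) @ \oo --> l n).

Lemma tame_mul f g l l' : tame f l -> tame g l' ->
  tame (fun N n => f N n * g N n) (fun n => l n * l' n).
Proof.
move=> [[B hB] hf] [[B' hB'] hg]; split; last by move=> n; exact: cvgMC.
by exists (B * B') => N n; rewrite cabsM ler_pM ?cabs_ge0.
Qed.

Lemma tame_cst l (B : R) : (forall n, cabs (l n) <= B) -> tame (fun=> l) l.
Proof. by move=> h; split; [exists B | move=> n; exact: cvg_cst]. Qed.

Lemma tame1 : tame (fun _ _ => 1) (fun=> 1).
Proof. by apply: (@tame_cst (fun=> 1) 1) => n; rewrite cabs1. Qed.

Lemma tame_prod (I : Type) (r : seq I) (P : pred I) (F : I -> nat -> nat -> C) (L : I -> nat -> C) :
  (forall i, P i -> tame (F i) (L i)) ->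
  tame (fun N n => \prod_(i <- r | P i) F i N n) (fun n => \prod_(i <- r | P i) L i n).
Proof.
move=> h; elim: r => [|i r IH].
  have := tame1; congr tame; first by apply/funext => N; apply/funext => n; rewrite big_nil.
  by apply/funext => n; rewrite big_nil.
case Pi : (P i).
  have := tame_mul (h i Pi) IH; congr tame.
    by apply/funext => N; apply/funext => n; rewrite big_cons Pi.
  by apply/funext => n; rewrite big_cons Pi.
move: IH; congr tame; first by apply/funext => N; apply/funext => n; rewrite big_cons Pi.
by apply/funext => n; rewrite big_cons Pi.
Qed.

Lemma tame_sum f l (w : C) (g : nat -> nat) : cabs w < 1 -> tame f l ->
  (forall N, (N <= g N)%N) ->
  geo_summable (fun n => l n * w ^+ n) /\
  (fun N => \sum_(n < g N) f N n * w ^+ n) @ \oo --> csum (fun n => l n * w ^+ n).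
Proof.
move=> w1 [[B hB] hf] gN.
have B0 : 0 <= B by apply: le_trans (hB 0%N 0%N); exact: cabs_ge0.
pose u N n := if (n < g N)%N then f N n * w ^+ n else 0.
have w01 : 0 <= cabs w < 1 by rewrite cabs_ge0.
have [hd hc] : geo_bound (fun n => l n * w ^+ n) B (cabs w) /\
    (fun N => csum (u N)) @ \oo --> csum (fun n => l n * w ^+ n).
  apply: (@tannery _ _ _ _ u _ B (cabs w) w01).
    apply: nearW => N n; rewrite /u; case: ifP => _.
      by rewrite cabsM cabsX ler_wpM2r ?exprn_ge0 ?cabs_ge0.
    by rewrite cabs0 mulr_ge0 ?exprn_ge0 ?cabs_ge0.
  move=> n; have h : (fun N => w ^+ n * f N n) @ \oo --> w ^+ n * l n by exact: cvgZC.
  rewrite [X in _ --> X]mulrC; apply: cvg_trans h; apply: near_eq_cvg.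
  exists n.+1 => // N /= nN; rewrite /u.
  by rewrite (leq_trans nN (gN N)) mulrC.
split; first by exists B, (cabs w).
rewrite (_ : (fun N => _) = (fun N => csum (u N))) //.
apply/funext => N; rewrite (@csum_fin _ (u N) (g N)).
  by apply: eq_bigr => i _; rewrite /u ltn_ord.
by move=> n h; rewrite /u ltnNge h.
Qed.

Variable q : C.
Hypotheses (q0 : q != 0) (q1 : cabs q < 1).

Lemma cvg_nat_oo (g : nat -> nat) :
  (forall K, exists N0, forall N, (N0 <= N)%N -> (K <= g N)%N) -> g @ \oo --> \oo.
Proof.
move=> h A [K _ hA]; have [N0 hN] := h K.
by exists N0 => // N /= /hN hK; apply: hA.
Qed.

Lemma tame_qpoch (c : C) (g : nat -> nat -> nat) :
  (forall n K, exists N0, forall N, (N0 <= N)%N -> (K <= g N n)%N) ->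
  tame (fun N n => qpoch c q (g N n)) (fun=> qpoch_oo c q).
Proof.
move=> h; split; first by exists (expR (cabs c / (1 - cabs q))) => N n; exact: qpoch_le.
move=> n; apply: (@cvg_comp _ _ _ (fun N => g N n) (qpoch c q) \oo \oo).
  exact: cvg_nat_oo.
exact: qpoch_cvg.
Qed.

Lemma tame_qpochV (c : C) (g : nat -> nat -> nat) : qregular q c ->
  (forall n K, exists N0, forall N, (N0 <= N)%N -> (K <= g N n)%N) ->
  tame (fun N n => (qpoch c q (g N n))^-1) (fun=> (qpoch_oo c q)^-1).
Proof.
move=> hc h; split.
  by have [B hB] := qpochV_bounded q1 hc; exists B => N n; exact: hB.
move=> n; apply: (@cvg_comp _ _ _ (fun N => g N n) (fun d => (qpoch c q d)^-1) \oo \oo).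
  exact: cvg_nat_oo.
exact: cvgV_qpoch.
Qed.

Lemma tame_qpoch_cst (c : C) (g : nat -> nat) :
  tame (fun _ n => qpoch c q (g n)) (fun n => qpoch c q (g n)).
Proof. by apply: tame_cst => n; exact: qpoch_le. Qed.

Lemma tame_qpochV_cst (c : C) (g : nat -> nat) : qregular q c ->
  tame (fun _ n => (qpoch c q (g n))^-1) (fun n => (qpoch c q (g n))^-1).
Proof.
by move=> hc; have [B hB] := qpochV_bounded q1 hc; apply: tame_cst => n; exact: hB.
Qed.

Lemma tame_qpoch_shift (c : C) :
  tame (fun N n => qpoch (c * q ^+ n) q N) (fun n => qpoch_oo (c * q ^+ n) q).
Proof.
split; last by move=> n; exact: qpoch_cvg.
exists (expR (cabs c / (1 - cabs q))) => N n.
apply: le_trans (qpoch_le q1 _ _) _; rewrite ler_expR ler_wpM2r //.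
  by rewrite invr_ge0 subr_ge0 ltW.
by rewrite cabsM cabsX ler_piMr ?cabs_ge0 // exprn_ile1 ?cabs_ge0 // ltW.
Qed.

Lemma qregular_q : qregular q q.
Proof.
move=> k; rewrite -exprS subr_eq0 eq_sym; apply/eqP => e.
by have := @cabsX_lt1 _ q k.+1 q1 isT; rewrite e cabs1 ltxx.
Qed.

End Tame.

(** * The bilateral connection formula *)

Section Bilateral.
Variable R : realType.
Local Notation C := (Cx R).
Variable q : C.
Hypotheses (q0 : q != 0) (q1 : cabs q < 1).
Variables (s : nat) (a b : 'I_s -> C) (Q : C).
Hypotheses (s0 : (0 < s)%N) (Q0 : Q != 0).
Hypotheses (a0 : forall i, a i != 0) (b0 : forall i, b i != 0).
Hypotheses (areg : forall i, qregular q (a i)) (areg' : forall i, qregular q (q / a i)).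
Hypotheses (aareg : forall i j, i != j -> qregular q (a i / a j)).

(** The ratio that governs both the decay of the bilateral series on its
negative side and the argument of the series in the inverse of Q. *)
Definition param_ratio : C := (\prod_i b i) / \prod_i a i.

Hypotheses (Q1 : cabs Q < 1) (zQ : cabs (param_ratio / Q) < 1).

(** The term at q^n for n >= 0 of the finite identity, without the factor
Q^(N+n). *)
Definition pos_summand N n : C :=
  qpoch (q / Q) q (N + n) * qpoch Q q (N - n) *
  (qpoch q q (N + n))^-1 * (qpoch q q (N - n))^-1 *
  \prod_i (qpoch (b i * q ^+ n) q N * qpoch (a i) q n * (qpoch (a i) q (n + N.+1))^-1).

(** The term at q^(-t-1) of the finite identity. Reversing the q-products
extracts the power (z/Q)^(t+1), and every remaining factor is bounded. *)
Definition neg_summand N t : C :=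
  qpoch (q / Q) q (N - t.+1) * qpoch Q q (N + t.+1) *
  (qpoch q q (N - t.+1))^-1 * (qpoch q q (N + t.+1))^-1 *
  \prod_i (qpoch (q / b i) q t.+1 * qpoch (b i) q (N - t.+1) *
           (qpoch (q / a i) q t.+1)^-1 * (qpoch (a i) q (N - t))^-1).

(** The term at the pole 1/(a_j q^m) of the finite identity, without Q^N and
the power (z/Q)^m. *)
Definition pole_summand j N m : C :=
  qpoch (a j * Q) q (N + m) * qpoch (q / (a j * Q)) q (N - m) *
  (qpoch (a j) q (N + m).+1)^-1 * (qpoch (q / a j) q (N - m))^-1 *
  \prod_i (qpoch (q * a j / b i) q m * qpoch (b i / a j) q (N - m)) *
  \prod_(i | i != j) ((qpoch (q * a j / a i) q m)^-1 * (qpoch (a i / a j) q (N.+1 - m))^-1) *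
  (qpoch q q m)^-1 * (qpoch q q (N - m))^-1.

Lemma node_term_pos N n : (n <= N)%N ->
  node_term q a b Q N (N + n) = Q ^+ N * (pos_summand N n * Q ^+ n).
Proof.
move=> nN; rewrite /node_term /pos_summand.
have -> : (N.*2 - (N + n) = N - n)%N by lia.
have -> : q ^+ (N + n) / q ^+ N = q ^+ n by rewrite exprD mulrAC divff ?mul1r ?qX_neq0.
rewrite exprD invfM.
have -> : \prod_i (qpoch (b i * q ^+ n) q N / qpoch (a i * q ^+ n) q N.+1) =
  \prod_i (qpoch (b i * q ^+ n) q N * qpoch (a i) q n * (qpoch (a i) q (n + N.+1))^-1).
  apply: eq_bigr => i _; rewrite qpochD invfM mulrA mulfK //.
  exact: qpoch_neq0.
by rewrite [(N + n)%N]addnC; ring.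
Qed.

(** Where the region |z| < |Q| comes from: both the numerators and the
denominators are reversed, and b_i/a_i is gained at each step. *)
Lemma node_term_neg N t : (t < N)%N ->
  node_term q a b Q N (N - t.+1) = Q ^+ N * (param_ratio / Q * (neg_summand N t * (param_ratio / Q) ^+ t)).
Proof.
move=> tN; rewrite /node_term /neg_summand.
have -> : (N.*2 - (N - t.+1) = N + t.+1)%N by lia.
have -> : q ^+ (N - t.+1)%N / q ^+ N = (q ^+ t.+1)^-1.
  by rewrite -{2}(subnK tN) exprD invfM mulrA divff ?mul1r ?qX_neq0.
have -> : \prod_i (qpoch (b i / q ^+ t.+1) q N / qpoch (a i / q ^+ t.+1) q N.+1) =
  param_ratio ^+ t.+1 * \prod_i (qpoch (q / b i) q t.+1 * qpoch (b i) q (N - t.+1) *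
           (qpoch (q / a i) q t.+1)^-1 * (qpoch (a i) q (N - t))^-1).
  rewrite /param_ratio -prodf_div -prodrXl -big_split /=; apply: eq_bigr => i _.
  have e1 : N = (t.+1 + (N - t.+1))%N by lia.
  have e2 : N.+1 = (t.+1 + (N - t))%N by lia.
  rewrite {1}e1 {1}e2 !qpoch_revD // !invfM exprMn exprVn.
  have h := rev_factor_neq0 q0 t.+1.
  by field; rewrite h !expf_neq0 ?qpoch_neq0.
have -> : Q ^+ (N - t.+1)%N = Q ^+ N / Q ^+ t.+1.
  by rewrite -{2}(subnK tN) exprD mulfK ?expf_neq0.
set P := \prod_i _; rewrite !(invfM, exprMn, exprVn, exprS); ring.
Qed.

Lemma pole_termE N j m : (m <= N)%N ->
  pole_term q a b Q N j m = Q ^+ N * (pole_summand j N m * (param_ratio / Q) ^+ m).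
Proof.
move=> mN; rewrite /pole_term /pole_summand.
have eN : N = (m + (N - m))%N by lia.
have eN1 : N.+1 = (m + (N.+1 - m))%N by lia.
have aj := a0 j; have qm := qX_neq0 q0 m.
have revE (c : C) n : c != 0 -> qpoch (c / a j / q ^+ m) q (m + n) =
    (c / a j) ^+ m * rev_factor q m * (qpoch (q * a j / c) q m * qpoch (c / a j) q n).
  move=> c0; rewrite qpoch_revD ?mulf_neq0 ?invr_neq0 // mulrA.
  by congr (_ * qpoch _ _ _ * _); field; rewrite ?aj ?c0.
have divE (c : C) : c / (a j * q ^+ m) = c / a j / q ^+ m by rewrite invfM mulrA.
set B := \prod_i qpoch (b i / (a j * q ^+ m)) q N.
set A := \prod_(i | i != j) qpoch (a i / (a j * q ^+ m)) q N.+1.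
have -> : B = \prod_i ((b i / a j) ^+ m * rev_factor q m) *
    \prod_i (qpoch (q * a j / b i) q m * qpoch (b i / a j) q (N - m)).
  rewrite -big_split /=; apply: eq_bigr => i _.
  by rewrite divE {1}eN revE.
have -> : A = \prod_(i | i != j) ((a i / a j) ^+ m * rev_factor q m) *
    \prod_(i | i != j) (qpoch (q * a j / a i) q m * qpoch (a i / a j) q (N.+1 - m)).
  rewrite -big_split /=; apply: eq_bigr => i _.
  by rewrite divE {1}eN1 revE.
have -> : \prod_i ((b i / a j) ^+ m * rev_factor q m) =
    param_ratio ^+ m * (\prod_(i | i != j) ((a i / a j) ^+ m * rev_factor q m) * rev_factor q m).
  rewrite [X in _ * X](_ : _ = \prod_i ((a i / a j) ^+ m * rev_factor q m)).
    rewrite /param_ratio -prodf_div -prodrXl -big_split /=; apply: eq_bigr => i _.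
    by rewrite mulrA -exprMn; congr (_ ^+ _ * _); field; rewrite ?aj ?a0.
  by rewrite [RHS](bigD1 j) //= divff // expr1n mul1r mulrC.
have -> : \prod_(i | i != j) ((qpoch (q * a j / a i) q m)^-1 * (qpoch (a i / a j) q (N.+1 - m))^-1)
   = (\prod_(i | i != j) (qpoch (q * a j / a i) q m * qpoch (a i / a j) q (N.+1 - m)))^-1.
  by rewrite -prodfV; apply: eq_bigr => i _; rewrite invfM.
have AU : \prod_(i | i != j) ((a i / a j) ^+ m * rev_factor q m) != 0.
  apply/prodf_neq0 => i _; apply: mulf_neq0; last exact: rev_factor_neq0.
  by rewrite expf_neq0 // mulf_neq0 ?invr_neq0.
rewrite -addnS [(N + m.+1)%N]addnC addSnnS [(N + m)%N]addnC !qpochD.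
have E1 : qpoch (q / (a j * q ^+ m * Q)) q N =
    (q / (a j * Q)) ^+ m * rev_factor q m * qpoch (a j * Q) q m * qpoch (q / (a j * Q)) q (N - m).
  have cabs0 : q / (a j * Q) != 0 by rewrite !mulf_neq0 ?invr_neq0 ?mulf_neq0.
  rewrite {1}eN (_ : q / (a j * q ^+ m * Q) = q / (a j * Q) / q ^+ m); last first.
    by field; rewrite aj Q0 qm.
  by rewrite qpoch_revD //; congr (_ * qpoch _ _ _ * _); field; rewrite ?aj ?q0 ?Q0.
have E2 : qpoch (q / (a j * q ^+ m)) q N =
    (q / a j) ^+ m * rev_factor q m * qpoch (a j) q m * qpoch (q / a j) q (N - m).
  have cabs0 : q / a j != 0 by rewrite mulf_neq0 ?invr_neq0.
  rewrite {1}eN divE qpoch_revD //; congr (_ * qpoch _ _ _ * _); field.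
  by rewrite ?aj ?q0.
have am : qpoch (a j) q m != 0 by exact: qpoch_neq0.
have hr := rev_factor_neq0 q0 m.
have E3 : (q / (a j * Q)) ^+ m = (q / a j) ^+ m / Q ^+ m.
  by rewrite -expr_div_n; congr (_ ^+ _); field; rewrite aj Q0.
have qa0 : (q / a j) ^+ m != 0 by rewrite expf_neq0 ?mulf_neq0 ?invr_neq0.
rewrite E1 E2 E3 [(param_ratio / Q) ^+ m]expr_div_n [a j * Q * q ^+ m]mulrAC.
move: AU; set U := bigop.body _ _ _ => hU.
set V := bigop.body _ _ _; set W := bigop.body _ _ _.
move: ((q / a j) ^+ m) qa0 (rev_factor q m) hr (qpoch (a j) q m) am => G hG r hr P hP.
have hQ : Q ^+ m != 0 by rewrite expf_neq0.
move: (Q ^+ m) hQ (Q ^+ N) (param_ratio ^+ m) => H hH H' z.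
clearbody U V W.
move: (qpoch _ q N) (qpoch (a j * Q) q m) (qpoch _ q (N - m)) => D1 D2 D3.
move: (qpoch _ q N.+1) (qpoch _ q (N - m)) (qpoch _ q m) (qpoch _ q (N - m)) => D4 D5 D6 D7.
rewrite !invfM.
move: (W^-1) (V^-1) (D4^-1) (D5^-1) (D6^-1) (D7^-1) => W' V' D4' D5' D6' D7'.
clear E1 E2 E3 revE divE eN eN1 A B aareg areg areg'.
by field; rewrite hH hP hU hr hG.
Qed.


(** The common factor Q^N disappears, which leaves terms that converge as N
grows. *)
Lemma finite_identity_split N :
  \sum_(n < N.+1) pos_summand N n * Q ^+ n +
    param_ratio / Q * (\sum_(t < N) neg_summand N t * (param_ratio / Q) ^+ t) =
  \sum_j \sum_(m < N.+1) pole_summand j N m * (param_ratio / Q) ^+ m.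
Proof.
have h := finite_identity q0 q1 b s0 Q0 a0 areg areg' aareg N.
apply: (mulfI (expf_neq0 N Q0)).
have -> : Q ^+ N * \sum_j \sum_(m < N.+1) pole_summand j N m * (param_ratio / Q) ^+ m =
    \sum_j \sum_(m < N.+1) pole_term q a b Q N j m.
  rewrite mulr_sumr; apply: eq_bigr => j _; rewrite mulr_sumr; apply: eq_bigr => m _.
  by rewrite pole_termE // -ltnS.
rewrite -h -(big_mkord xpredT (fun k => node_term q a b Q N k)).
rewrite (big_cat_nat _ (n := N)) //=; last by rewrite -addnn; lia.
rewrite mulrDr addrC; congr (_ + _).
  have -> : \sum_(N <= i < N.*2.+1) node_term q a b Q N i =
            \sum_(0 <= i < N.*2.+1 - N) node_term q a b Q N (i + N) by exact: (big_addn 0 _ N).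
  rewrite (_ : (N.*2.+1 - N = N.+1)%N); last by rewrite -addnn; lia.
  rewrite big_mkord mulr_sumr; apply: eq_bigr => n _.
  by rewrite addnC node_term_pos // -ltnS.
rewrite big_nat_rev /= add0n big_mkord !mulr_sumr; apply: eq_bigr => t _.
by rewrite node_term_neg.
Qed.

Lemma big_tendsto (g : nat -> nat -> nat) :
  (forall n, exists c, forall N, (N <= g N n + c)%N) ->
  forall n K, exists N0, forall N, (N0 <= N)%N -> (K <= g N n)%N.
Proof.
by move=> h n K; have [c hc] := h n; exists (K + c)%N => N hN; have := hc N; lia.
Qed.

Ltac tendsto := apply: big_tendsto; let n := fresh in intro n; exists n.+1; intro; lia.

Lemma tame_pos_summand : tame pos_summand (fun n =>
  qpoch_oo (q / Q) q * qpoch_oo Q q * (qpoch_oo q q)^-1 * (qpoch_oo q q)^-1 *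
  \prod_i (qpoch_oo (b i * q ^+ n) q * qpoch (a i) q n * (qpoch_oo (a i) q)^-1)).
Proof.
apply: tame_mul.
  apply: tame_mul; last by apply: tame_qpochV; [|exact: qregular_q|tendsto].
  apply: tame_mul; last by apply: tame_qpochV; [|exact: qregular_q|tendsto].
  by apply: tame_mul; apply: tame_qpoch => //; tendsto.
apply: tame_prod => i _; apply: tame_mul; last by apply: tame_qpochV => //; tendsto.
by apply: tame_mul; [exact: tame_qpoch_shift | exact: tame_qpoch_cst].
Qed.

Lemma tame_neg_summand : tame neg_summand (fun t =>
  qpoch_oo (q / Q) q * qpoch_oo Q q * (qpoch_oo q q)^-1 * (qpoch_oo q q)^-1 *
  \prod_i (qpoch (q / b i) q t.+1 * qpoch_oo (b i) q *
    (qpoch (q / a i) q t.+1)^-1 * (qpoch_oo (a i) q)^-1)).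
Proof.
apply: tame_mul.
  apply: tame_mul; last by apply: tame_qpochV; [|exact: qregular_q|tendsto].
  apply: tame_mul; last by apply: tame_qpochV; [|exact: qregular_q|tendsto].
  by apply: tame_mul; apply: tame_qpoch => //; tendsto.
apply: tame_prod => i _; apply: tame_mul; last by apply: tame_qpochV => //; tendsto.
apply: tame_mul; last exact: (@tame_qpochV_cst _ _ q1 _ succn).
by apply: tame_mul; [exact: (@tame_qpoch_cst _ _ q1 _ succn) | apply: tame_qpoch => //; tendsto].
Qed.

Lemma qregular_swap i j : i != j -> qregular q (q * a j / a i).
Proof.
by move=> ij k; have := aareg (j := i) (i := j) _ k.+1; rewrite eq_sym => /(_ ij); rewrite exprS; congr (1 - _ != 0); ring.
Qed.

Lemma tame_pole_summand j : tame (pole_summand j) (fun m =>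
  qpoch_oo (a j * Q) q * qpoch_oo (q / (a j * Q)) q *
  (qpoch_oo (a j) q)^-1 * (qpoch_oo (q / a j) q)^-1 *
  \prod_i (qpoch (q * a j / b i) q m * qpoch_oo (b i / a j) q) *
  \prod_(i | i != j) ((qpoch (q * a j / a i) q m)^-1 * (qpoch_oo (a i / a j) q)^-1) *
  (qpoch q q m)^-1 * (qpoch_oo q q)^-1).
Proof.
apply: tame_mul; last by apply: tame_qpochV; [|exact: qregular_q|tendsto].
apply: tame_mul; last by apply: (@tame_qpochV_cst _ _ q1 _ id); exact: qregular_q.
apply: tame_mul.
  apply: tame_mul.
    apply: tame_mul; last by apply: tame_qpochV => //; tendsto.
    apply: tame_mul; last by apply: tame_qpochV => //; tendsto.
    by apply: tame_mul; apply: tame_qpoch => //; tendsto.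
  apply: tame_prod => i _; apply: tame_mul; first exact: (@tame_qpoch_cst _ _ q1 _ id).
  by apply: tame_qpoch => //; tendsto.
apply: tame_prod => i ij; apply: tame_mul.
  by apply: (@tame_qpochV_cst _ _ q1 _ id); exact: qregular_swap.
by apply: tame_qpochV => //; [exact: aareg | tendsto].
Qed.

Hypotheses (Qreg : qregular q Q) (Qreg' : qregular q (q / Q)) (breg : forall i, qregular q (b i)).

(** A nonterminating connection formula on the whole annulus |z| < |Q| < 1.
The left-hand side is the bilateral series with general term prod_i
(a_i)_n/(b_i)_n Q^n, split at n = 0. Its continuation past |Q| = |q| needs no
separate argument, since the finite identity holds for every Q and its terms
are dominated on the annulus. *)
Theorem bilateral :
  geo_summable (fun t => \prod_i (qpoch (q / b i) q t.+1 / qpoch (q / a i) q t.+1) * (param_ratio / Q) ^+ t) /\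
  csum (fun n => \prod_i (qpoch (a i) q n / qpoch (b i) q n) * Q ^+ n) +
  param_ratio / Q * csum (fun t => \prod_i (qpoch (q / b i) q t.+1 / qpoch (q / a i) q t.+1) * (param_ratio / Q) ^+ t) =
  \prod_i (qpoch_oo (a i) q / qpoch_oo (b i) q) *
  \sum_j (qpochs_oo [:: q; q; a j * Q; q / (a j * Q)] q
           / qpochs_oo [:: a j; q / a j; Q; q / Q] q
    * (\prod_i qpoch_oo (b i / a j) q
       / (\prod_(i | i != j) qpoch_oo (a i / a j) q * qpoch_oo q q))
    * csum (fun m => \prod_i qpoch (q * a j / b i) q m
       / (qpoch q q m * \prod_(i | i != j) qpoch (q * a j / a i) q m) * (param_ratio / Q) ^+ m)).
Proof.
have [gp cp] := tame_sum Q1 tame_pos_summand (g := succn) (fun N => leqnSn N).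
have [gn cn'] := tame_sum zQ tame_neg_summand (g := id) (fun N => leqnn N).
have hj j := tame_sum zQ (tame_pole_summand j) (g := succn) (fun N => leqnSn N).
set Kq := qpoch_oo (q / Q) q * qpoch_oo Q q * (qpoch_oo q q)^-1 * (qpoch_oo q q)^-1.
set Kab := \prod_i (qpoch_oo (a i) q / qpoch_oo (b i) q).
have Kq0 : Kq != 0.
  by rewrite !mulf_neq0 ?invr_neq0 ?qpoch_oo_neq0 //; exact: qregular_q.
have Kab0 : Kab != 0.
  by apply/prodf_neq0 => i _; rewrite mulf_neq0 ?invr_neq0 ?qpoch_oo_neq0.
pose P n := \prod_i (qpoch (a i) q n / qpoch (b i) q n) * Q ^+ n.
pose M t := \prod_i (qpoch (q / b i) q t.+1 / qpoch (q / a i) q t.+1) * (param_ratio / Q) ^+ t.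
pose phi j m := \prod_i qpoch (q * a j / b i) q m
       / (qpoch q q m * \prod_(i | i != j) qpoch (q * a j / a i) q m).
pose kap j := qpochs_oo [:: q; q; a j * Q; q / (a j * Q)] q
           / qpochs_oo [:: a j; q / a j; Q; q / Q] q
    * (\prod_i qpoch_oo (b i / a j) q
       / (\prod_(i | i != j) qpoch_oo (a i / a j) q * qpoch_oo q q)).
have qq0 : qpoch_oo q q != 0 by apply: qpoch_oo_neq0 => //; exact: qregular_q.
have QQ0 : qpoch_oo Q q != 0 by exact: qpoch_oo_neq0.
have QQ0' : qpoch_oo (q / Q) q != 0 by exact: qpoch_oo_neq0.
have E1 : (fun n => Kq * \prod_i (qpoch_oo (b i * q ^+ n) q * qpoch (a i) q n * (qpoch_oo (a i) q)^-1) * Q ^+ n)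
    = (fun n => Kq / Kab * P n).
  apply/funext => n; rewrite /P mulrA; congr (_ * _); rewrite -mulrA; congr (_ * _).
  rewrite /Kab -prodfV -big_split /=; apply: eq_bigr => i _.
  rewrite [qpoch_oo (b i) q](qpoch_oo_split q1 _ n).
  have h1 := qpoch_neq0 n (breg i); have h2 : qpoch_oo (a i) q != 0 by exact: qpoch_oo_neq0.
  have h3 : qpoch_oo (b i * q ^+ n) q != 0 by apply: qpoch_oo_neq0 => //; exact: qregular_shift.
  by field; rewrite ?h1 ?h2 ?h3.
have E2 : (fun t => Kq * \prod_i (qpoch (q / b i) q t.+1 * qpoch_oo (b i) q *
    (qpoch (q / a i) q t.+1)^-1 * (qpoch_oo (a i) q)^-1) * (param_ratio / Q) ^+ t)
    = (fun n => Kq / Kab * M n).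
  apply/funext => n; rewrite /M mulrA; congr (_ * _); rewrite -mulrA; congr (_ * _).
  rewrite /Kab -prodfV -big_split /=; apply: eq_bigr => i _.
  have h1 := qpoch_neq0 n.+1 (areg' i); have h2 : qpoch_oo (a i) q != 0 by exact: qpoch_oo_neq0.
  have h3 : qpoch_oo (b i) q != 0 by exact: qpoch_oo_neq0.
  by field; rewrite ?h1 ?h2 ?h3.
have nz : Kq / Kab != 0 by rewrite mulf_neq0 ?invr_neq0.
have geo_summableV (u : nat -> C) (k : C) : k != 0 -> geo_summable (fun n => k * u n) -> geo_summable u.
  move=> k0 /(geo_summableZ k^-1); rewrite (_ : (fun n => _) = u) //.
  by apply/funext => n; rewrite mulKf.
have gP : geo_summable P by apply: (geo_summableV _ _ nz); rewrite -E1; exact: gp.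
have gM : geo_summable M by apply: (geo_summableV _ _ nz); rewrite -E2; exact: gn.
have gphi j : geo_summable (fun m => phi j m * (param_ratio / Q) ^+ m).
  have tp : tame (fun _ m => phi j m) (phi j).
    rewrite /phi; apply: tame_mul.
      by apply: tame_prod => i _; exact: (@tame_qpoch_cst _ _ q1 _ id).
    have := tame_mul (@tame_qpochV_cst _ _ q1 _ id (qregular_q q1))
      (@tame_prod _ _ (index_enum 'I_s) (fun i => i != j) _ _
         (fun i ij => @tame_qpochV_cst _ _ q1 _ id (qregular_swap ij))).
    congr tame; first by apply/funext => N; apply/funext => m; rewrite invfM prodfV.
    by apply/funext => m; rewrite invfM prodfV.
  by case: (tame_sum zQ tp (g := id) (fun N => leqnn N)).
split=> //.
have -> : \sum_j (qpochs_oo [:: q; q; a j * Q; q / (a j * Q)] q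
           / qpochs_oo [:: a j; q / a j; Q; q / Q] q
    * (\prod_i qpoch_oo (b i / a j) q
       / (\prod_(i | i != j) qpoch_oo (a i / a j) q * qpoch_oo q q))
    * csum (fun m => \prod_i qpoch (q * a j / b i) q m
       / (qpoch q q m * \prod_(i | i != j) qpoch (q * a j / a i) q m) * (param_ratio / Q) ^+ m)) =
    \sum_j kap j * csum (fun m => phi j m * (param_ratio / Q) ^+ m) by [].
rewrite -/M -/P.
move: cp; rewrite E1 csumZ // => cp.
move: cn'; rewrite E2 csumZ // => cn'.
have hj' j : (fun N => \sum_(m < N.+1) pole_summand j N m * (param_ratio / Q) ^+ m) @ \oo -->
    Kq * (kap j * csum (fun m => phi j m * (param_ratio / Q) ^+ m)).
  have [_] := hj j.
  rewrite (_ : (fun n => _ * (param_ratio / Q) ^+ n) = (fun m => (Kq * kap j) * (phi j m * (param_ratio / Q) ^+ m))).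
    rewrite csumZ; last exact: gphi.
    by rewrite -mulrA => h; exact: h.
  apply/funext => m; rewrite mulrA; congr (_ * _).
  rewrite /Kq /kap /phi /qpochs_oo !big_cons !big_nil !mulr1 !big_split /= !prodfV.
  set A := \prod_(i < s | i != j) qpoch _ _ _.
  set A' := \prod_(i < s | i != j) qpoch_oo _ _.
  rewrite !invfM.
  have := qq0; have := QQ0; have := QQ0'.
  move: (qpoch_oo q q) (qpoch_oo Q q) (qpoch_oo (q / Q) q) => u v w hu hv hw.
  move: (A^-1) (A'^-1) ((qpoch q q m)^-1) => x y z.
  move: ((qpoch_oo (a j) q)^-1) ((qpoch_oo (q / a j) q)^-1) => x' y'.
  by field; rewrite ?hu ?hv ?hw.
have L1 : (fun N => \sum_(n < N.+1) pos_summand N n * Q ^+ n +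
    param_ratio / Q * (\sum_(t < N) neg_summand N t * (param_ratio / Q) ^+ t)) @ \oo -->
    Kq / Kab * csum P + param_ratio / Q * (Kq / Kab * csum M).
  by apply: cvgDC; [exact: cp | apply: cvgZC; exact: cn'].
have L2 : (fun N => \sum_j \sum_(m < N.+1) pole_summand j N m * (param_ratio / Q) ^+ m) @ \oo -->
    \sum_j Kq * (kap j * csum (fun m => phi j m * (param_ratio / Q) ^+ m)).
  exact: cvg_sumr.
have E : (fun N => \sum_(n < N.+1) pos_summand N n * Q ^+ n +
    param_ratio / Q * (\sum_(t < N) neg_summand N t * (param_ratio / Q) ^+ t)) =
    (fun N => \sum_j \sum_(m < N.+1) pole_summand j N m * (param_ratio / Q) ^+ m).
  by apply/funext => N; exact: finite_identity_split.
rewrite E in L1.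
have H : Kq / Kab * csum P + param_ratio / Q * (Kq / Kab * csum M) =
    Kq * \sum_j kap j * csum (fun m => phi j m * (param_ratio / Q) ^+ m).
  by rewrite mulr_sumr; exact: (cvg_unique _ L1 L2).
move: H; set S := \sum_j _; clearbody S.
move: (csum P) (csum M) => x y H.
apply: (mulfI Kq0); rewrite mulrCA -H; field.
by rewrite Kab0 Q0.
Qed.


End Bilateral.

(** * Power series with summable coefficients *)

Section Expansions.
Variable R : realType.
Local Notation C := (Cx R).
Implicit Types (c h z : C) (rho M : R) (al be : nat -> C) (f g : C -> C).

(** A weighted l1 norm of the coefficients. It is submultiplicative, so
products of expansions, and limits of such products, need no contour integral.
*)
Definition l1_le rho M al := forall N, \sum_(0 <= n < N) cabs (al n) * rho ^+ n <= M.

Definition expansion c rho M al f :=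
  l1_le rho M al /\ forall h, cabs h < rho -> f (c + h) = csum (fun n => al n * h ^+ n).

Lemma l1_le_ge0 rho M al : l1_le rho M al -> 0 <= M.
Proof. by move=> /(_ 0%N); rewrite big_geq. Qed.

Lemma l1_le_term rho M al n : 0 < rho -> l1_le rho M al -> cabs (al n) * rho ^+ n <= M.
Proof.
move=> r0 /(_ n.+1); rewrite big_nat_recr //=; apply: le_trans.
by rewrite lerDr sumr_ge0 // => i _; rewrite mulr_ge0 ?cabs_ge0 ?exprn_ge0 // ltW.
Qed.

Lemma l1_le_geo_bound rho M al h : 0 < rho -> l1_le rho M al ->
  geo_bound (fun n => al n * h ^+ n) M (cabs h / rho).
Proof.
move=> r0 ha n; rewrite cabsM cabsX expr_div_n.
have := l1_le_term n r0 ha; rewrite -ler_pdivlMr ?exprn_gt0 // => H.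
apply: le_trans (ler_wpM2r _ H) _; first by rewrite exprn_ge0 ?cabs_ge0.
by rewrite mulrAC mulrA.
Qed.

Lemma ratio01 rho h : cabs h < rho -> 0 <= cabs h / rho < 1.
Proof.
move=> hr; have r0 : 0 < rho by apply: le_lt_trans hr; exact: cabs_ge0.
by rewrite divr_ge0 ?cabs_ge0 1?ltW //= ltr_pdivrMr // mul1r.
Qed.

Lemma l1_le_geo_summable rho M al h : l1_le rho M al -> cabs h < rho -> geo_summable (fun n => al n * h ^+ n).
Proof.
move=> ha hr; have r0 : 0 < rho by apply: le_lt_trans hr; exact: cabs_ge0.
by exists M, (cabs h / rho); split; [exact: ratio01 | exact: l1_le_geo_bound].
Qed.

Lemma l1_le_le rho rho' M M' al : 0 <= rho' <= rho -> M <= M' ->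
  l1_le rho M al -> l1_le rho' M' al.
Proof.
move=> /andP[r0 rr] MM ha N; apply: le_trans (le_trans (ha N) MM).
by apply: ler_sum => n _; rewrite ler_wpM2l ?cabs_ge0 // lerXn2r ?nnegrE // (le_trans r0).
Qed.

Lemma expansion_le c rho rho' M M' al f : 0 <= rho' <= rho -> M <= M' ->
  expansion c rho M al f -> expansion c rho' M' al f.
Proof.
move=> rr MM [h1 h2]; split; first exact: l1_le_le h1.
by move=> h hr; apply: h2; case/andP: rr => _; exact: lt_le_trans.
Qed.

Lemma expansion_cst c rho (k : C) : expansion c rho (cabs k) (fun n => if n == 0%N then k else 0) (fun=> k).
Proof.
split=> [N|h _].
  case: N => [|N]; first by rewrite big_geq // cabs_ge0.
  rewrite big_nat_recl //= mulr1 big1 ?addr0 // => i _; by rewrite cabs0 mul0r.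
rewrite (@csum_fin _ _ 1) ?big_ord1 /= ?mulr1 //.
by case=> // n _; rewrite mul0r.
Qed.

Lemma expansion_id c rho : 0 <= rho ->
  expansion c rho (cabs c + rho) (fun n => if n == 0%N then c else (n == 1%N)%:R) id.
Proof.
move=> r0; split=> [N|h _].
  case: N => [|[|N]]; first by rewrite big_geq // addr_ge0 ?cabs_ge0.
    by rewrite big_nat1 mulr1 lerDl.
  rewrite big_nat_recl // big_nat_recl //= mulr1 cabs1 mul1r expr1 big1 ?addr0 //.
  by move=> i _; rewrite cabs0 mul0r.
rewrite (@csum_fin _ _ 2) ?big_ord_recl ?big_ord0 /= ?mulr1 ?mul1r ?addr0 //.
by case=> [|[|n]] // _; rewrite mul0r.
Qed.

Lemma expansion_add c rho M M' al be f g : 0 < rho -> expansion c rho M al f -> expansion c rho M' be g ->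
  expansion c rho (M + M') (fun n => al n + be n) (fun z => f z + g z).
Proof.
move=> r0 [a1 a2] [b1 b2]; split=> [N|h hr].
  apply: le_trans (lerD (a1 N) (b1 N)); rewrite -big_split /=; apply: ler_sum => n _.
  by rewrite -mulrDl ler_wpM2r ?cabsD ?exprn_ge0 // ltW.
rewrite a2 // b2 // -csumD; [|exact: l1_le_geo_summable a1 hr|exact: l1_le_geo_summable b1 hr].
by congr csum; apply/funext => n; rewrite mulrDl.
Qed.

Lemma expansion_scale c rho M al f (k : C) : 0 < rho -> expansion c rho M al f ->
  expansion c rho (cabs k * M) (fun n => k * al n) (fun z => k * f z).
Proof.
move=> r0 [a1 a2]; split=> [N|h hr].
  under eq_bigr do rewrite cabsM -mulrA.
  by rewrite -mulr_sumr ler_wpM2l ?cabs_ge0.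
rewrite a2 // -csumZ; last exact: l1_le_geo_summable a1 hr.
by congr csum; apply/funext => n; rewrite mulrA.
Qed.

(** Submultiplicativity of the weighted l1 norm, for nonnegative coefficients.
*)
Lemma triangle_sum_le (a b : nat -> R) N : (forall n, 0 <= a n) -> (forall n, 0 <= b n) ->
  \sum_(0 <= n < N) \sum_(i < n.+1) a i * b (n - i)%N <=
  (\sum_(0 <= n < N) a n) * \sum_(0 <= n < N) b n.
Proof.
move=> a0 b0.
have -> : \sum_(0 <= n < N) \sum_(i < n.+1) a i * b (n - i)%N =
    \sum_(0 <= i < N) \sum_(0 <= n < N | (i <= n)%N) a i * b (n - i)%N.
  rewrite !big_mkord; under [RHS]eq_bigr do rewrite big_mkord.
  rewrite (eq_bigr (fun n : 'I_N => \sum_(i < N | (i < n.+1)%N) a i * b (n - i)%N)).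
    by rewrite (exchange_big_dep xpredT).
  by move=> n _; apply: (big_ord_widen N (fun i => a i * b (n - i)%N)).
rewrite mulr_suml; apply: ler_sum => i _; rewrite -mulr_sumr ler_wpM2l //.
have [iN|Ni] := leqP i N; last first.
  rewrite big_nat_cond big1; first by rewrite sumr_ge0.
  by move=> n /andP[/andP[_ nN] inn]; lia.
rewrite (big_cat_nat _ (n := i)) //= big_nat_cond big1 ?add0r; last first.
  by move=> n; case: (ltnP n i) => //; rewrite ?andbF // => ->; rewrite ?andbF.
rewrite big_nat_cond (eq_bigl (fun n => (i <= n < N)%N && true)); last first.
  by move=> n; case: (i <= n)%N; rewrite ?andbT ?andbF.
rewrite -big_nat_cond.
have -> : \sum_(i <= n < N) b (n - i)%N = \sum_(0 <= n < N - i) b n.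
  rewrite (big_addn 0 _ i); apply: eq_bigr => n _; by rewrite addnK.
rewrite [leRHS](big_cat_nat _ (n := N - i)) ?leq_subr //= lerDl sumr_ge0 //.
Qed.

(** The Cauchy product, as an exchange of summations in the array indexed by i
<= n. *)
Lemma expansion_mul c rho M M' al be f g : 0 < rho -> expansion c rho M al f -> expansion c rho M' be g ->
  expansion c rho (M * M') (fun n => \sum_(i < n.+1) al i * be (n - i)%N) (fun z => f z * g z).
Proof.
move=> r0 [a1 a2] [b1 b2]; split=> [N|h hr].
  pose a n := cabs (al n) * rho ^+ n; pose b n := cabs (be n) * rho ^+ n.
  have pos x n : 0 <= cabs x * rho ^+ n by rewrite mulr_ge0 ?cabs_ge0 ?exprn_ge0 // ltW.
  apply: le_trans (_ : \sum_(0 <= n < N) \sum_(i < n.+1) a i * b (n - i)%N <= _).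
    apply: ler_sum => n _; apply: le_trans (ler_wpM2r _ (cabs_sum _ _ _)) _.
      by rewrite exprn_ge0 // ltW.
    rewrite mulr_suml; apply: ler_sum => i _; rewrite cabsM /a /b mulrACA -exprD subnKC //.
    by rewrite -ltnS.
  apply: le_trans (triangle_sum_le _ (fun n => pos _ n) (fun n => pos _ n)) _.
  by apply: ler_pM; rewrite ?sumr_ge0.
rewrite a2 // b2 //.
have ga := l1_le_geo_summable a1 hr; have gb := l1_le_geo_summable b1 hr.
pose u i n := if (i <= n)%N then al i * be (n - i)%N * h ^+ n else 0.
have E1 n : csum (fun i => u i n) = (\sum_(i < n.+1) al i * be (n - i)%N) * h ^+ n.
  rewrite (@csum_fin _ _ n.+1); last by move=> i; rewrite /u leqNgt ltnS => /negbTE ->.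
  by rewrite mulr_suml; apply: eq_bigr => i _; rewrite /u -ltnS ltn_ord.
set x := cabs h / rho; have /andP[x0 x1] := ratio01 hr; rewrite -/x in x0 x1.
(* y^2 >= x, so that the decay x^n is shared between the indices i <= n and n. *)
pose y := (1 + x) / 2.
have y01 : 0 <= y < 1 by rewrite /y; apply/andP; split; lra.
have [y0 y1] := andP y01.
have yy0 := mulr_ge0 y0 y0.
have xy : x <= y * y by rewrite /y; nra.
have hu i n : cabs (u i n) <= (M * M') * y ^+ i * y ^+ n.
  have M0 := l1_le_ge0 a1; have M0' := l1_le_ge0 b1.
  rewrite /u; case: leqP => inn; last by rewrite cabs0 !mulr_ge0 ?exprn_ge0.
  have -> : al i * be (n - i)%N * h ^+ n = (al i * h ^+ i) * (be (n - i)%N * h ^+ (n - i)%N).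
    by rewrite mulrACA -exprD subnKC.
  rewrite cabsM; apply: le_trans (ler_pM (cabs_ge0 _) (cabs_ge0 _) (l1_le_geo_bound h r0 a1 i) (l1_le_geo_bound h r0 b1 (n - i)%N)) _.
  rewrite -/x mulrACA -exprD subnKC // -[leRHS]mulrA ler_wpM2l ?mulr_ge0 //.
  apply: le_trans (_ : (y * y) ^+ n <= _); first by apply: lerXn2r; rewrite // nnegrE.
  rewrite exprMn ler_wpM2r ?exprn_ge0 //.
  by rewrite -(subnKC inn) exprD ler_piMr ?exprn_ge0 // exprn_ile1 // ltW.
have ex := csum_exchange y01 y01 hu.
have -> : (fun n => (\sum_(i < n.+1) al i * be (n - i)%N) * h ^+ n) = (fun n => csum (fun i => u i n)).
  by apply/funext => n; rewrite E1.
rewrite -ex mulrC -csumZ //; congr csum; apply/funext => i.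
have gu : geo_summable (u i).
  by exists (M * M' * y ^+ i), y; split=> // n; exact: hu.
rewrite (csum_split i gu) big1 ?add0r; last first.
  by move=> n _; rewrite /u leqNgt ltn_ord.
rewrite mulrC -csumZ //; congr csum; apply/funext => n.
by rewrite /u leq_addl addnK exprD; ring.
Qed.

(** The geometric series of 1/(u + h). *)
Lemma expansion_inv c rho (u : C) : 0 < rho -> rho < cabs u ->
  expansion c rho (cabs u - rho)^-1 (fun n => (-1) ^+ n / u ^+ n.+1) (fun z => (u + (z - c))^-1).
Proof.
move=> r0 ru; have u0 : 0 < cabs u by exact: lt_trans ru.
have un0 : u != 0 by rewrite -cabs_gt0.
split=> [N|h hr].
  have E n : cabs ((-1) ^+ n / u ^+ n.+1) * rho ^+ n = (cabs u)^-1 * (rho / cabs u) ^+ n.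
    rewrite cabsM cabsX cabsN cabs1 expr1n mul1r cabsV cabsX exprS invfM expr_div_n; ring.
  under eq_bigr do rewrite E.
  have r1 : rho / cabs u < 1 by rewrite ltr_pdivrMr // mul1r.
  rewrite -mulr_sumr big_mkord.
  have -> : (cabs u - rho)^-1 = (cabs u)^-1 * (1 - rho / cabs u)^-1.
    by rewrite -invfM mulrBr mulr1 mulrCA divff ?mulr1 // gt_eqF.
  rewrite ler_wpM2l ?invr_ge0 ?cabs_ge0 // -[leRHS]mul1r.
  rewrite ler_pdivlMr ?subr_gt0 // mulrC -opprB mulNr -subrX1 opprB gerBl exprn_ge0 //.
  by rewrite divr_ge0 // ltW.
have E n : (-1) ^+ n / u ^+ n.+1 * h ^+ n = u^-1 * (- h / u) ^+ n.
  by rewrite expr_div_n -[- h]mulN1r exprMn exprS invfM; ring.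
under eq_fun do rewrite E.
set w := - h / u.
have w1 : cabs w < 1.
  by rewrite cabsM cabsN cabsV ltr_pdivrMr // mul1r (lt_trans hr).
have uh : u + h != 0.
  apply/negP => /eqP /eqP; rewrite addr_eq0 => /eqP e.
  by move: (lt_trans hr ru); rewrite e cabsN ltxx.
rewrite [c + h]addrC addrK (_ : (u + h)^-1 = u^-1 * (1 - w)^-1); last first.
  by rewrite /w; field; rewrite ?uh ?un0 ?opprK.
symmetry; apply: csum_cvg.
have -> : series (fun n => u^-1 * w ^+ n) = (fun N => u^-1 * ((1 - w)^-1 * (1 - w ^+ N))).
  apply/funext => N; rewrite /series /= -mulr_sumr big_mkord; congr (_ * _).
  have w10 : 1 - w != 0.
    by rewrite (_ : 1 - w = (u + h) / u) ?mulf_neq0 ?invr_neq0 // /w; field.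
  apply: (mulfI w10); rewrite mulVKf // -opprB mulNr -subrX1; ring.
apply: cvgZC; rewrite -[X in _ --> X]mulr1; apply: cvgZC.
rewrite -[X in _ --> X]subr0; apply: cvgDC; first exact: cvg_cst.
by apply: cvgN; exact: cvg_exprC.
Qed.

(** Norms that are summable over d allow the expansions of a series of
functions to be added coefficientwise. *)
Lemma expansion_csum c rho M (s : R) (al : nat -> nat -> C) (f : nat -> C -> C) :
  0 < rho -> 0 <= s < 1 -> (forall d, expansion c rho (M * s ^+ d) (al d) (f d)) ->
  expansion c rho (M / (1 - s)) (fun n => csum (fun d => al d n)) (fun z => csum (fun d => f d z)).
Proof.
move=> r0 s01 ha; have [s0 s1] := andP s01.
have M0 : 0 <= M by have [/l1_le_ge0] := ha 0%N; rewrite mulr1.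
have ga n : geo_summable (fun d => al d n).
  exists (M / rho ^+ n), s; split=> // d; have [h _] := ha d.
  by have := l1_le_term n r0 h; rewrite -ler_pdivlMr ?exprn_gt0 // mulrAC.
have geosum D : \sum_(d < D) s ^+ d <= (1 - s)^-1.
  rewrite -[leRHS]mul1r ler_pdivlMr ?subr_gt0 // mulrC -opprB mulNr -subrX1 opprB gerBl exprn_ge0 //.
split=> [N|h hr].
  have cv : (fun D => \sum_(0 <= n < N) cabs (series (fun d => al d n) D) * rho ^+ n) @ \oo -->
     \sum_(0 <= n < N) cabs (csum (fun d => al d n)) * rho ^+ n.
    by apply: cvg_sumr => n; apply: cvgMr_tmp; apply: cvg_cabs; exact: geo_summable_cvg.
  rewrite -(cvg_lim _ cv) //; apply: limr_le; first by apply/cvg_ex; eexists; exact: cv.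
  apply: nearW => D; apply: le_trans (_ : \sum_(d < D) M * s ^+ d <= _); last first.
    by rewrite -mulr_sumr ler_wpM2l.
  apply: le_trans (_ : \sum_(0 <= n < N) \sum_(d < D) cabs (al d n) * rho ^+ n <= _).
    apply: ler_sum => n _; rewrite -mulr_suml ler_wpM2r ?exprn_ge0 ?(ltW r0) //.
    by rewrite /series /= big_mkord; exact: cabs_sum.
  by rewrite exchange_big /=; apply: ler_sum => d _; case: (ha d).
have -> : (fun d => f d (c + h)) = (fun d => csum (fun n => al d n * h ^+ n)).
  by apply/funext => d; have [_ ->] := ha d.
have /andP[x0 x1] := ratio01 hr.
rewrite (csum_exchange (M := M) s01 (ratio01 hr)); last first.
  by move=> d n; have [h1 _] := ha d; exact: (l1_le_geo_bound h r0 h1 n).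
congr csum; apply/funext => n; rewrite [RHS]mulrC -csumZ //.
by congr csum; apply/funext => d; rewrite mulrC.
Qed.

(** The factor n lost by differentiation is absorbed by a slightly larger
radius. *)
Lemma mulrn_expr_le (x y : R) n : 0 <= x < y -> n.+1%:R * x ^+ n <= y ^+ n.+1 / (y - x).
Proof.
move=> /andP[x0 xy]; rewrite ler_pdivlMr ?subr_gt0 //.
apply: le_trans (_ : y ^+ n.+1 - x ^+ n.+1 <= _); last by rewrite gerBl exprn_ge0.
rewrite subrXX mulrC ler_wpM2l ?subr_ge0 ?(ltW xy) //.
rewrite -[n.+1 in leLHS]card_ord mulr_natl -sumr_const; apply: ler_sum => i _.
have iN : (i <= n)%N by rewrite -ltnS.
rewrite /= -{1}(subnK iN) exprD ler_wpM2r ?exprn_ge0 //.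
by rewrite lerXn2r ?nnegrE ?(le_trans x0) // ltW.
Qed.

Definition dcoef (al : nat -> C) n : C := n.+1%:R * al n.+1.

Lemma l1_le_dcoef rho rho' M al : 0 <= rho' < rho -> l1_le rho M al ->
  l1_le rho' (M / (rho - rho')) (dcoef al).
Proof.
move=> /andP[r0 rr] ha N.
have rg : 0 < rho by exact: le_lt_trans rr.
apply: le_trans (_ : (\sum_(0 <= n < N) cabs (al n.+1) * rho ^+ n.+1) / (rho - rho') <= _).
  rewrite mulr_suml; apply: ler_sum => n _.
  rewrite cabsM cabs_nat -mulrA mulrCA -mulrA ler_wpM2l ?cabs_ge0 //.
  by apply: mulrn_expr_le; rewrite r0.
rewrite ler_wpM2r ?invr_ge0 ?subr_ge0 ?(ltW rr) //.
apply: le_trans (ha N.+1); rewrite big_nat_recl // lerDr.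
by rewrite mulr_ge0 ?cabs_ge0 // exprn_ge0 // ltW.
Qed.

(** The difference quotient is differentiated termwise: on a disc of radius
strictly between |h| and rho, the quotients ((h+t)^n - h^n)/t are dominated
uniformly in t. *)
Lemma expansion_quotient c rho M al f h : 0 < rho -> expansion c rho M al f -> cabs h < rho ->
  (fun t : C => t^-1 *: (f (t + (c + h)) - f (c + h))) @ 0^' -->
  csum (fun n => dcoef al n * h ^+ n).
Proof.
move=> r0 [a1 a2] hr.
have M0 := l1_le_ge0 a1.
(* The quotients are bounded on the disc of radius si, where |h| < si < rho,
   and the gap between si and rh absorbs the factor n. *)
pose si := (cabs h + rho) / 2; pose rh := (si + rho) / 2.
have hs : cabs h < si by rewrite /si; lra.
have sr : si < rh by rewrite /rh /si; lra.
have rr : rh < rho by rewrite /rh /si; lra.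
have si0 : 0 < si by apply: le_lt_trans hs; exact: cabs_ge0.
have rh0 : 0 < rh by lra.
clearbody si rh.
pose u (t : C) n := al n * \sum_(i < n) (t + h) ^+ (n.-1 - i) * h ^+ i.
have s01 : 0 <= rh / rho < 1.
  by rewrite divr_ge0 ?ltW //= ltr_pdivrMr // mul1r.
have near_t : \forall t \near (0 : C)^', cabs (t + h) < si /\ t != 0.
  apply/near_dnbhsC; exists (si - cabs h); first by rewrite subr_gt0.
  move=> t; rewrite subr0 => ht t0; split=> //.
  by apply: le_lt_trans (cabsD _ _) _; rewrite -ltrBrDr.
have hu : \forall t \near (0 : C)^', geo_bound (u t) (M / (rh - si)) (rh / rho).
  apply: filterS near_t => t [ht t0] [|n].
    by rewrite /u big_ord0 mulr0 cabs0 mulr1 divr_ge0 // subr_ge0 ltW.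
  have hs' : cabs (\sum_(i < n.+1) (t + h) ^+ (n.+1.-1 - i) * h ^+ i) <= n.+1%:R * si ^+ n.
    apply: le_trans (cabs_sum _ _ _) _.
    rewrite -[n.+1 in leRHS]card_ord mulr_natl -sumr_const; apply: ler_sum => i _.
    have iN : (i <= n)%N by rewrite -ltnS.
    rewrite cabsM !cabsX /= (_ : si ^+ n = si ^+ (n - i) * si ^+ i); last by rewrite -exprD subnK.
    apply: ler_pM; rewrite ?exprn_ge0 ?cabs_ge0 //; apply: lerXn2r; rewrite ?nnegrE ?cabs_ge0 // ltW //.
  have hd : n.+1%:R * si ^+ n <= rh ^+ n.+1 / (rh - si).
    by apply: mulrn_expr_le; rewrite ltW.
  rewrite /u cabsM; apply: le_trans (ler_wpM2l (cabs_ge0 _) (le_trans hs' hd)) _.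
  have := l1_le_term n.+1 r0 a1; rewrite -ler_pdivlMr ?exprn_gt0 // => H.
  apply: le_trans (ler_wpM2r _ H) _.
    by rewrite divr_ge0 ?exprn_ge0 ?ltW // subr_gt0.
  by rewrite expr_div_n le_eqVlt; apply/orP; left; apply/eqP; ring.
have cv n : (fun t => u t n) @ (0 : C)^' --> al n * (n%:R * h ^+ n.-1).
  apply: cvgZC; rewrite mulr_natl -[n in _ *+ n]card_ord -sumr_const.
  apply: cvg_sumr => i.
  have -> : h ^+ n.-1 = h ^+ (n.-1 - i) * h ^+ i.
    by rewrite -exprD subnK // -ltnS (ltn_predK (ltn_ord i)).
  rewrite ![_ * h ^+ i]mulrC; under eq_cvg do rewrite mulrC.
  apply: cvgZC.
  have c1 : (fun t : C => t + h) @ (0 : C)^' --> h.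
    rewrite -[X in _ --> X]add0r; apply: cvgDC; last exact: cvg_cst.
    exact: cvg_within.
  suff cX k : (fun t : C => (t + h) ^+ k) @ (0 : C)^' --> h ^+ k by exact: cX.
  elim: k => [|k IH].
    have -> : (fun t : C => (t + h) ^+ 0) = (fun=> 1) by apply/funext.
    exact: cvg_cst.
  have -> : (fun t : C => (t + h) ^+ k.+1) = (fun t => (t + h) * (t + h) ^+ k).
    by apply/funext => t; rewrite exprS.
  by rewrite exprS; exact: (cvgMC c1 IH).
have [gv L] := tannery s01 hu cv.
have gv' : geo_summable (fun n => al n * (n%:R * h ^+ n.-1)) by exists (M / (rh - si)), (rh / rho).
have -> : csum (fun n => dcoef al n * h ^+ n) = csum (fun n => al n * (n%:R * h ^+ n.-1)).
  rewrite [RHS]csumS // mul0r mulr0 add0r; congr csum; apply/funext => n.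
  by rewrite /dcoef /=; ring.
apply: cvg_trans L; apply: near_eq_cvg; apply: filterS near_t => t [ht t0].
have ths : cabs (h + t) < rho by rewrite addrC; lra.
rewrite (_ : t + (c + h) = c + (h + t)); last by ring.
rewrite !a2 // -mulN1r.
have g1 := l1_le_geo_summable a1 ths; have g2 := l1_le_geo_summable a1 hr.
rewrite -csumZ // -csumD //; last exact: geo_summableZ.
rewrite -[LHS]/(csum (u t)) -[RHS]/(t^-1 * _) -csumZ; last by apply: geo_summableD => //; exact: geo_summableZ.
congr csum; apply/funext => n; rewrite /u.
have := subrXX (t + h) h n; rewrite addrK => e.
have -> : \sum_(i < n) (t + h) ^+ (n.-1 - i) * h ^+ i = t^-1 * ((t + h) ^+ n - h ^+ n).
  apply: (mulfI t0); rewrite mulVKf // e.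
by rewrite [t + h]addrC; ring.
Qed.

Lemma expansion_derivable c rho M al f h : 0 < rho -> expansion c rho M al f -> cabs h < rho ->
  derivable f (c + h) 1.
Proof.
move=> r0 af hr; apply/cvg_ex; exists (csum (fun n => dcoef al n * h ^+ n)).
have L := expansion_quotient r0 af hr.
have E : (fun t : C => t^-1 *: (f (t + (c + h)) - f (c + h))) =
         (fun t : C => t^-1 *: ((f \o shift (c + h)) (t *: 1) - f (c + h))).
  by apply/funext => t; rewrite /= -[t *: 1]/(t * 1) mulr1.
by rewrite E in L; exact: L.
Qed.

Lemma expansion_derive1 c rho rho' M al f : 0 < rho' < rho -> expansion c rho M al f ->
  expansion c rho' (M / (rho - rho')) (dcoef al) (derive1 f).
Proof.
move=> /andP[r0 rr] af; split.
  by apply: l1_le_dcoef (proj1 af); rewrite ltW.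
move=> h hr; rewrite /derive1; apply: cvg_lim => //.
apply: expansion_quotient (lt_trans r0 rr) af (lt_trans hr rr).
Qed.

Lemma expansion_center c rho M al f : 0 < rho -> expansion c rho M al f -> f c = al 0%N.
Proof.
move=> r0 [_ /(_ 0)]; rewrite cabs0 addr0 => /(_ r0) ->.
rewrite (@csum_fin _ _ 1) ?big_ord1 ?expr0 ?mulr1 // => -[|n] // _.
by rewrite expr0n /= mulr0.
Qed.

(** Identifies the iterated derivatives with the coefficients, the only form
in which Taylor expansions are used. *)
Lemma expansion_derive1n c rho M al f k : 0 < rho -> expansion c rho M al f ->
  derive1n k f c = k`!%:R * al k.
Proof.
elim: k rho M al f => [|k IH] rho M al f r0 af.
  by rewrite derive1n0 (expansion_center r0 af) fact0 mul1r.
have rr : 0 < rho / 2 < rho by apply/andP; split; lra.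
have [r0' _] := andP rr.
rewrite derive1Sn (IH _ _ _ _ r0' (expansion_derive1 rr af)).
by rewrite /dcoef factS natrM; ring.
Qed.

End Expansions.

(** * The theta function and its zeros *)

Section Theta.
Variable R : realType.
Local Notation C := (Cx R).
Variable q : C.
Hypotheses (q0 : q != 0) (q1 : cabs q < 1).
Implicit Types w z x : C.

(** The ratio test. *)
Lemma eventually_geo_summable (v : nat -> R) (s : R) K : 0 < s -> (forall n, 0 <= v n) ->
  (forall n, (K <= n)%N -> v n.+1 <= s * v n) -> exists M, forall n, v n <= M * s ^+ n.
Proof.
move=> s0; elim: K v => [|K IH] v v0 hv.
  exists (v 0%N); elim=> [|n IHn]; first by rewrite mulr1.
  apply: le_trans (hv n isT) _; rewrite exprS mulrCA ler_wpM2l // ltW //.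
have [M hM] := IH (fun n => v n.+1) (fun n => v0 n.+1) (fun n Kn => hv n.+1 Kn).
exists (Num.max (v 0%N) (M / s)) => -[|n]; first by rewrite mulr1 le_max lexx.
apply: le_trans (hM n) _.
have -> : M * s ^+ n = (M / s) * s ^+ n.+1.
  by rewrite exprS -mulrA mulKf // gt_eqF.
by rewrite ler_wpM2r ?exprn_ge0 ?(ltW s0) // le_max lexx orbT.
Qed.

Lemma binS2 n : 'C(n.+1, 2) = ('C(n, 2) + n)%N.
Proof. by rewrite binS bin1 addnC. Qed.

(** The Gaussian factor q^(n(n-1)/2) beats every geometric growth, hence the
theta series converges on the whole punctured plane. *)
Lemma supergeo (y s : R) : 0 <= y -> 0 < s ->
  exists M, forall n, cabs q ^+ 'C(n, 2) * y ^+ n <= M * s ^+ n.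
Proof.
move=> y0 s0.
have [K hK] : exists K, forall n, (K <= n)%N -> y * cabs q ^+ n <= s.
  have /cvgrPdist_lt := @cvg_geomr _ y _ (cabs_q01 q1).
  move=> /(_ s s0) [K _ hK]; exists K => n /hK /=.
  by rewrite sub0r normrN ger0_norm ?mulr_ge0 ?exprn_ge0 ?cabs_ge0 // => /ltW.
apply: (@eventually_geo_summable _ s K) => // n.
  by rewrite mulr_ge0 ?exprn_ge0 ?cabs_ge0.
move=> /hK h; rewrite binS2 exprD exprS.
have -> : cabs q ^+ 'C(n, 2) * cabs q ^+ n * (y * y ^+ n) =
   (y * cabs q ^+ n) * (cabs q ^+ 'C(n, 2) * y ^+ n) by ring.
by rewrite ler_wpM2r // mulr_ge0 ?exprn_ge0 ?cabs_ge0.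
Qed.

Lemma supergeo_shift (y s : R) : 0 <= y -> 0 < s < 1 ->
  exists M, forall n, cabs q ^+ 'C(n.+2, 2) * y ^+ n.+1 <= M * s ^+ n.
Proof.
move=> y0 /andP[s0 s1]; have [M hM] := supergeo y0 s0.
exists M => n; apply: le_trans (_ : cabs q ^+ 'C(n.+1, 2) * y ^+ n.+1 <= _).
  rewrite ler_wpM2r ?exprn_ge0 // (binS2 n.+1) exprD ler_piMr ?exprn_ge0 ?cabs_ge0 //.
  by rewrite exprn_ile1 ?cabs_ge0 // ltW.
have M0 : 0 <= M.
  by have := hM 0%N; rewrite bin_small // !expr0 !mulr1; exact: le_trans.
apply: le_trans (hM n.+1) _; rewrite ler_wpM2l // exprS ler_piMl ?exprn_ge0 ?ltW //.
Qed.

(** The exponents d(d-1)/2 written as binomial coefficients, separately for d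
>= 0 and d < 0. *)
Lemma thetaE w : theta q w =
  csum (fun n => q ^+ 'C(n, 2) * w ^+ n) + csum (fun n => q ^+ 'C(n.+2, 2) * w ^- n.+1).
Proof.
have d2 (a b : nat) : (a.*2 = b)%N -> (Posz b %/ 2)%Z = a.
  by move=> <-; rewrite -muln2 PoszM mulzK.
have T n : ('C(n.+1, 2).*2 = n.+1 * n)%N.
  elim: n => [|n IH]; first by rewrite bin_small.
  by rewrite binS2 doubleD IH; lia.
rewrite /theta /csumZ; congr (csum _ + csum _); apply/funext => n.
  case: n => [|n]; first by rewrite mul0r div0z bin_small.
  rewrite (_ : Posz n.+1 * (Posz n.+1 - 1) = Posz (n.+1 * n)); last by lia.
  by rewrite (d2 'C(n.+1, 2)) // T.
rewrite (_ : Negz n * (Negz n - 1) = Posz (n.+2 * n.+1)); last by rewrite NegzE; lia.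
by rewrite (d2 'C(n.+2, 2)) // T.
Qed.

(** Each w^n and each w^(-n) has an expansion at z whose norm is the n-th
power of a constant, and the Gaussian factors make these norms summable. *)
Lemma theta_expansion z : z != 0 -> exists M al, expansion z (cabs z / 2) M al (theta q).
Proof.
move=> z0; have cz : 0 < cabs z by rewrite cabs_gt0.
set rho := cabs z / 2; have r0 : 0 < rho by rewrite divr_gt0.
have rz : rho < cabs z by rewrite /rho; lra.
have pw (f : C -> C) M al (k : nat) : expansion z rho M al f ->
    exists be, expansion z rho (M ^+ k) be (fun w => f w ^+ k).
  move=> af; elim: k => [|k [be hb]].
    by exists (fun n => if n == 0%N then 1 else 0); rewrite expr0 -(cabs1 R); exact: expansion_cst.
  by eexists; under eq_fun do rewrite exprS; rewrite exprS; exact: expansion_mul af hb.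
have mk (f : C -> C) M al (e : nat -> nat) (k : nat -> nat) (s : R) (B : R) : 0 <= s < 1 ->
    expansion z rho M al f -> (forall n, cabs q ^+ e n * M ^+ k n <= B * s ^+ n) ->
    exists M' be, expansion z rho M' be (fun w => csum (fun n => q ^+ e n * f w ^+ k n)).
  move=> s01 af hB.
  have hb n : exists be, expansion z rho (B * s ^+ n) be (fun w => q ^+ e n * f w ^+ k n).
    have [be hbe] := pw f M al (k n) af; exists (fun m => q ^+ e n * be m).
    apply: expansion_le (expansion_scale (q ^+ e n) r0 hbe); first by rewrite lexx ltW.
    by rewrite cabsX.
  have [be hbe] := choice hb.
  by exists (B / (1 - s)), (fun n => csum (fun d => be d n)); exact: expansion_csum.
have h01 : 0 <= (2^-1 : R) < 1 by apply/andP; split; lra.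
have [h0 h1] := andP h01.
have hp : 0 < (2^-1 : R) by lra.
have aid := expansion_id z (ltW r0).
have ainv : expansion z rho (cabs z - rho)^-1 (fun n => (-1) ^+ n / z ^+ n.+1) (fun w => w^-1).
  have := expansion_inv z r0 rz; congr (expansion _ _ _ _ _); apply/funext => w.
  by rewrite addrC subrK.
have [B1 hB1] := @supergeo (cabs z + rho) 2^-1 (addr_ge0 (cabs_ge0 z) (ltW r0)) hp.
have i0 : 0 <= (cabs z - rho)^-1 by rewrite invr_ge0 subr_ge0 ltW.
have hp1 : 0 < (2^-1 : R) < 1 by apply/andP; split; lra.
have [B2 hB2] := supergeo_shift i0 hp1.
have [M1 [al1 A1]] := mk _ _ _ (fun n => 'C(n, 2)) id _ _ h01 aid hB1.
have [M2 [al2 A2]] := mk _ _ _ (fun n => 'C(n.+2, 2)) succn _ _ h01 ainv hB2.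
exists (M1 + M2), (fun n => al1 n + al2 n).
have := expansion_add r0 A1 A2; congr (expansion _ _ _ _ _); apply/funext => w.
rewrite thetaE; congr (_ + csum _); apply/funext => n; by rewrite exprVn.
Qed.

(** The Gaussian binomial coefficient. *)
Definition qbin n j : C := qpoch q q n / (qpoch q q j * qpoch q q (n - j)).

Lemma qq_neq0 n : qpoch q q n != 0.
Proof. by apply: qpoch_neq0; exact: qregular_q. Qed.

Lemma qbinS n j : (j < n)%N -> qbin n.+1 j.+1 = qbin n j.+1 + q ^+ (n - j) * qbin n j.
Proof.
move=> jn; rewrite /qbin subSS.
have [m e] : exists m, n = (j + m.+1)%N by exists (n - j).-1; lia.
have -> : (n - j = m.+1)%N by lia.
have -> : (n - j.+1 = m)%N by lia.
have e' : q ^+ n.+1 = q ^+ j.+1 * q ^+ m.+1 by rewrite e -addSn exprD.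
rewrite !qpochS -!exprS e'.
have h1 := qq_neq0 j; have h2 := qq_neq0 m.
have h3 := qregular_q q1 j; have h4 := qregular_q q1 m; rewrite -!exprS in h3 h4.
move: (qpoch q q n) (q ^+ j.+1) h3 (q ^+ m.+1) h4 => x y hy z hz.
by field; rewrite h1 h2 hy hz.
Qed.

Lemma qbinn0 n : qbin n 0 = 1.
Proof. by rewrite /qbin qpoch0 mul1r subn0 divff // qq_neq0. Qed.

Lemma qbinnn n : qbin n n = 1.
Proof. by rewrite /qbin subnn qpoch0 mulr1 divff // qq_neq0. Qed.

Lemma qbinomial x n :
  qpoch (- x) q n = \sum_(j < n.+1) q ^+ 'C(j, 2) * qbin n j * x ^+ j.
Proof.
elim: n => [|n IH]; first by rewrite qpoch0 big_ord1 bin_small // qbinn0 !mulr1.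
rewrite qpochS IH mulNr opprK mulrDr mulr1.
pose c j := q ^+ 'C(j, 2) * qbin n j * x ^+ j.
have L1 : \sum_(j < n.+1) c j = 1 + \sum_(j < n) c j.+1.
  by rewrite big_ord_recl /c bin_small // qbinn0 !mulr1.
have L2 : \sum_(j < n.+1) c j = \sum_(j < n) c j + q ^+ 'C(n, 2) * x ^+ n.
  by rewrite big_ord_recr /c /= qbinnn mulr1.
rewrite -/(\sum_(j < n.+1) c j) {1}L1 L2 big_ord_recl big_ord_recr /=.
rewrite qbinn0 /bump /= add1n qbinnn (@bin_small 0 2) // !expr0 !mulr1 -!addrA; congr (_ + _).
rewrite mulrDl addrA; congr (_ + _); last first.
  by rewrite binS2 exprD exprS; ring.
rewrite mulr_suml -big_split /=; apply: eq_bigr => j _.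
rewrite /c /bump /= !add1n qbinS // binS2 exprD.
have -> : q ^+ n = q ^+ (n - j) * q ^+ j by rewrite -exprD subnK // ltnW.
by rewrite exprS; ring.
Qed.

(** The q-binomial theorem in 2N factors, shifted so that half of the factors
become 1 + q^l/w. *)
Lemma jacobi_finite w N : w != 0 ->
  qpoch (- w) q N * qpoch (q / - w) q N =
  \sum_(n < N.+1) qbin N.*2 (N + n) * (q ^+ 'C(n, 2) * w ^+ n) +
  \sum_(t < N) qbin N.*2 (N - t.+1) * (q ^+ 'C(t.+2, 2) * w ^- t.+1).
Proof.
move=> w0; have nw0 : - w != 0 by rewrite oppr_eq0.
have h := qbinomial (w / q ^+ N) N.*2.
rewrite -mulNr -addnn qpoch_revD // addnn in h.
have kN : (- w) ^+ N * rev_factor q N != 0 by rewrite mulf_neq0 ?expf_neq0 ?rev_factor_neq0.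
apply: (mulfI kN); rewrite [LHS]mulrA mulrAC [LHS]h {h}.
have rE : (- w) ^+ N * rev_factor q N = w ^+ N / q ^+ 'C(N.+1, 2).
  rewrite /rev_factor; elim: N {kN} => [|N IH]; first by rewrite big_geq // bin_small // !mul1r invr1.
  rewrite big_nat_recr //= [(- w) ^+ N.+1]exprSr mulrACA IH (binS2 N.+1) exprD [w ^+ N.+1]exprSr.
  by field; rewrite ?qX_neq0 ?expf_neq0 ?q0.
rewrite rE -(big_mkord xpredT (fun j => q ^+ 'C(j, 2) * qbin N.*2 j * (w / q ^+ N) ^+ j)).
rewrite (big_cat_nat _ (n := N)) //=; last by rewrite -addnn; lia.
rewrite mulrDr addrC; congr (_ + _).
  have -> : \sum_(N <= i < N.*2.+1) q ^+ 'C(i, 2) * qbin N.*2 i * (w / q ^+ N) ^+ i =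
      \sum_(0 <= i < N.*2.+1 - N) q ^+ 'C(i + N, 2) * qbin N.*2 (i + N) * (w / q ^+ N) ^+ (i + N).
    exact: (big_addn 0 _ N).
  rewrite (_ : (N.*2.+1 - N = N.+1)%N); last by rewrite -addnn; lia.
  rewrite big_mkord mulr_sumr; apply: eq_bigr => n _; rewrite [(n + N)%N]addnC.
  have eN : ('C(N + n, 2) + 'C(N.+1, 2) = 'C(n, 2) + N * (N + n))%N.
    elim: (nat_of_ord n) => [|k IH]; last by rewrite addnS !binS2 in IH *; lia.
    rewrite addn0 (@bin_small 0 2) // add0n; elim: (N) => // k IH.
    by rewrite !binS2 in IH *; lia.
  have eq' : q ^+ 'C(N + n, 2) * q ^+ 'C(N.+1, 2) = q ^+ 'C(n, 2) * (q ^+ N) ^+ (N + n).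
    by rewrite -!exprM -!exprD eN.
  have h1 := qX_neq0 q0 'C(N.+1, 2); have h2 : (q ^+ N) ^+ (N + n) != 0 by rewrite !expf_neq0.
  rewrite expr_div_n exprD.
  apply: (mulIf h1); apply: (mulIf h2).
  transitivity (q ^+ 'C(N + n, 2) * q ^+ 'C(N.+1, 2) * qbin N.*2 (N + n) * (w ^+ N * w ^+ n)).
    by field.
  by rewrite eq'; field.
rewrite big_nat_rev /= add0n big_mkord mulr_sumr; apply: eq_bigr => t _.
have tN := ltn_ord t.
have eN : ('C(N - t.+1, 2) + 'C(N.+1, 2) = 'C(t.+2, 2) + N * (N - t.+1))%N.
  move: (nat_of_ord t) tN => u uN.
  have [m ->] : exists m, N = (m + u.+1)%N by exists (N - u.+1)%N; rewrite subnK.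
  rewrite addnK.
  elim: m => [|m IH]; first by rewrite (@bin_small 0 2) // muln0 addn0.
  by rewrite addSn !binS2 in IH *; lia.
have eq' : q ^+ 'C(N - t.+1, 2) * q ^+ 'C(N.+1, 2) = q ^+ 'C(t.+2, 2) * (q ^+ N) ^+ (N - t.+1).
  by rewrite -!exprM -!exprD eN.
have h1 := qX_neq0 q0 'C(N.+1, 2); have h2 : (q ^+ N) ^+ (N - t.+1) != 0 by rewrite !expf_neq0.
have h3 : w ^+ t.+1 != 0 by rewrite expf_neq0.
have ew : w ^+ N = w ^+ (N - t.+1) * w ^+ t.+1 by rewrite -exprD subnK.
rewrite expr_div_n ew.
apply: (mulIf h1); apply: (mulIf h2).
transitivity (q ^+ 'C(N - t.+1, 2) * q ^+ 'C(N.+1, 2) * qbin N.*2 (N - t.+1) * w ^+ (N - t.+1)).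
  by field.
by rewrite eq'; field; rewrite h1 h3.
Qed.

(** The triple product identity; it locates the zeros of theta on the lattice
-q^Z. *)
Lemma jacobi w : w != 0 ->
  theta q w = qpoch_oo q q * qpoch_oo (- w) q * qpoch_oo (q / - w) q.
Proof.
move=> w0.
have qq0 : qpoch_oo q q != 0 by apply: qpoch_oo_neq0 => //; exact: qregular_q.
have hp : 0 < (2^-1 : R) by lra.
have c2 : cabs (2^-1 : C) < 1 by rewrite cabsV cabs_nat; lra.
have n2 : (2 : C) != 0 by rewrite pnatr_eq0.
have tb (g : nat -> nat -> nat) (v : nat -> C) (B : R) (k : nat -> nat) :
    (forall n K, exists N0, forall N, (N0 <= N)%N -> (K <= g N n)%N) ->
    (forall n K, exists N0, forall N, (N0 <= N)%N -> (K <= N.*2 - g N n)%N) ->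
    (forall N, (N <= k N)%N) ->
    (forall n, cabs (v n) <= B * 2^-1 ^+ n) ->
    (fun N => \sum_(n < k N) qbin N.*2 (g N n) * v n) @ \oo --> (qpoch_oo q q)^-1 * csum v.
  move=> hg1 hg2 hk hv.
  have t1 : tame (fun N n => qpoch q q N.*2 * ((qpoch q q (g N n))^-1 * (qpoch q q (N.*2 - g N n))^-1) * (2 ^+ n * v n))
     (fun n => qpoch_oo q q * ((qpoch_oo q q)^-1 * (qpoch_oo q q)^-1) * (2 ^+ n * v n)).
    apply: tame_mul.
      apply: tame_mul.
        by apply: tame_qpoch => // n K; exists K => N KN; rewrite -addnn; lia.
      by apply: tame_mul; apply: tame_qpochV => //; exact: qregular_q.
    apply: (@tame_cst _ _ B) => n; rewrite cabsM cabsX cabs_nat.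
    apply: le_trans (ler_wpM2l _ (hv n)) _; first by rewrite exprn_ge0.
    by rewrite mulrCA -exprMn divff ?expr1n ?mulr1.
  have [g2 c] := tame_sum c2 t1 hk.
  have e1 : (fun n => qpoch_oo q q * ((qpoch_oo q q)^-1 * (qpoch_oo q q)^-1) * (2 ^+ n * v n) * 2^-1 ^+ n)
     = (fun n => (qpoch_oo q q)^-1 * v n).
    apply/funext => n; rewrite -mulrA [2 ^+ n * v n * _]mulrAC -exprMn divff // expr1n mul1r.
    by rewrite mulVKf.
  rewrite e1 in c g2.
  have gv : geo_summable v.
    have := geo_summableZ (qpoch_oo q q) g2; rewrite (_ : (fun n => _) = v) //.
    by apply/funext => n; rewrite mulVKf.
  rewrite (csumZ _ gv) in c.
  have e2 : (fun N => \sum_(n < k N) qbin N.*2 (g N n) * v n) = (fun N => \sum_(n < k N)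
       qpoch q q N.*2 * ((qpoch q q (g N n))^-1 * (qpoch q q (N.*2 - g N n))^-1) * (2 ^+ n * v n) * 2^-1 ^+ n).
    apply/funext => N; apply: eq_bigr => n _.
    rewrite -[RHS]mulrA [2 ^+ n * v n * _]mulrAC -exprMn divff // expr1n mul1r.
    by rewrite /qbin invfM.
  by rewrite e2.
have [B1 hB1] := @supergeo (cabs w) 2^-1 (cabs_ge0 w) hp.
have hp1 : 0 < (2^-1 : R) < 1 by apply/andP; split; lra.
have iw : 0 <= (cabs w)^-1 by rewrite invr_ge0 cabs_ge0.
have [B2 hB2] := supergeo_shift iw hp1.
have L1 : (fun N => \sum_(n < N.+1) qbin N.*2 (N + n) * (q ^+ 'C(n, 2) * w ^+ n)) @ \oo -->
    (qpoch_oo q q)^-1 * csum (fun n => q ^+ 'C(n, 2) * w ^+ n).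
  apply: (tb (fun N n => (N + n)%N) _ B1 succn).
  - by move=> n K; exists K => N KN; lia.
  - by move=> n K; exists (K + n)%N => N KN; rewrite -addnn; lia.
  - by move=> N; exact: leqnSn.
  by move=> n; rewrite cabsM !cabsX.
have L2 : (fun N => \sum_(n < N) qbin N.*2 (N - n.+1) * (q ^+ 'C(n.+2, 2) * w ^- n.+1)) @ \oo -->
    (qpoch_oo q q)^-1 * csum (fun n => q ^+ 'C(n.+2, 2) * w ^- n.+1).
  apply: (tb (fun N n => (N - n.+1)%N) _ B2 id).
  - by move=> n K; exists (K + n.+1)%N => N KN; lia.
  - by move=> n K; exists K => N KN; rewrite -addnn; lia.
  - by move=> N; exact: leqnn.
  by move=> n; rewrite cabsM cabsV !cabsX -exprVn.
have L := cvgMC (@qpoch_cvg _ _ q1 (- w)) (@qpoch_cvg _ _ q1 (q / - w)).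
have E : (fun N => qpoch (- w) q N * qpoch (q / - w) q N) =
  (fun N => \sum_(n < N.+1) qbin N.*2 (N + n) * (q ^+ 'C(n, 2) * w ^+ n) +
  \sum_(t < N) qbin N.*2 (N - t.+1) * (q ^+ 'C(t.+2, 2) * w ^- t.+1)).
  by apply/funext => N; exact: jacobi_finite.
have L12 : (fun N => qpoch (- w) q N * qpoch (q / - w) q N) @ \oo -->
    (qpoch_oo q q)^-1 * csum (fun n => q ^+ 'C(n, 2) * w ^+ n) +
    (qpoch_oo q q)^-1 * csum (fun n => q ^+ 'C(n.+2, 2) * w ^- n.+1).
  by rewrite E; exact: (cvgDC L1 L2).
have H : qpoch_oo (- w) q * qpoch_oo (q / - w) q =
    (qpoch_oo q q)^-1 * csum (fun n => q ^+ 'C(n, 2) * w ^+ n) +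
    (qpoch_oo q q)^-1 * csum (fun n => q ^+ 'C(n.+2, 2) * w ^- n.+1).
  have L' : (fun N => qpoch (- w) q N * qpoch (q / - w) q N) @ \oo -->
     qpoch_oo (- w) q * qpoch_oo (q / - w) q by apply: cvgMC; exact: qpoch_cvg.
  exact: (cvg_unique _ L' L12).
by rewrite -mulrA H -mulrDr mulVKf // thetaE.
Qed.

(** For nonzero x, this says that x is not an integral power of q. *)
Definition off_lattice x := qregular q x /\ qregular q (q / x).

(** Two natural exponents encode an arbitrary integral power of q, which keeps
the arithmetic within natural powers. *)
Definition in_lattice x := exists n m, x * q ^+ n = q ^+ m.

Lemma off_latticeP x : x != 0 -> ~ in_lattice x -> off_lattice x.
Proof.
move=> x0 h; split=> k; rewrite subr_eq0 eq_sym; apply/eqP => e; apply: h.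
  by exists k, 0%N; rewrite e.
by exists 0%N, k.+1; apply: (mulIf (invr_neq0 x0)); rewrite mulr1 divff // -e exprS; ring.
Qed.

Lemma off_lattice_inv x : x != 0 -> off_lattice x -> off_lattice (q / x).
Proof.
move=> x0 [h1 h2]; split=> //.
by rewrite (_ : q / (q / x) = x) //; field; rewrite x0 q0.
Qed.

(** Two powers of q whose moduli have a ratio strictly between |q| and 1/|q|
are equal. *)
Lemma in_lattice_close x y : in_lattice x -> in_lattice y -> cabs x * cabs q < cabs y -> cabs y * cabs q < cabs x -> x = y.
Proof.
move=> [n [m e]] [n' [m' e']] h1 h2.
have h : x * q ^+ (n + m') = y * q ^+ (n' + m).
  by rewrite !exprD !mulrA e e' mulrC.
suff S (a b : nat) u v : (a < b)%N -> u * q ^+ a = v * q ^+ b -> cabs u <= cabs v * cabs q.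
  move: h; case: (ltngtP (n + m') (n' + m)) => [lt|lt|->].
  - by move=> /(S _ _ _ _ lt); rewrite leNgt h2.
  - by move=> /esym /(S _ _ _ _ lt); rewrite leNgt h1.
  by move=> /(mulIf (qX_neq0 q0 _)).
move=> ab E; have -> : u = v * q ^+ (b - a).
  by apply: (mulIf (qX_neq0 q0 a)); rewrite E -mulrA -exprD subnK // ltnW.
rewrite cabsM cabsX ler_wpM2l ?cabs_ge0 // -(subnSK ab) exprS ler_piMr ?cabs_ge0 //.
by rewrite exprn_ile1 ?cabs_ge0 // ltW.
Qed.

(** The zeros and poles of all functions of Q involved lie on lattices c q^Z,
which are discrete in the punctured plane. *)
Lemma near_off_lattice (c z : C) : c != 0 -> z != 0 -> \forall w \near z^', w != 0 /\ off_lattice (c * w).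
Proof.
move=> c0 z0; have cz : 0 < cabs z by rewrite cabs_gt0.
(* The moduli of two points within e of z have a ratio greater than |q|, so at
   most one of these points is on the lattice. *)
pose e := (1 - cabs q) / 2 * cabs z.
have e0 : 0 < e by rewrite mulr_gt0 // divr_gt0 // subr_gt0.
have ez : e <= cabs z / 2.
  by rewrite /e mulrC ler_pM2l //; have := cabs_ge0 q; lra.
have bounds w : cabs (w - z) < e -> cabs z - e < cabs w < cabs z + e.
  move=> h; have h1 := cabs_dist w z; have h2 := cabs_dist z w; rewrite (cabsC z w) in h2.
  apply/andP; split; lra.
have gap : (cabs z + e) * cabs q <= cabs z - e.
  rewrite -subr_ge0 (_ : _ - _ = cabs z * ((1 - cabs q) ^+ 2 / 2)).
    by rewrite mulr_ge0 ?cabs_ge0 // divr_ge0 // sqr_ge0.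
  by rewrite /e; field.
have w0 w : cabs (w - z) < e -> w != 0.
  by move=> /bounds /andP[h _]; rewrite -cabs_gt0; lra.
have close w w' : cabs (w - z) < e -> cabs (w' - z) < e -> in_lattice (c * w) -> in_lattice (c * w') -> w = w'.
  move=> h h' i i'; apply: (mulfI c0); apply: in_lattice_close => //.
  - rewrite !cabsM -mulrA ltr_pM2l ?cabs_gt0 //.
    have /andP[_ b1] := bounds _ h; have /andP[b2 _] := bounds _ h'.
    apply: le_lt_trans b2; apply: le_trans gap.
    by rewrite ler_wpM2r ?cabs_ge0 // ltW.
  - rewrite !cabsM -mulrA ltr_pM2l ?cabs_gt0 //.
    have /andP[_ b1] := bounds _ h'; have /andP[b2 _] := bounds _ h.
    apply: le_lt_trans b2; apply: le_trans gap.
    by rewrite ler_wpM2r ?cabs_ge0 // ltW.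
apply/near_dnbhsC.
case: (pselect (exists w1, [/\ cabs (w1 - z) < e, w1 != z & in_lattice (c * w1)])) => [[w1 [h1 n1 i1]]|no].
  exists (Num.min e (cabs (w1 - z))); first by rewrite lt_min e0 cabs_gt0 subr_eq0.
  move=> w; rewrite lt_min => /andP[hw hw1] wz; split; first exact: w0.
  apply: off_latticeP; first by rewrite mulf_neq0 // w0.
  by move=> i; move: hw1; rewrite (close w w1) // ltxx.
exists e => // w hw wz; split; first exact: w0.
apply: off_latticeP; first by rewrite mulf_neq0 // w0.
by move=> i; apply: no; exists w.
Qed.

Lemma theta_neq0 w : w != 0 -> off_lattice (- w) -> theta q w != 0.
Proof.
move=> w0 [h1 h2]; rewrite jacobi // !mulf_neq0 ?qpoch_oo_neq0 //; exact: qregular_q.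
Qed.
End Theta.

(** * Meromorphic functions and Taylor truncations *)

Section Mero.
Variable R : realType.
Local Notation C := (Cx R).
Implicit Types (f g : C -> C) (z w : C).

Definition mero_at z f := exists (n : nat) (g : C -> C),
    holomorphic_near g z /\ \forall w \near z^', f w = g w / (w - z) ^+ n.

Lemma holo_cst z (k : C) : holomorphic_near (fun=> k) z.
Proof. by apply: filterE => w; exact: derivable_cst. Qed.

Lemma holo_id z : holomorphic_near (fun w => w) z.
Proof. by apply: filterE => w; exact: derivable_id. Qed.

Lemma holo_add z f g : holomorphic_near f z -> holomorphic_near g z ->
  holomorphic_near (fun w => f w + g w) z.
Proof. by apply: filterS2 => w hf hg; exact: (derivableD hf hg). Qed.

Lemma holo_mul z f g : holomorphic_near f z -> holomorphic_near g z ->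
  holomorphic_near (fun w => f w * g w) z.
Proof. by apply: filterS2 => w hf hg; exact: (derivableM hf hg). Qed.

Lemma holo_exp z f n : holomorphic_near f z -> holomorphic_near (fun w => f w ^+ n) z.
Proof.
move=> hf; elim: n => [|n IH]; first by under eq_fun do rewrite expr0; exact: holo_cst.
by under eq_fun do rewrite exprS; exact: (holo_mul hf IH).
Qed.

Lemma holo_inv z f : (\forall w \near z, f w != 0) -> holomorphic_near f z ->
  holomorphic_near (fun w => (f w)^-1) z.
Proof. by apply: filterS2 => w h0 hf; exact: (derivableV h0 hf). Qed.

Lemma holo_subX z n : holomorphic_near (fun w => (w - z) ^+ n) z.
Proof. exact: (holo_exp n (holo_add (holo_id z) (holo_cst z (- z)))). Qed.

Lemma mero_at_holo z f : holomorphic_near f z -> mero_at z f.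
Proof. by move=> hf; exists 0%N, f; split=> //; apply: nearW => w; rewrite expr0 divr1. Qed.

Lemma mero_at_mul z f g : mero_at z f -> mero_at z g -> mero_at z (fun w => f w * g w).
Proof.
move=> [n [f' [hf ef]]] [m [g' [hg eg]]]; exists (n + m)%N, (fun w => f' w * g' w).
split; first exact: (holo_mul hf hg).
by apply: filterS2 ef eg => w -> ->; rewrite exprD invfM mulrACA.
Qed.

Lemma near_ne z : \forall w \near z^', w - z != 0.
Proof. by apply/near_dnbhsC; exists 1 => // w _; rewrite subr_eq0. Qed.

Lemma mero_at_add z f g : mero_at z f -> mero_at z g -> mero_at z (fun w => f w + g w).
Proof.
move=> [n [f' [hf ef]]] [m [g' [hg eg]]]; exists (n + m)%N.
exists (fun w => f' w * (w - z) ^+ m + g' w * (w - z) ^+ n); split.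
  exact: (holo_add (holo_mul hf (holo_subX z m)) (holo_mul hg (holo_subX z n))).
apply: filterS3 ef eg (near_ne z) => w -> -> wz.
by rewrite exprD; field; rewrite !expf_neq0.
Qed.

Lemma mero_at_cst z (k : C) : mero_at z (fun=> k).
Proof. by apply: mero_at_holo; exact: holo_cst. Qed.

Lemma mero_at_sum z (I : Type) (r : seq I) (F : I -> C -> C) :
  (forall i, mero_at z (F i)) -> mero_at z (fun w => \sum_(i <- r) F i w).
Proof.
move=> h; elim: r => [|i r IH].
  by under eq_fun do rewrite big_nil; exact: mero_at_cst.
by under eq_fun do rewrite big_cons; exact: (mero_at_add (h i) IH).
Qed.

Lemma mero_at_prod z (I : Type) (r : seq I) (F : I -> C -> C) :
  (forall i, mero_at z (F i)) -> mero_at z (fun w => \prod_(i <- r) F i w).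
Proof.
move=> h; elim: r => [|i r IH].
  by under eq_fun do rewrite big_nil; exact: mero_at_cst.
by under eq_fun do rewrite big_cons; exact: (mero_at_mul (h i) IH).
Qed.

Lemma expansion_holo c rho M al f (z : C) : expansion c rho M al f -> cabs (z - c) < rho ->
  holomorphic_near f z.
Proof.
move=> af hz; apply/nearC; exists (rho - cabs (z - c)); first by rewrite subr_gt0.
move=> w hw; have hr : cabs (w - c) < rho.
  have := cabsD (w - z) (z - c); rewrite addrA subrK; lra.
have L := expansion_derivable (le_lt_trans (cabs_ge0 _) hr) af hr.
by rewrite addrC subrK in L.
Qed.

Lemma holo_near_neq0 z f : holomorphic_near f z -> f z != 0 -> \forall w \near z, f w != 0.
Proof.
move=> /nearC[e e0 /(_ z)]; rewrite subrr cabs0 => /(_ e0) df f0.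
have cf : {for z, continuous f}.
  by apply: differentiable_continuous; exact/derivable1_diffP.
have L : cabs (f w) @[w --> z] --> cabs (f z) by apply: (@cvg_cabs R C (nbhs z) _ f (f z)); exact: cf.
move/cvgrPdist_lt: L => /(_ (cabs (f z))); rewrite cabs_gt0 f0 => /(_ isT).
apply: filterS => w hw; apply/negP => /eqP fw.
by move: hw; rewrite fw cabs0 subr0 ger0_norm ?cabs_ge0 // ltxx.
Qed.

(** A function that is not identically zero near c is a power of w - c times a
nonvanishing function; the exponent is the index of the first nonzero
coefficient. *)
Lemma expansion_factor c rho M al f : 0 < rho -> expansion c rho M al f ->
  (exists2 w, cabs (w - c) < rho & f w != 0) ->
  exists n g, [/\ holomorphic_near g c, \forall w \near c, g w != 0 &
    \forall w \near c, f w = (w - c) ^+ n * g w].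
Proof.
move=> r0 [a1 a2] [w hw fw].
have [n0 hn0] : exists n, al n != 0.
  apply: contrapT => no; move: fw; rewrite -(subrK c w) addrC a2 // => /negP; apply; apply/eqP.
  rewrite (@csum_fin _ _ 0) ?big_ord0 // => n _.
  by have [->|an] := eqVneq (al n) 0; [rewrite mul0r | case: no; exists n].
have exn : exists n, al n != 0 by exists n0.
pose n := ex_minn exn.
have [an nmin] : al n != 0 /\ forall m, (m < n)%N -> al m = 0.
  rewrite /n; case: ex_minnP => m hm hmin; split=> // k km.
  by apply/eqP; apply: contraTT km => /hmin; rewrite -leqNgt.
pose be m := al (m + n)%N.
pose g w := csum (fun m => be m * (w - c) ^+ m).
have b1 : l1_le rho (M / rho ^+ n) be.
  move=> N; rewrite ler_pdivlMr ?exprn_gt0 // mulr_suml.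
  apply: le_trans (a1 (N + n)%N).
  rewrite [leRHS](big_cat_nat _ (n := n)) ?leq_addl //=.
  rewrite (big_addn 0 (N + n)%N n) addnK.
  under eq_bigr do rewrite -mulrA -exprD.
  by rewrite lerDr sumr_ge0 // => i _; rewrite mulr_ge0 ?cabs_ge0 ?exprn_ge0 // ltW.
have ag : expansion c rho (M / rho ^+ n) be g.
  split; first exact: b1.
  by move=> h hr; rewrite /g (_ : c + h - c = h) //; ring.
have hg : holomorphic_near g c by apply: expansion_holo ag _; rewrite subrr cabs0.
exists n, g; split=> //.
  by apply: holo_near_neq0 => //; rewrite (expansion_center r0 ag) /be add0n.
apply/nearC; exists rho => // v hv.
rewrite -{1}(subrK c v) addrC a2 // (csum_split n (l1_le_geo_summable a1 hv)).
rewrite big1 ?add0r; last by move=> i _; rewrite nmin ?mul0r.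
rewrite /g -csumZ; last exact: l1_le_geo_summable b1 hv.
by congr csum; apply/funext => m; rewrite /be exprD; ring.
Qed.

Lemma in_qpoly_coef (p : {poly C}) k : (k < 4)%N ->
  (in_qpoly 'X^4 p : {poly C})`_k = p`_k.
Proof.
move=> k4; rewrite /= mk_monic_Xn.
rewrite [in RHS](Pdiv.RingMonic.rdivp_eq (monicXn C 4) p) coefD coefMXn k4 add0r //.
Qed.

(** Products in C[X]/(X^4) are truncated Cauchy products. *)
Lemma coef_Ppow_taylorP (l : C) (F : C -> C) k : (k < 4)%N ->
  ((Ppow l * taylorP F : KP3 R) : {poly C})`_k =
  \sum_(i < k.+1) ((-1) ^+ i * cbinom l i) *
     ((-1) ^+ (k - i) * derive1n (k - i) F 1 / (k - i)`!%:R).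
Proof.
move=> k4; rewrite /Ppow /taylorP -in_qpolyM in_qpoly_coef // coefM.
apply: eq_bigr => i _; rewrite !coef_poly.
have ik : (i <= k)%N by rewrite -ltnS.
by rewrite (leq_ltn_trans ik k4) (leq_ltn_trans (leq_subr i k) k4).
Qed.

Variable q : C.
Hypotheses (q0 : q != 0) (q1 : cabs q < 1).

Lemma near_theta_neq0 (c z : C) : c != 0 -> z != 0 -> \forall w \near z^', theta q (c * w) != 0.
Proof.
move=> c0 z0; have nc : - c != 0 by rewrite oppr_eq0.
apply: filterS (near_off_lattice q0 q1 nc z0) => w [w0 hw].
by apply: theta_neq0 => //; rewrite ?mulf_neq0 // -mulNr.
Qed.

(** Writing theta = (w - z)^n g with g nonvanishing bounds the pole order of
the logarithmic derivative by n. The expansion of theta is not zero because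
theta has zeros only on a discrete set. *)
Lemma mero_ell z : z != 0 -> mero_at z (ell q).
Proof.
move=> z0; have [M [al ath]] := theta_expansion q0 q1 z0.
have cz : 0 < cabs z / 2 by rewrite divr_gt0 // cabs_gt0.
have ex : exists2 w, cabs (w - z) < cabs z / 2 & theta q w != 0.
  have /near_dnbhsC[e e0 h] := near_theta_neq0 (oner_neq0 C) z0.
  pose d := Num.min e (cabs z / 2) / 2.
  have m0 : 0 < Num.min e (cabs z / 2) by rewrite lt_min e0.
  have d0 : 0 < d by rewrite divr_gt0.
  have dlt : d < Num.min e (cabs z / 2) by rewrite /d; lra.
  pose w : C := z + real_complex R d.
  have cw : cabs (w - z) = d by rewrite /w addrC addKr cabs_real ger0_norm // ltW.
  move: dlt; rewrite lt_min => /andP[d1 d2].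
  exists w; first by rewrite cw.
  rewrite -[w]mul1r; apply: h; first by rewrite cw.
  by rewrite -subr_eq0 -cabs_gt0 cw.
have [n [g [hg g0 eg]]] := expansion_factor cz ath ex.
exists n, (fun w => - w * derive1 (theta q) w * (g w)^-1); split.
  have rr : 0 < cabs z / 2 / 2 < cabs z / 2 by apply/andP; split; lra.
  have hd : holomorphic_near (derive1 (theta q)) z.
    by apply: expansion_holo (expansion_derive1 rr ath) _; rewrite subrr cabs0; lra.
  have hn : holomorphic_near (fun w : C => - w) z.
    have := holo_mul (holo_cst z (-1)) (holo_id z).
    by under eq_fun do rewrite mulN1r.
  exact: (holo_mul (holo_mul hn hd) (holo_inv g0 hg)).
have /nearC[e e0 he] := eg.
apply/near_dnbhsC; exists e => // w hw _.
by rewrite /ell he // invfM mulrA mulrAC.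
Qed.

End Mero.

(** * Expansions at P = 1 of q-products *)

Section ExpandsAtOne.
Variable R : realType.
Local Notation C := (Cx R).
Variables (q : C) (rho : R).
Hypotheses (q1 : cabs q < 1) (r0 : 0 < rho) (r1 : rho < 1).
Implicit Types (f g : C -> C).

(** The coefficients are forgotten: only the norm matters for uniform bounds
on q-products. *)
Definition expands (M : R) f := exists al, expansion 1 rho M al f.

Lemma rho1 : 0 <= 1 + rho.
Proof. by rewrite addr_ge0 // ltW. Qed.

Lemma expansion_congr c M al f g : (forall h, cabs h < rho -> f (c + h) = g (c + h)) ->
  expansion c rho M al f -> expansion c rho M al g.
Proof. by move=> e [h1 h2]; split=> // h hr; rewrite -e // h2. Qed.

(** Multiplying by (z - c)^n shifts the coefficients by n. *)
Lemma expansion_vanish c M al f n : expansion c rho M al f ->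
  exists M' be, expansion c rho M' be (fun z => (z - c) ^+ n * f z) /\
    forall k, (k < n)%N -> be k = 0.
Proof.
move=> af; elim: n => [|n [M' [be [ab b0]]]].
  exists M, al; split=> //; apply: expansion_congr af => h _; by rewrite expr0 mul1r.
have aX := expansion_add r0 (expansion_id c (ltW r0)) (expansion_cst c rho (- c)).
have aM := expansion_mul r0 aX ab.
do 2 eexists; split.
  by apply: expansion_congr aM => h _; rewrite exprS mulrA.
case=> [|k] kn; rewrite /=.
  by rewrite big_ord1 /= subrr mul0r.
rewrite big_ord_recl /= subrr mul0r add0r big_ord_recl /= /bump /= addr0 subSS subn0.
by rewrite b0 // mulr0 add0r big1 // => i _; rewrite /bump /= !add1n /= addr0 mul0r.
Qed.

Lemma expands_le M M' f : M <= M' -> expands M f -> expands M' f.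
Proof.
by move=> h [al af]; exists al; apply: expansion_le af => //; rewrite lexx ltW.
Qed.

Lemma expands_ge0 M f : expands M f -> 0 <= M.
Proof. by move=> [al [/l1_le_ge0]]. Qed.

Lemma expands_congr M f g : (forall h, cabs h < rho -> f (1 + h) = g (1 + h)) -> expands M f -> expands M g.
Proof. by move=> e [al af]; exists al; exact: expansion_congr af. Qed.

Lemma expands_mul M M' f g : expands M f -> expands M' g -> expands (M * M') (fun z => f z * g z).
Proof. by move=> [al af] [be ag]; eexists; exact: (expansion_mul r0 af ag). Qed.

Lemma expands_cst (k : C) : expands (cabs k) (fun=> k).
Proof. by eexists; exact: expansion_cst. Qed.

Lemma expands_id : expands (1 + rho) (fun z => z).
Proof. by eexists; rewrite -{1}(cabs1 R); exact: (expansion_id 1 (ltW r0)). Qed.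

Lemma expands_1D M f (k : C) : expands M f -> expands (1 + cabs k * M) (fun z => 1 + k * f z).
Proof.
move=> [al af]; eexists; rewrite -{1}(cabs1 R).
exact: (expansion_add r0 (expansion_cst 1 rho 1) (expansion_scale k r0 af)).
Qed.

Lemma expands_inv (u : C) : rho < cabs u -> expands (cabs u - rho)^-1 (fun z => (u + (z - 1))^-1).
Proof. by move=> ru; eexists; exact: (expansion_inv 1 r0 ru). Qed.

Lemma expands_prod (I : Type) (s : seq I) (M : I -> R) (f : I -> C -> C) :
  (forall i, expands (M i) (f i)) -> expands (\prod_(i <- s) M i) (fun z => \prod_(i <- s) f i z).
Proof.
move=> h; elim: s => [|i s IH].
  rewrite big_nil -(cabs1 R) (_ : (fun z => _) = (fun=> 1)); first exact: expands_cst.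
  by apply/funext => z; rewrite big_nil.
rewrite big_cons (_ : (fun z => _) = (fun z => f i z * \prod_(j <- s) f j z)).
  exact: (expands_mul (h i) IH).
by apply/funext => z; rewrite big_cons.
Qed.

(** Bounds the norm of a q-product uniformly in its length, because the norm
is submultiplicative. *)
Lemma expands_prod_expR (K s : R) (f : nat -> C -> C) d : 0 <= s < 1 -> 0 <= K ->
  (forall k, expands (1 + K * s ^+ k) (f k)) ->
  expands (expR (K / (1 - s))) (fun z => \prod_(0 <= k < d) f k z).
Proof.
move=> s01 K0 h; apply: expands_le (expands_prod (index_iota 0 d) h).
apply: prod_le_expR => // k; rewrite lexx andbT addr_ge0 ?mulr_ge0 ?exprn_ge0 //.
by case/andP: s01.
Qed.

Lemma expands_qpoch (a : C) d :
  expands (expR (cabs a * (1 + rho) / (1 - cabs q))) (fun z => qpoch (z * a) q d).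
Proof.
apply: expands_prod_expR; first exact: cabs_q01.
  by rewrite mulr_ge0 ?cabs_ge0 // rho1.
move=> k; apply: expands_le (expands_congr _ (expands_1D (- (a * q ^+ k)) expands_id)).
  by rewrite cabsN cabsM cabsX mulrAC.
by move=> h _; ring.
Qed.

(** Each factor has an expansion of norm close to 1, as 1/(1 - P b) = 1 + b
P/(1 - P b) and b decays geometrically. *)
Lemma expands_qpochV (a : C) (delta : R) d : a != 0 -> q != 0 -> 0 < delta ->
  cabs a * (1 + rho) <= 1 - delta ->
  expands (expR (cabs a * (1 + rho) / delta / (1 - cabs q))) (fun z => (qpoch (z * a) q d)^-1).
Proof.
move=> a0 q0 d0 had.
apply: (expands_congr (f := fun z => \prod_(0 <= k < d) (1 - z * a * q ^+ k)^-1)).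
  by move=> h _; rewrite prodfV.
apply: expands_prod_expR; first exact: cabs_q01.
  by rewrite divr_ge0 ?mulr_ge0 ?cabs_ge0 ?rho1 ?(ltW d0).
move=> k; set b := a * q ^+ k.
have b0 : b != 0 by rewrite mulf_neq0 ?expf_neq0.
have cb : cabs b = cabs a * cabs q ^+ k by rewrite /b cabsM cabsX.
have cba : cabs b <= cabs a.
  by rewrite cb ler_piMr ?cabs_ge0 // exprn_ile1 ?cabs_ge0 // ltW.
have hb : cabs b * (1 + rho) <= 1 - delta.
  by apply: le_trans had; rewrite ler_wpM2r // rho1.
have cb0 : 0 < cabs b by rewrite cabs_gt0.
have h1b : 1 - cabs b <= cabs (1 - b) by have := cabs_dist 1 b; rewrite cabs1.
pose u := - (1 - b) / b.
have cu : cabs u = cabs (1 - b) / cabs b by rewrite /u cabsM cabsN cabsV.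
have ru : rho < cabs u by rewrite cu ltr_pdivlMr //; lra.
have Ainv : expands (delta^-1 * cabs b) (fun z => (u + (z - 1))^-1).
  apply: expands_le (expands_inv ru).
  rewrite -lef_pV2 ?posrE ?invr_gt0 ?subr_gt0 ?mulr_gt0 ?invr_gt0 //.
  rewrite invrK invfM invrK cu ler_pdivrMr // mulrBl divfK ?gt_eqF //; lra.
have A2 := expands_mul (expands_cst (- b^-1)) (expands_mul expands_id Ainv).
apply: expands_le (expands_congr _ (expands_1D b A2)).
  rewrite cabsN cabsV lerD2l le_eqVlt; apply/orP; left; apply/eqP.
  have bn0 : cabs b != 0 by rewrite gt_eqF.
  have dn0 : delta != 0 by rewrite gt_eqF.
  transitivity (cabs b * (1 + rho) / delta); first by field; rewrite bn0 dn0.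
  by rewrite cb; field.
move=> h hr; rewrite -mulrA -/b.
have n0 : 1 - (1 + h) * b != 0.
  rewrite -cabs_gt0; have := cabs_dist 1 ((1 + h) * b); rewrite cabs1 cabsM.
  have : cabs (1 + h) * cabs b <= (1 + rho) * cabs b.
    by rewrite ler_wpM2r ?cabs_ge0 // (le_trans (cabsD _ _)) // cabs1 lerD2l ltW.
  lra.
have e : u + (1 + h - 1) = - (1 - (1 + h) * b) / b by rewrite /u; field.
by rewrite e; field; rewrite n0 b0.
Qed.

Lemma expands_V : expands (1 - rho)^-1 (fun z => z^-1).
Proof.
have ru : rho < cabs (1 : C) by rewrite cabs1.
apply: expands_le (expands_congr _ (expands_inv ru)); first by rewrite cabs1.
by move=> h _; congr (_^-1); ring.
Qed.

Lemma expands_qpoch_inv (b : C) d :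
  expands (expR (cabs b / (1 - rho) / (1 - cabs q))) (fun z => qpoch (b / z) q d).
Proof.
apply: expands_prod_expR; first exact: cabs_q01.
  by rewrite divr_ge0 ?cabs_ge0 // subr_ge0 ltW.
move=> k; apply: expands_le (expands_congr _ (expands_1D (- (b * q ^+ k)) expands_V)).
  by rewrite cabsN cabsM cabsX mulrAC.
by move=> h _; ring.
Qed.

(** The analogue with 1/P in place of P: 1/(1 - e/P) = 1 + e/(P - e). *)
Lemma expands_qpochV_inv (b : C) (delta : R) d : 0 < delta ->
  cabs b + rho <= 1 - delta ->
  expands (expR (cabs b / delta / (1 - cabs q))) (fun z => (qpoch (b / z) q d)^-1).
Proof.
move=> d0 hbd.
apply: (expands_congr (f := fun z => \prod_(0 <= k < d) (1 - b / z * q ^+ k)^-1)).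
  by move=> h _; rewrite prodfV.
apply: expands_prod_expR; first exact: cabs_q01.
  by rewrite divr_ge0 ?cabs_ge0 ?ltW.
move=> k; set e := b * q ^+ k.
have ce : cabs e = cabs b * cabs q ^+ k by rewrite /e cabsM cabsX.
have ceb : cabs e <= cabs b.
  by rewrite ce ler_piMr ?cabs_ge0 // exprn_ile1 ?cabs_ge0 // ltW.
have h1e : 1 - cabs e <= cabs (1 - e) by have := cabs_dist 1 e; rewrite cabs1.
have ru : rho < cabs (1 - e) by lra.
have Ainv : expands delta^-1 (fun z => (1 - e + (z - 1))^-1).
  apply: expands_le (expands_inv ru).
  rewrite lef_pV2 ?posrE ?subr_gt0 //; lra.
apply: expands_le (expands_congr _ (expands_1D e Ainv)); first by rewrite ce mulrAC.
move=> h hr.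
have n1 : 1 + h != 0.
  rewrite -cabs_gt0; have := cabs_dist 1 (- h); rewrite cabs1 cabsN opprK.
  by apply: lt_le_trans; rewrite subr_gt0 (lt_trans hr).
have n2 : 1 + h - e != 0.
  rewrite -cabs_gt0; have := cabs_dist (1 - e) (- h); rewrite cabsN opprK.
  have -> : 1 - e + h = 1 + h - e by ring.
  lra.
have -> : b / (1 + h) * q ^+ k = e / (1 + h) by rewrite /e mulrAC.
have -> : 1 - e + (1 + h - 1) = 1 + h - e by ring.
by field; rewrite n1 n2.
Qed.

End ExpandsAtOne.

(** * The connection formula for P close to 1 *)

Section NearOne.
Variable R : realType.
Local Notation C := (Cx R).
Variables (q r : C).
Hypotheses (hr : r ^+ 5 = q) (q0 : q != 0) (q1 : cabs q < 1).

Lemma r_neq0 : r != 0.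
Proof. by apply: contraNneq q0 => e; rewrite -hr e expr0n. Qed.

Lemma r_lt1 : cabs r < 1.
Proof.
rewrite ltNge; apply/negP => h; move: q1; rewrite -hr cabsX ltNge => /negP; apply.
exact: exprn_ege1.
Qed.

(** For this radius, (1 + radius)|r| < 1 and |r| < 1 - radius, so that P r^m =
1 for no P in the disc around 1 and no integer m <> 0. *)
Definition radius : R := (1 - cabs r) / 4.

Lemma radius_gt0 : 0 < radius.
Proof. by rewrite divr_gt0 // subr_gt0 r_lt1. Qed.

Lemma radius_lt1 : radius < 1.
Proof. by have := cabs_ge0 r; rewrite /radius; lra. Qed.

Lemma rX_le n : cabs (r ^+ n.+1) <= cabs r.
Proof. by rewrite cabsX exprS ler_piMr ?cabs_ge0 // exprn_ile1 ?cabs_ge0 // ltW // r_lt1. Qed.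

Lemma qregular_lt1 (a : C) : cabs a < 1 -> qregular q a.
Proof.
move=> a1 k; rewrite subr_eq0 eq_sym; apply/eqP => e.
have : cabs (a * q ^+ k) < 1.
  rewrite cabsM cabsX; apply: le_lt_trans a1; rewrite ler_piMr ?cabs_ge0 //.
  by rewrite exprn_ile1 ?cabs_ge0 // ltW.
by rewrite e cabs1 ltxx.
Qed.

Lemma prod15 (T : comNzRingType) (F : nat -> T) :
  \prod_(1 <= i < 5) F i = \prod_(i < 4) F i.+1.
Proof. by rewrite big_add1 /= big_mkord. Qed.

Definition lhs_summand d (P : C) : C :=
  \prod_(i < 4) (qpoch (P * r ^+ i.+1) q d * (qpoch (P * q) q d)^-1).

(** The term of index -t-1 of the bilateral series, after the factor (1 -
1/P)^4 and the power of q^2/Q have been taken out. *)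
Definition tail_summand t (P : C) : C :=
  \prod_(i < 4) (qpoch (q / P) q t * (qpoch (r ^+ (4 - i) / P) q t.+1)^-1).

Lemma delta_gt0 : 0 < (1 - cabs r) / 2.
Proof. by rewrite divr_gt0 // subr_gt0 r_lt1. Qed.

Lemma cabs_q_le : cabs q <= cabs r.
Proof. by rewrite -hr rX_le. Qed.

Lemma expands_lhs_summand : exists2 B, 0 <= B & forall d, expands radius B (lhs_summand d).
Proof.
have r0 := radius_gt0.
pose D := expR (cabs q * (1 + radius) / ((1 - cabs r) / 2) / (1 - cabs q)).
pose N (i : 'I_4) := expR (cabs (r ^+ i.+1) * (1 + radius) / (1 - cabs q)) * D.
have h d : expands radius (\prod_(i < 4) N i) (lhs_summand d).
  apply: expands_prod => // i; apply: expands_mul => //; first exact: expands_qpoch.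
  apply: expands_qpochV => //; first exact: delta_gt0.
  have := cabs_q_le; have := cabs_ge0 q; have := r_lt1; rewrite /radius => t1 q0' qt.
  apply: le_trans (_ : cabs r * (1 + (1 - cabs r) / 4) <= _).
    by rewrite ler_wpM2r //; lra.
  have := cabs_ge0 r; nra.
by exists (\prod_(i < 4) N i) => //; exact: (expands_ge0 (h 0%N)).
Qed.

Lemma expands_tail_summand : exists2 B, 0 <= B & forall t, expands radius B (tail_summand t).
Proof.
have r0 := radius_gt0; have r1 := radius_lt1.
pose D (i : 'I_4) := expR (cabs (r ^+ (4 - i)) / ((1 - cabs r) / 2) / (1 - cabs q)).
pose N := expR (cabs q / (1 - radius) / (1 - cabs q)).
have h d : expands radius (\prod_(i < 4) (N * D i)) (tail_summand d).
  apply: expands_prod => // i; apply: expands_mul => //; first exact: expands_qpoch_inv.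
  apply: expands_qpochV_inv => //; first exact: delta_gt0.
  have i4 : (4 - i = (3 - i).+1)%N by have := ltn_ord i; lia.
  have := rX_le (3 - i); rewrite -i4 => h; have := r_lt1; rewrite /radius; lra.
by exists (\prod_(i < 4) (N * D i)) => //; exact: (expands_ge0 (h 0%N)).
Qed.

(** The negative half of the bilateral series, divided by (P - 1)^4. *)
Definition tail (Q P : C) : C :=
  q ^+ 2 / Q * (P^-1 ^+ 4 * csum (fun t => tail_summand t P * (q ^+ 2 / Q) ^+ t)).

Definition lhs_series (Q P : C) : C := csum (fun d => lhs_summand d P * Q ^+ d).

Lemma expands_csum (rho M s : R) (f : nat -> C -> C) : 0 < rho -> 0 <= s < 1 ->
  (forall d, expands rho (M * s ^+ d) (f d)) ->
  expands rho (M / (1 - s)) (fun z => csum (fun d => f d z)).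
Proof.
move=> r0 s01 /choice[al h]; exists (fun n => csum (fun d => al d n)).
exact: expansion_csum.
Qed.

Lemma expands_tail Q : cabs (q ^+ 2 / Q) < 1 -> exists M, expands radius M (tail Q).
Proof.
move=> w1; have r0 := radius_gt0; have r1 := radius_lt1.
have [B B0 hB] := expands_tail_summand; set w := q ^+ 2 / Q.
have w01 : 0 <= cabs w < 1 by rewrite cabs_ge0.
have hs d : expands radius (B * cabs w ^+ d) (fun P => tail_summand d P * w ^+ d).
  by rewrite -cabsX; apply: expands_mul => //; exact: expands_cst.
have A1 := expands_csum r0 w01 hs.
have AV := expands_V r0 r1.
have A2 := expands_mul r0 AV (expands_mul r0 AV (expands_mul r0 AV AV)).
eexists; apply: expands_congr (expands_mul r0 (expands_cst radius w) (expands_mul r0 A2 A1)) => h _.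
by rewrite /tail -/w; congr (_ * (_ * _)); rewrite !exprS expr0 mulr1.
Qed.

Lemma near1_bounds P : cabs (P - 1) < radius -> cabs r < cabs P /\ cabs P * cabs r < 1.
Proof.
move=> hP; have := cabsD (P - 1) 1; rewrite subrK cabs1.
have := cabs_dist 1 (1 - P); rewrite opprB addrCA subrr addr0 cabs1 (cabsC 1 P).
have := cabs_ge0 r; have := r_lt1; have := cabs_ge0 P.
move: hP; rewrite /radius; move: (cabs (P - 1)) (cabs r) (cabs P) => x t p h p0 t1 t0 h1 h2.
by split; [lra | nra].
Qed.

Lemma reg_pos P i : cabs (P - 1) < radius -> qregular q (P * r ^+ i.+1).
Proof.
move=> /near1_bounds[_ h]; apply: qregular_lt1; apply: le_lt_trans h.
by rewrite cabsM ler_wpM2l ?cabs_ge0 // rX_le.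
Qed.

Lemma near1_neq0 P : cabs (P - 1) < radius -> P != 0.
Proof. by move=> /near1_bounds[h _]; rewrite -cabs_gt0; apply: le_lt_trans h; exact: cabs_ge0. Qed.

Lemma reg_neg P i : cabs (P - 1) < radius -> qregular q (r ^+ i.+1 / P).
Proof.
move=> hP; have [h _] := near1_bounds hP; apply: qregular_lt1.
rewrite cabsM cabsV ltr_pdivrMr ?mul1r; first exact: le_lt_trans (rX_le i) h.
by rewrite cabs_gt0 near1_neq0.
Qed.

Lemma reg_ratio i j : (0 < i < 5)%N -> (0 < j < 5)%N -> i != j -> qregular q (r ^+ i / r ^+ j).
Proof.
move=> hi hj ij k; rewrite subr_eq0 eq_sym; apply/eqP => e.
have : r ^+ (i + 5 * k) = r ^+ j.
  rewrite exprD exprM hr; apply: (mulIf (invr_neq0 (qX_neq0 r_neq0 j))).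
  by rewrite mulrAC e divff // qX_neq0 // r_neq0.
by move=> /(qX_inj r_neq0 r_lt1); move: ij => /eqP; lia.
Qed.

(** The basic hypergeometric series in W_j in the uniform shape produced by
the connection formula. *)
Definition phi_series j (y : C) : C :=
  csum (fun m => qpoch (r ^+ j) q m ^+ 4 /
    (qpoch q q m * \prod_(i < 4 | i.+1 != j) qpoch (r ^+ (5 + j - i.+1)) q m) * y ^+ m).

(** The elliptic factors e_{q,lambda} cancel wherever they are finite and
nonzero. *)
Lemma Wfun_phi_series j y : (0 < j < 5)%N -> eqlam q (r ^+ j) y != 0 ->
  (eqlam q (r ^+ j) y)^-1 * Wfun q r j y = phi_series j (q ^+ 2 * y).
Proof.
case: j => [|[|[|[|[|//]]]]] // _ h; rewrite /Wfun mulKf // /phi43 /phi_series;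
  congr csum; apply/funext => m; congr (_ / _ * _);
  rewrite /qpochs !big_cons !big_nil ?mulr1; try by [].
all: by rewrite big_mkcond !big_ord_recl big_ord0 /= /bump /= ?mulr1 ?mul1r ?addn0 ?add1n; ring.
Qed.

(** Turns a uniform bound on norms into a dominator for the values at a fixed
P. *)
Lemma expands_bound (rho M : R) (f : C -> C) h : 0 < rho -> expands rho M f -> cabs h < rho -> cabs (f (1 + h)) <= M.
Proof.
move=> r0 [al [a1 a2]] hh; rewrite a2 //.
apply: (cvgn_cabs_le (geo_summable_cvg (l1_le_geo_summable a1 hh))); apply: nearW => N.
apply: le_trans (cabs_sum _ _ _) _; apply: le_trans (a1 N); apply: ler_sum => n _.
by rewrite cabsM cabsX ler_wpM2l ?cabs_ge0 //; apply: lerXn2r; rewrite ?nnegrE ?cabs_ge0 // ltW.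
Qed.

Lemma geo_summable_tail_summand P w : cabs (P - 1) < radius -> cabs w < 1 -> geo_summable (fun t => tail_summand t P * w ^+ t).
Proof.
move=> hP w1; have [B B0 hB] := expands_tail_summand; exists B, (cabs w); split; first by rewrite cabs_ge0.
move=> t; rewrite cabsM cabsX ler_wpM2r ?exprn_ge0 ?cabs_ge0 //.
by have := expands_bound radius_gt0 (hB t) hP; rewrite addrC subrK.
Qed.

(** The connection formula with a_i = P r^i and b_i = P q. The negative half
of the bilateral series contains the factors 1 - q/b_i = 1 - 1/P four times,
hence it is divisible by (P - 1)^4. *)
Theorem connection_near_1 (P Q : C) : cabs (P - 1) < radius -> Q != 0 -> cabs q ^+ 2 < cabs Q -> cabs Q < 1 ->
  off_lattice q Q -> (forall j, (0 < j < 5)%N -> eqlam q (r ^+ j) (1 / Q) != 0) ->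
  (\prod_(1 <= i < 5) qpoch_oo (P * r ^+ i) q) / qpoch_oo (P * q) q ^+ 4
         * \sum_(1 <= j < 5)
             (qpochs_oo [:: q; q; P * r ^+ j * Q; q / (P * r ^+ j * Q)] q
              / qpochs_oo [:: P * r ^+ j; q / (P * r ^+ j); Q; q / Q] q
              * (qpoch_oo (r ^- j * q) q ^+ 4 * (eqlam q (r ^+ j) (1 / Q))^-1
                 / ((\prod_(1 <= i < 5 | i != j)
                       qpoch_oo (r ^ (i%:Z - j%:Z)) q) * qpoch_oo q q))
              * Wfun q r j (1 / Q)) =
  lhs_series Q P + (P - 1) ^+ 4 * tail Q P.
Proof.
move=> hP Q0 Qlo Q1 [Qr Qr'] hW.
have P0 := near1_neq0 hP; have rn0 := r_neq0.
have cQ : 0 < cabs Q by rewrite cabs_gt0.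
pose a (i : 'I_4) : C := P * r ^+ i.+1; pose b (i : 'I_4) : C := P * q.
have a0 i : a i != 0 by rewrite mulf_neq0 ?expf_neq0.
have b0 i : b i != 0 by rewrite mulf_neq0.
have areg i : qregular q (a i) by exact: reg_pos.
have qaE (i : 'I_4) : q / a i = r ^+ (4 - i) / P.
  have e : q = r ^+ (4 - i) * r ^+ i.+1.
    by by rewrite -exprD -hr; congr (_ ^+ _); by rewrite addnS subnK // ltnW.
  by rewrite {1}e /a; field; rewrite P0 expf_neq0.
have areg' i : qregular q (q / a i).
  rewrite qaE (_ : (4 - i = (3 - i).+1)%N); last by rewrite -subSn // -ltnS.
  exact: reg_neg.
have aaE i j : a i / a j = r ^+ i.+1 / r ^+ j.+1.
  by rewrite /a; field; rewrite P0 expf_neq0.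
have aareg i j : i != j -> qregular q (a i / a j).
  move=> ij; rewrite aaE; apply: reg_ratio => //; rewrite /= ltnS; exact: ltn_ord.
have breg i : qregular q (b i) by have := reg_pos 4 hP; rewrite hr.
have zE : param_ratio a b = q ^+ 2.
  rewrite /param_ratio /a /b !big_ord_recl !big_ord0 /= /bump /= -hr.
  by field; rewrite P0 rn0.
have zQ : cabs (param_ratio a b / Q) < 1.
  by rewrite zE cabsM cabsV cabsX ltr_pdivrMr // mul1r.
have [_ B] := bilateral q0 q1 (isT : (0 < 4)%N) Q0 a0 b0 areg areg' aareg Q1 zQ Qr Qr' breg.
have -> : \prod_(1 <= i < 5) qpoch_oo (P * r ^+ i) q / qpoch_oo (P * q) q ^+ 4 =
    \prod_i (qpoch_oo (a i) q / qpoch_oo (b i) q).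
  by rewrite prod15 /a /b prodf_div prodr_const card_ord.
rewrite big_add1 -[5.-1]/4%N big_mkord.
rewrite [X in _ * X](eq_bigr (fun j : 'I_4 => qpochs_oo [:: q; q; a j * Q; q / (a j * Q)] q
           / qpochs_oo [:: a j; q / a j; Q; q / Q] q
    * (\prod_i qpoch_oo (b i / a j) q
       / (\prod_(i | i != j) qpoch_oo (a i / a j) q * qpoch_oo q q))
    * csum (fun m => \prod_i qpoch (q * a j / b i) q m
       / (qpoch q q m * \prod_(i | i != j) qpoch (q * a j / a i) q m) * (param_ratio a b / Q) ^+ m))).
  rewrite -B; congr (_ + _).
  (* As q / b i = 1/P, the first factor of each (q/b;q)_(t+1) is 1 - 1/P. *)
  have E t : \prod_i (qpoch (q / b i) q t.+1 / qpoch (q / a i) q t.+1) =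
      ((P - 1) ^+ 4 * P^-1 ^+ 4) * tail_summand t P.
    have -> : (P - 1) ^+ 4 * P^-1 ^+ 4 = \prod_(i < 4) (1 - P^-1).
      by rewrite prodr_const card_ord -exprMn mulrBl mul1r divff.
    rewrite -big_split /=; apply: eq_bigr => i _; rewrite mulrA qaE; congr (_ / _).
    have -> : q / b i = P^-1 by rewrite /b; field; rewrite q0 P0.
    by rewrite qpochSl mulrC [P^-1 * q]mulrC mulrC.
  have wQ : cabs (q ^+ 2 / Q) < 1 by rewrite -zE.
  rewrite zE (_ : (fun t => _) = (fun t => ((P - 1) ^+ 4 * P^-1 ^+ 4) * (tail_summand t P * (q ^+ 2 / Q) ^+ t))).
    by rewrite csumZ; [rewrite /tail; ring | exact: geo_summable_tail_summand].
  by apply/funext => t; rewrite E mulrA.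
move=> j _.
have j5 : (0 < j.+1 < 5)%N by rewrite /= ltnS; exact: ltn_ord.
have WE := Wfun_phi_series j5 (hW _ j5).
have -> : forall x y z w v : C, x * (y * z / w) * v = x * (y / w) * (z * v).
  by move=> x y z w v; rewrite -!mulrA; congr (_ * (_ * _)); rewrite mulrCA mulrA.
rewrite WE; congr (_ * (_ / (_ * _)) * _).
- have baE i : b i / a j = r ^- j.+1 * q.
    by rewrite /b /a; field; rewrite P0 expf_neq0.
  by under [RHS]eq_bigr do rewrite baE; rewrite prodr_const card_ord.
- rewrite big_add1 -[5.-1]/4%N big_mkord; apply: eq_big => i; first by rewrite eqSS.
  by move=> _; rewrite aaE expfzDr // -exprnN -exprnP.
rewrite /phi_series; congr csum; apply/funext => m; congr (_ / (_ * _) * _).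
- have baE i : q * a j / b i = r ^+ j.+1.
    by rewrite /b /a; field; rewrite P0 q0.
  by under [RHS]eq_bigr do rewrite baE; rewrite prodr_const card_ord.
- apply: eq_big => i; first by rewrite eqSS.
  move=> _; congr (qpoch _ _ _).
  have e : r ^+ (5 + j.+1) = r ^+ (5 + j.+1 - i.+1) * r ^+ i.+1.
    by rewrite -exprD subnK // (leq_trans (ltn_ord i)) // ltnW // leq_addr.
  have -> : q * a j / a i = r ^+ (5 + j.+1) / r ^+ i.+1.
    by rewrite /a exprD hr; field; rewrite P0 expf_neq0.
  by rewrite e mulfK // expf_neq0.
by rewrite zE mulrA mulr1.
Qed.

End NearOne.

(** * Taylor coefficients at P = 1 *)

Section TaylorAtOne.
Variable R : realType.
Local Notation C := (Cx R).
Variables (q r : C).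
Hypotheses (hr : r ^+ 5 = q) (q0 : q != 0) (q1 : cabs q < 1).

Lemma mero_at_eq (z : C) (f g : C -> C) : mero_at z f ->
  (\forall w \near z^', f w = g w) -> mero_at z g.
Proof.
move=> [n [h [hh e]]] fg; exists n, h; split=> //.
by apply: filterS2 e fg => w -> ->.
Qed.

(** The Taylor coefficients at P = 1 are power series in Q, with coefficients
bounded independently of d. *)
Lemma lhs_series_expansion : exists al B, (forall n d, cabs (al d n) <= B n) /\
  forall Q : C, cabs Q < 1 ->
  exists M, expansion 1 (radius r) M (fun n => csum (fun d => al d n * Q ^+ d)) (lhs_series q r Q).
Proof.
have r0 := radius_gt0 hr q1; have [B B0 hB] := expands_lhs_summand hr q0 q1.
have [al hal] := choice hB.
exists al, (fun n => B / radius r ^+ n); split=> [n d | Q Q1].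
  rewrite ler_pdivlMr ?exprn_gt0 //.
  exact: l1_le_term r0 (proj1 (hal d)).
have Q01 : 0 <= cabs Q < 1 by rewrite cabs_ge0.
exists (B / (1 - cabs Q)).
apply: (expansion_csum (M := B) r0 Q01 (al := fun d n => al d n * Q ^+ d)) => d.
have h := expansion_scale (Q ^+ d) r0 (hal d).
rewrite cabsX mulrC in h.
have e1 : (fun n => Q ^+ d * al d n) = (fun n => al d n * Q ^+ d).
  by apply/funext => n; rewrite mulrC.
have e2 : (fun z => Q ^+ d * lhs_summand q r d z) = (fun z => lhs_summand q r d z * Q ^+ d).
  by apply/funext => n; rewrite mulrC.
by rewrite e1 e2 in h.
Qed.

(** The Taylor coefficient of index m is a power series in Q of radius at
least 1. *)
Lemma mero_derive1n (z : C) m : cabs z < 1 -> mero_at z (fun Q => derive1n m (lhs_series q r Q) 1).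
Proof.
move=> z1; have [al [B [hB h]]] := lhs_series_expansion.
pose rh := (cabs z + 1) / 2.
have c0 := cabs_ge0 z.
have rh0 : 0 < rh by rewrite /rh; lra.
have rh1 : rh < 1 by rewrite /rh; lra.
have zrh : cabs z < rh by rewrite /rh; lra.
pose g Q := csum (fun d => al d m * Q ^+ d).
have B0 : 0 <= B m by apply: le_trans (hB m 0%N); exact: cabs_ge0.
have ag : expansion 0 rh (B m / (1 - rh)) (fun d => al d m) g.
  split=> [N|x _]; last by rewrite add0r.
  apply: le_trans (_ : \sum_(0 <= d < N) B m * rh ^+ d <= _).
    by apply: ler_sum => d _; rewrite ler_wpM2r ?hB ?exprn_ge0 // ltW.
  rewrite -mulr_sumr ler_wpM2l // big_mkord -[leRHS]mul1r.
  rewrite ler_pdivlMr ?subr_gt0 // mulrC -opprB mulNr -subrX1 opprB gerBl exprn_ge0 // ltW //.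
have hg : holomorphic_near g z by apply: expansion_holo ag _; rewrite subr0.
have mg : mero_at z (fun Q => m`!%:R * g Q).
  exact: mero_at_mul (mero_at_cst z _) (mero_at_holo hg).
apply: mero_at_eq mg _; apply/near_dnbhsC; exists (1 - cabs z); first by rewrite subr_gt0.
move=> w hw _; have w1 : cabs w < 1.
  by have := cabsD (w - z) z; rewrite subrK; lra.
have [M aw] := h w w1.
by rewrite (expansion_derive1n _ (radius_gt0 hr q1) aw).
Qed.

Lemma mero_cbinom (z : C) a : z != 0 -> mero_at z (fun Q => cbinom (ell q Q) a).
Proof.
move=> z0; apply: mero_at_mul; last exact: mero_at_cst.
apply: mero_at_prod => i; apply: mero_at_add; last exact: mero_at_cst.
exact: mero_ell.
Qed.

Lemma mero_lhs (z : C) k : (k < 4)%N -> z != 0 -> cabs z < 1 ->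
  mero_at z (fun Q => ((Ppow (ell q Q) * taylorP (lhs_series q r Q) : KP3 R) : {poly C})`_k).
Proof.
move=> k4 z0 z1.
have E : (fun Q => ((Ppow (ell q Q) * taylorP (lhs_series q r Q) : KP3 R) : {poly C})`_k) =
  (fun Q => \sum_(i < k.+1) ((-1) ^+ i * cbinom (ell q Q) i) *
     ((-1) ^+ (k - i) * derive1n (k - i) (lhs_series q r Q) 1 / (k - i)`!%:R)).
  by apply/funext => Q; exact: coef_Ppow_taylorP.
rewrite E; apply: mero_at_sum => i; apply: mero_at_mul.
  by apply: mero_at_mul; [exact: mero_at_cst | exact: mero_cbinom].
apply: mero_at_mul; last exact: mero_at_cst.
by apply: mero_at_mul; [exact: mero_at_cst | exact: mero_derive1n].
Qed.

Lemma taylorP_eq (f g : C -> C) : (forall k, (k < 4)%N -> derive1n k f 1 = derive1n k g 1) ->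
  taylorP f = taylorP g.
Proof.
move=> h; rewrite /taylorP; congr in_qpoly; apply/polyP => k; rewrite !coef_poly.
by case: ltnP => // k4; rewrite h.
Qed.

(** A perturbation divisible by (P - 1)^4 is not seen by a Taylor expansion
modulo (1 - P)^4. *)
Lemma taylorP_perturb (Q : C) (g : C -> C) : cabs Q < 1 -> cabs (q ^+ 2 / Q) < 1 ->
  (forall P, cabs (P - 1) < radius r -> g P = lhs_series q r Q P + (P - 1) ^+ 4 * tail q r Q P) ->
  taylorP (lhs_series q r Q) = taylorP g.
Proof.
move=> Q1 wQ hg; have r0 := radius_gt0 hr q1.
have [al [_ [_ /(_ Q Q1)[M aL]]]] := lhs_series_expansion.
have [M2 [be ab]] := expands_tail hr q0 q1 wQ.
have [M3 [ga [ag g0]]] := expansion_vanish r0 4 ab.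
have aS := expansion_add r0 aL ag.
have aG : expansion 1 (radius r) (M + M3) (fun n => csum (fun d => al d n * Q ^+ d) + ga n) g.
  apply: expansion_congr aS => h hh; rewrite hg //.
  by rewrite (_ : 1 + h - 1 = h) //; ring.
apply: taylorP_eq => k k4.
by rewrite (expansion_derive1n k r0 aL) (expansion_derive1n k r0 aG) g0 // addr0.
Qed.

Lemma near_theta_inv (c z : C) : c != 0 -> z != 0 ->
  \forall Q \near z^', theta q (c * (1 / Q)) != 0.
Proof.
move=> c0 z0; have c'0 : - q / c != 0 by rewrite mulf_neq0 ?invr_neq0 ?oppr_eq0.
apply: filterS (near_off_lattice q0 q1 c'0 z0) => Q [Q0 hQ].
have n0 : c * (1 / Q) != 0 by rewrite mul1r mulf_neq0 ?invr_neq0.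
have hq := off_lattice_inv q0 (mulf_neq0 c'0 Q0) hQ.
have e : q / (- q / c * Q) = - (c * (1 / Q)) by field; rewrite ?q0 ?c0 ?Q0 ?oppr_eq0.
rewrite e in hq; exact: (theta_neq0 q0 q1 n0 hq).
Qed.

Lemma near_eqlam (c z : C) : c != 0 -> z != 0 ->
  \forall Q \near z^', eqlam q c (1 / Q) != 0.
Proof.
move=> c0 z0; apply: filterS2 (near_theta_inv c0 z0) (near_theta_inv (oner_neq0 C) z0).
by move=> Q h1; rewrite (mul1r (1 / Q)) => h2; exact: (mulf_neq0 h2 (invr_neq0 h1)).
Qed.

Lemma near_annulus (z : C) : cabs q ^+ 2 < cabs z < 1 ->
  \forall Q \near z^', cabs q ^+ 2 < cabs Q < 1.
Proof.
move=> /andP[h1 h2]; apply/near_dnbhsC.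
exists (Num.min (cabs z - cabs q ^+ 2) (1 - cabs z)); first by rewrite lt_min !subr_gt0 h1.
move=> w; rewrite lt_min => /andP[w1 w2] _.
have a1 := cabsD (w - z) z; rewrite subrK in a1.
have a2 := cabs_dist z w; rewrite cabsC in a2.
by apply/andP; split; lra.
Qed.

Lemma near_all_lt (T : Type) (F : set_system T) (FF : Filter F) (P : nat -> T -> Prop) n :
  (forall j, \forall t \near F, P j t) -> \forall t \near F, forall j, (j < n)%N -> P j t.
Proof.
move=> h; elim: n => [|n IH]; first by apply: filterE => t j; rewrite ltn0.
apply: filterS2 IH (h n) => t IH hn j.
by rewrite ltnS leq_eqVlt => /orP[/eqP -> // | /IH].
Qed.

(** Meromorphy depends on punctured neighbourhoods only, so it passes from one
side of the identity to the other. *)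
Lemma mero_eqK_near (D : set C) (F G : C -> KP3 R) :
  (forall z, D z -> forall k : 'I_4, mero_at z (fun Q => (F Q : {poly C})`_k)) ->
  (forall z, D z -> \forall w \near z^', F w = G w) -> mero_eqK D F G.
Proof.
move=> hF hFG k; split=> [z Dz | z Dz | z Dz].
- exact: hF.
- by apply: mero_at_eq (hF z Dz k) _; apply: filterS (hFG z Dz) => w ->.
by apply: filterS (hFG z Dz) => w ->.
Qed.

End TaylorAtOne.

Unset Implicit Arguments.

Theorem corollary5p3 (R : realType) (q r : Cx R)
    (hr : r ^+ 5 = q) (hq0 : 0 < `|q|) (hq1 : `|q| < 1) :
  mero_eqK [set Q : Cx R | `|q| ^+ 2 < `|Q| < 1]
    (fun Q => Ppow (ell q Q) *
       taylorP (fun P =>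
         csum (fun d => (\prod_(1 <= i < 5) qpoch (P * r ^+ i) q d)
                        / qpoch (P * q) q d ^+ 4 * Q ^+ d)))
    (fun Q => Ppow (ell q Q) *
       taylorP (fun P =>
         (\prod_(1 <= i < 5) qpoch_oo (P * r ^+ i) q) / qpoch_oo (P * q) q ^+ 4
         * \sum_(1 <= j < 5)
             (qpochs_oo [:: q; q; P * r ^+ j * Q; q / (P * r ^+ j * Q)] q
              / qpochs_oo [:: P * r ^+ j; q / (P * r ^+ j); Q; q / Q] q
              * (qpoch_oo (r ^- j * q) q ^+ 4 * (eqlam q (r ^+ j) (1 / Q))^-1
                 / ((\prod_(1 <= i < 5 | i != j)
                       qpoch_oo (r ^ (i%:Z - j%:Z)) q) * qpoch_oo q q))
              * Wfun q r j (1 / Q)))).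
Proof.
have q0 : q != 0 by rewrite -normr_gt0.
have q1 : cabs q < 1 by rewrite -ltcR -cabsE.
have LE (Q P : Cx R) : csum (fun d => (\prod_(1 <= i < 5) qpoch (P * r ^+ i) q d)
    / qpoch (P * q) q d ^+ 4 * Q ^+ d) = lhs_series q r Q P.
  congr csum; apply/funext => d; congr (_ * _).
  by rewrite prod15 /lhs_summand big_split /= prodr_const card_ord exprVn.
have -> : (fun Q : Cx R => Ppow (ell q Q) * taylorP (fun P =>
      csum (fun d => (\prod_(1 <= i < 5) qpoch (P * r ^+ i) q d)
                        / qpoch (P * q) q d ^+ 4 * Q ^+ d))) =
    (fun Q => Ppow (ell q Q) * taylorP (lhs_series q r Q)).
  by apply/funext => Q; congr (_ * taylorP _); apply/funext => P; exact: LE.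
have dom (z : Cx R) : `|q| ^+ 2 < `|z| < 1 -> [/\ z != 0, cabs z < 1 & cabs q ^+ 2 < cabs z < 1].
  rewrite !cabsE -rmorphXn !ltcR /= => /andP[h1 h2].
  by split=> //; [rewrite -cabs_gt0; apply: le_lt_trans h1; rewrite exprn_ge0 ?cabs_ge0 | rewrite h1].
apply: mero_eqK_near => [z /dom[z0 z1 _] k | z /dom[z0 _ zD]].
  exact: (mero_lhs hr q0 q1 (ltn_ord k) z0 z1).
have N j := near_eqlam q0 q1 (qX_neq0 (r_neq0 hr q0) j) z0.
apply: filterS3 (near_annulus zD) (near_off_lattice q0 q1 (oner_neq0 _) z0)
  (near_all_lt _ 5 N).
move=> Q /andP[Qlo Q1] [Q0 Qr] hN; rewrite mul1r in Qr.
have hW j : (0 < j < 5)%N -> eqlam q (r ^+ j) (1 / Q) != 0.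
  by case/andP=> _; exact: hN.
congr (_ * _); apply: (taylorP_perturb hr q0 q1 Q1).
  by rewrite cabsM cabsV cabsX ltr_pdivrMr ?mul1r // cabs_gt0.
by move=> P hP; exact: connection_near_1.
Qed.
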